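(* Let $q\in\mathbb R$, $q\ne0$. The algebra $\Sigma^4_q$ is generated by $\{a,a^*,b,b^*,R\}$, where $$a=z_1z_4^*-z_2z_3^*,\qquad b=z_1z_3+q^{-1}z_2z_4,\qquad R=z_1z_1^*+z_2z_2^* .$$ They satisfy the following relations: $$Ra=q^{-2}aR,\quad Rb=q^2bR,\quad ab=q^3ba,\quad ab^*=q^{-1}b^*a,$$ $$aa^*+q^2bb^*=R(1-q^2R),$$ $$aa^*=q^2a^*a+(1-q^2)R^2,\qquad b^*b=q^4bb^*+(1-q^2)R .$$
   Context: $U_q(4)$ is the complex Hopf $*$-algebra generated by $\{t_{ij}\}_{i,j=1}^4$ and $D_q^{-1}$ with relations $t_{ik}t_{jk}=q\,t_{jk}t_{ik}$ and $t_{ki}t_{kj}=q\,t_{kj}t_{ki}$ for $i<j$; $t_{i\ell}t_{jk}=t_{jk}t_{i\ell}$ and $t_{ik}t_{j\ell}-t_{j\ell}t_{ik}=(q-q^{-1})t_{jk}t_{i\ell}$ for $i<j$, $k<\ell$; $D_qD_q^{-1}=D_q^{-1}D_q=1$, where $D_q=\sum_{\sigma\in P_4}(-q)^{\ell(\sigma)}t_{\sigma(1)1}\cdots t_{\sigma(4)4}$ is the (central) quantum determinant ($P_4$ = permutations of $4$ elements, $\ell(\sigma)$ = length). $\Delta(t_{ij})=\sum_kt_{ik}\otimes t_{kj}$, $\Delta(D_q)=D_q\otimes D_q$, $\epsilon(t_{ij})=\delta_{ij}$, $\epsilon(D_q)=1$; $S$ is the antipode, $t_{ij}^*=S(t_{ji})$,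 $D_q^*=D_q^{-1}$. The quantum 7-sphere $\mathbb S^7_q$ is the $*$-subalgebra of coinvariants $\{x\in U_q(4): (\ell\otimes\mathrm{id})\Delta x=\ell(1)\otimes x\}$, where $\ell:U_q(4)\to U_q(4)/\mathcal L\simeq U_q(3)$ is the quotient by the Hopf ideal $\mathcal L=U_q(4)\,\mathrm{Span}\{t_{j4},t_{4j},t_{44}-1\}_{j=1,2,3}$. It is the $*$-algebra generated by $z_i=t_{4i}$, $i=1,\dots,4$, with relations $z_iz_j=qz_jz_i$ ($i<j$), $z_j^*z_i=qz_iz_j^*$ ($i\ne j$), $z_k^*z_k=z_kz_k^*+(1-q^2)\sum_{j<k}z_jz_j^*$, $\sum_{k=1}^4z_kz_k^*=1$; moreover $\Delta(z_i)=\sum_jz_j\otimes t_{ji}$. Let $\mathcal R$ be the right ideal of $U_q(4)$ generated by $t_{13},t_{31},t_{14},t_{41},t_{24},t_{42},t_{23},t_{32}$, $t_{11}-t_{44}$, $t_{12}+t_{43}$, $t_{21}+t_{34}$, $t_{22}-t_{33}$, $t_{11}t_{22}-q\,t_{12}t_{21}-1$. It is a two-sided coideal; let $r:U_q(4)\to U_q(4)/\mathcal R$ be the quotient map (a morphism of coalgebras and right $U_q(4)$-modules), and $\Delta_r=(\mathrm{id}\otimes r)\Delta$. The quantum 4-sphere is $$\Sigma^4_q=\{x\in\mathbb S^7_q:\ \Delta_r(x)=x\otimes r(1)\}.$$ *)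

(* Defs.v *)
From HB Require Import structures.
From mathcomp Require Import all_boot all_order all_algebra.
From mathcomp Require Import generic_quotient ring_quotient perm finmap.
From mathcomp Require Import boolp classical_sets reals.
From mathcomp Require Import complex monalg.

Set Implicit Arguments.
Unset Strict Implicit.
Unset Printing Implicit Defensive.

Import Order.TTheory GRing.Theory Num.Theory.

Local Open Scope ring_scope.
Local Open Scope quotient_scope.

Section LinearQuotient.
Context {K : nzRingType} {V : lmodType K}.

(* The smallest linear subspace containing A. *)
Definition lspan (A : set V) : {pred V} :=
  fun x => `[< forall P : {pred V}, submod_closed P ->
                 (forall a, A a -> a \in P) -> x \in P >].

Lemma lspanP A x : reflect (forall P : {pred V}, submod_closed P ->
    (forall a, A a -> a \in P) -> x \in P) (x \in lspan A).
Proof. exact: asboolP. Qed.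

Lemma mem_lspan (A : set V) x : A x -> x \in lspan A.
Proof. by move=> Ax; apply/lspanP => P _; exact. Qed.

Lemma lspan_submod_closed A : submod_closed (lspan A).
Proof.
split=> [|c u v /lspanP Au /lspanP Av]; apply/lspanP => P Psub AP.
  by case: Psub.
by case: (Psub) => _; apply; [exact: Au | exact: Av].
Qed.

HB.instance Definition _ A :=
  GRing.isSubmodClosed.Build K V (lspan A)
    (GRing.submod_closed_semi (lspan_submod_closed A)).

Definition lquot (A : set V) : Type := Quotient.quot (lspan A).

HB.instance Definition _ A := GRing.Zmodule.on (lquot A).
HB.instance Definition _ A := EqQuotient.on (lquot A).

Definition lpi (A : set V) (x : V) : lquot A := \pi_(lquot A) x.
Definition lrepr (A : set V) (x : lquot A) : V := @repr _ (lquot A) x.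

Lemma lreprK A : cancel (@lrepr A) (@lpi A).
Proof. exact: reprK. Qed.

Lemma lpi_zmod_morphism A : zmod_morphism (@lpi A).
Proof. by move=> x y; exact: (raddfB (\pi_(Quotient.quot (lspan A)))). Qed.

HB.instance Definition _ A :=
  GRing.isZmodMorphism.Build V (lquot A) (@lpi A) (@lpi_zmod_morphism A).

Lemma lpi_eq A x y : (lpi A x = lpi A y) <-> (x - y \in lspan A).
Proof.
rewrite Quotient.idealrBE; split => [xy|/eqP xy]; last exact: xy.
exact/eqP/xy.
Qed.

Lemma lpi_eq0 A x : (lpi A x = 0) <-> (x \in lspan A).
Proof. by rewrite -(raddf0 (lpi A)) lpi_eq subr0. Qed.

Definition lquot_scale A (c : K) (x : lquot A) : lquot A :=
  lpi A (c *: lrepr x).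

Lemma lquot_scale_pi A c x : lquot_scale c (lpi A x) = lpi A (c *: x).
Proof.
apply/lpi_eq; rewrite -scalerBr rpredZ //; apply/lpi_eq.
by rewrite lreprK.
Qed.

Fact lquot_scaleA A (a b : K) (x : lquot A) :
  lquot_scale a (lquot_scale b x) = lquot_scale (a * b) x.
Proof. by rewrite -[x]lreprK !lquot_scale_pi scalerA. Qed.

Fact lquot_scale1 A : left_id 1 (@lquot_scale A).
Proof. by move=> x; rewrite -[x]lreprK lquot_scale_pi scale1r. Qed.

Fact lquot_scaleDr A : right_distributive (@lquot_scale A) +%R.
Proof.
move=> c x y; rewrite -[x]lreprK -[y]lreprK -raddfD !lquot_scale_pi.
by rewrite scalerDr raddfD.
Qed.

Fact lquot_scaleDl A (x : lquot A) :
  {morph (@lquot_scale A)^~ x : a b / a + b}.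
Proof.
by move=> a b; rewrite -[x]lreprK !lquot_scale_pi scalerDl raddfD.
Qed.

HB.instance Definition _ A := GRing.Zmodule_isLmodule.Build K (lquot A)
  (@lquot_scaleA A) (@lquot_scale1 A) (@lquot_scaleDr A) (@lquot_scaleDl A).

Fact lpi_scalable A : scalable (@lpi A).
Proof. by move=> c x; exact: esym (lquot_scale_pi A c x). Qed.

HB.instance Definition _ A :=
  GRing.isScalable.Build K V (lquot A) *:%R (@lpi A) (@lpi_scalable A).

End LinearQuotient.

Section FreeLift.
Context {K : fieldType} {T : choiceType} {X : lmodType K}.

(* The extension to the free module on T of h : T -> X, along the change of
   scalars s; s is the identity, or complex conjugation for antilinear maps. *)
Definition free_lift (s : K -> K) (h : T -> X) (g : {malg K[T]}) : X :=
  \sum_(k <- msupp g) s g@_k *: h k.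

Variables (s : {rmorphism K -> K}) (h : T -> X).

Lemma free_liftEw (d : {fset T}) g : (msupp g `<=` d)%fset ->
  free_lift s h g = \sum_(k <- d) s g@_k *: h k.
Proof.
move=> le; rewrite [LHS](big_fset_incl _ le) => //= x xd /mcoeff_outdom ->.
by rewrite rmorph0 scale0r.
Qed.

Lemma free_liftU c k : free_lift s h << c *g k >> = s c *: h k.
Proof. by rewrite (free_liftEw msuppU_le) big_seq_fset1 mcoeffUU. Qed.

Lemma free_lift_zmod_morphism : zmod_morphism (free_lift s h).
Proof.
move=> x y; pose d := (msupp x `|` msupp y)%fset.
have xd : (msupp x `<=` d)%fset by exact: fsubsetUl.
have yd : (msupp y `<=` d)%fset by exact: fsubsetUr.
have xyd : (msupp (x - y) `<=` d)%fset by exact: msuppB_le.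
rewrite (free_liftEw xd) (free_liftEw yd) (free_liftEw xyd) -sumrB.
by apply: eq_bigr => k _; rewrite mcoeffB rmorphB scalerBl.
Qed.

HB.instance Definition _ := GRing.isZmodMorphism.Build {malg K[T]} X
  (free_lift s h) free_lift_zmod_morphism.

Lemma free_liftZ c g : free_lift s h (c *: g) = s c *: free_lift s h g.
Proof.
rewrite (free_liftEw (msuppZ_le c g)) scaler_sumr; apply: eq_bigr => k _.
by rewrite mcoeffZ rmorphM scalerA.
Qed.

End FreeLift.

Section Tensor.
Context {K : fieldType}.

Inductive tensor_rel (V W : lmodType K) : set {malg K[(V * W)%type]} :=
| TensorAddl v v' w : tensor_rel (<< (v + v', w) >> - << (v, w) >> - << (v', w) >>)
| TensorAddr v w w' : tensor_rel (<< (v, w + w') >> - << (v, w) >> - << (v, w') >>)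
| TensorScalel c v w : tensor_rel (<< (c *: v, w) >> - c *: << (v, w) >>)
| TensorScaler c v w : tensor_rel (<< (v, c *: w) >> - c *: << (v, w) >>).

Definition tensor (V W : lmodType K) : Type := lquot (@tensor_rel V W).
HB.instance Definition _ (V W : lmodType K) := GRing.Lmodule.on (tensor V W).

Definition tens (V W : lmodType K) (v : V) (w : W) : tensor V W :=
  lpi (@tensor_rel V W) << (v, w) >>.

(* The map v (x) w |-> f v w.  It is computed on representatives, hence
   meaningful only for f additive in each argument and such that
   f (c *: v) w = f v (c *: w) = s c *: f v w; see tens_liftE below. *)
Definition tens_lift (V W X : lmodType K) (s : K -> K) (f : V -> W -> X)
  (x : tensor V W) : X := free_lift s (fun p => f p.1 p.2) (lrepr x).

Definition tens_map (V V' W W' : lmodType K) (f : V -> V') (g : W -> W') :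
  tensor V W -> tensor V' W' := tens_lift idfun (fun v w => tens (f v) (g w)).

Definition tens_assoc (V W X : lmodType K) :
  tensor (tensor V W) X -> tensor V (tensor W X) :=
  tens_lift idfun (fun vw x =>
    tens_lift idfun (fun v w => tens v (tens w x)) vw).

Definition tens_mul (A : lalgType K) (x y : tensor A A) : tensor A A :=
  tens_lift idfun (fun a b =>
    tens_lift idfun (fun c d => tens (a * c) (b * d)) y) x.

End Tensor.

Section TensorTheory.
Context {K : fieldType} {V W : lmodType K}.

Lemma tensDl (v v' : V) (w : W) : tens (v + v') w = tens v w + tens v' w.
Proof.
apply/eqP; rewrite -subr_eq0 opprD addrA -!raddfB; apply/eqP/lpi_eq0.
exact/mem_lspan/TensorAddl.
Qed.

Lemma tensDr (v : V) (w w' : W) : tens v (w + w') = tens v w + tens v w'.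
Proof.
apply/eqP; rewrite -subr_eq0 opprD addrA -!raddfB; apply/eqP/lpi_eq0.
exact/mem_lspan/TensorAddr.
Qed.

Lemma tensZl c (v : V) (w : W) : tens (c *: v) w = c *: tens v w.
Proof.
rewrite /tens -[RHS]linearZ; apply/lpi_eq.
exact/mem_lspan/TensorScalel.
Qed.

Lemma tensZr c (v : V) (w : W) : tens v (c *: w) = c *: tens v w.
Proof.
rewrite /tens -[RHS]linearZ; apply/lpi_eq.
exact/mem_lspan/TensorScaler.
Qed.

Lemma tens_ind (P : tensor V W -> Prop) : P 0 ->
  (forall c v w x, P x -> P (c *: tens v w + x)) -> forall x, P x.
Proof.
move=> P0 PD x; rewrite -[x]lreprK [lrepr x]monalgE raddf_sum.
elim/big_rec: _ => // -[v w] y _ Py.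
have -> : << (lrepr x)@_(v, w) *g (v, w) >> =
          (lrepr x)@_(v, w) *: << (v, w) >> :> {malg K[(V * W)%type]}.
  by apply/malgP => k; rewrite mcoeffZ !mcoeffU mulrnAr mulr1.
by rewrite /= linearZ; exact: PD.
Qed.

Section Lift.
Context {X : lmodType K} (s : {rmorphism K -> K}) (f : V -> W -> X).
Hypothesis fDl : forall v v' w, f (v + v') w = f v w + f v' w.
Hypothesis fDr : forall v w w', f v (w + w') = f v w + f v w'.
Hypothesis fZl : forall c v w, f (c *: v) w = s c *: f v w.
Hypothesis fZr : forall c v w, f v (c *: w) = s c *: f v w.

Let F := free_lift s (fun p : V * W => f p.1 p.2).

Lemma free_lift_tensor_rel x : x \in lspan (@tensor_rel K V W) -> F x = 0.
Proof.
move=> /lspanP/(_ [pred x | F x == 0]) /= P; apply/eqP/P; first split=> /=.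
- by rewrite inE /F raddf0.
- move=> c u v; rewrite !inE => /eqP Fu /eqP Fv.
  by rewrite /F raddfD /= free_liftZ -/(F u) -/(F v) Fu Fv scaler0 addr0.
- move=> _ []; rewrite /F.
  + move=> v v' w; rewrite inE !raddfB /= !free_liftU /= rmorph1 !scale1r fDl.
    by rewrite addrAC addrK subrr.
  + move=> v w w'; rewrite inE !raddfB /= !free_liftU /= rmorph1 !scale1r fDr.
    by rewrite addrAC addrK subrr.
  + move=> c v w; rewrite inE raddfB /= free_liftZ !free_liftU /= rmorph1 !scale1r.
    by rewrite fZl subrr.
  + move=> c v w; rewrite inE raddfB /= free_liftZ !free_liftU /= rmorph1 !scale1r.
    by rewrite fZr subrr.
Qed.

Lemma tens_lift_pi x : tens_lift s f (lpi (@tensor_rel K V W) x) = F x.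
Proof.
apply/eqP; rewrite -subr_eq0 /tens_lift -/F /F -raddfB; apply/eqP.
by apply/free_lift_tensor_rel/lpi_eq; rewrite lreprK.
Qed.

Lemma tens_liftE v w : tens_lift s f (tens v w) = f v w.
Proof. by rewrite tens_lift_pi /F free_liftU rmorph1 scale1r. Qed.

Lemma tens_liftD x y :
  tens_lift s f (x + y) = tens_lift s f x + tens_lift s f y.
Proof.
by rewrite -[x]lreprK -[y]lreprK -raddfD !tens_lift_pi /F raddfD.
Qed.

Lemma tens_liftZ c x : tens_lift s f (c *: x) = s c *: tens_lift s f x.
Proof. by rewrite -[x]lreprK -linearZ !tens_lift_pi /F free_liftZ. Qed.

End Lift.
End TensorTheory.

Lemma tens_mapE (K : fieldType) (V V' W W' : lmodType K) (f : {linear V -> V'})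
  (g : {linear W -> W'}) (v : V) (w : W) :
  tens_map f g (tens v w) = tens (f v) (g w).
Proof.
apply: (tens_liftE (s := idfun)).
- by move=> ? ? ?; rewrite linearD tensDl.
- by move=> ? ? ?; rewrite linearD tensDr.
- by move=> ? ? ?; rewrite linearZ tensZl.
- by move=> ? ? ?; rewrite linearZ tensZr.
Qed.

Lemma tens_assocE (K : fieldType) (V W X : lmodType K) (v : V) (w : W) (x : X) :
  tens_assoc (tens (tens v w) x) = tens v (tens w x).
Proof.
pose f := fun (x : X) (v : V) (w : W) => tens v (tens w x).
have fDl y v1 v2 w1 : f y (v1 + v2) w1 = f y v1 w1 + f y v2 w1.
  by rewrite /f tensDl.
have fDr y v1 w1 w2 : f y v1 (w1 + w2) = f y v1 w1 + f y v1 w2.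
  by rewrite /f tensDl tensDr.
have fZl y c v1 w1 : f y (c *: v1) w1 = idfun c *: f y v1 w1.
  by rewrite /f tensZl.
have fZr y c v1 w1 : f y v1 (c *: w1) = idfun c *: f y v1 w1.
  by rewrite /f tensZl tensZr.
pose F y := tens_lift idfun (f y).
have FE y v1 w1 : F y (tens v1 w1) = f y v1 w1.
  exact: (tens_liftE (s := idfun) (fDl y) (fDr y) (fZl y) (fZr y)).
have FD y u1 u2 : F y (u1 + u2) = F y u1 + F y u2.
  exact: (tens_liftD (s := idfun) (fDl y) (fDr y) (fZl y) (fZr y)).
have FZ y c u : F y (c *: u) = c *: F y u.
  exact: (tens_liftZ (s := idfun) (fDl y) (fDr y) (fZl y) (fZr y)).
have F0 y : F y 0 = 0 by rewrite -(scale0r 0) FZ scale0r.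
have FDr u y1 y2 : F (y1 + y2) u = F y1 u + F y2 u.
  move: u; apply: tens_ind => [|c v1 w1 u IH]; first by rewrite !F0 addr0.
  by rewrite 3!FD IH 3!FZ 3!FE /f 2!tensDr scalerDr addrACA.
have FZr u c y : F (c *: y) u = c *: F y u.
  move: u; apply: tens_ind => [|d v1 w1 u IH]; first by rewrite !F0 scaler0.
  by rewrite 2!FD IH 2!FZ 2!FE /f 2!tensZr scalerDr !scalerA mulrC.
rewrite -[RHS]/(f x v w) -FE.
by apply: (tens_liftE (s := idfun) (f := fun u y => F y u)).
Qed.

Lemma tens_mulE (K : fieldType) (A : algType K) (a b c d : A) :
  tens_mul (tens a b) (tens c d) = tens (a * c) (b * d).
Proof.
pose f := fun a b c d : A => tens (a * c) (b * d).
have fDl x y v1 v2 w1 : f x y (v1 + v2) w1 = f x y v1 w1 + f x y v2 w1.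
  by rewrite /f mulrDr tensDl.
have fDr x y v1 w1 w2 : f x y v1 (w1 + w2) = f x y v1 w1 + f x y v1 w2.
  by rewrite /f mulrDr tensDr.
have fZl x y k v1 w1 : f x y (k *: v1) w1 = idfun k *: f x y v1 w1.
  by rewrite /f -scalerAr tensZl.
have fZr x y k v1 w1 : f x y v1 (k *: w1) = idfun k *: f x y v1 w1.
  by rewrite /f -scalerAr tensZr.
have fE x y := tens_liftE (s := idfun) (fDl x y) (fDr x y) (fZl x y) (fZr x y).
rewrite /tens_mul (tens_liftE (s := idfun)) => [|x x' y|x y y'|k x y|k x y];
  by rewrite !fE /f ?mulrDl ?tensDl ?tensDr -?scalerAl ?tensZl ?tensZr.
Qed.

Record hopfStarAlg (K : numClosedFieldType) := HopfStarAlg {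
  hopf_alg :> algType K;
  Delta : {linear hopf_alg -> tensor hopf_alg hopf_alg};
  counit : {linear hopf_alg -> K^o};
  antipode : {linear hopf_alg -> hopf_alg};
  star : hopf_alg -> hopf_alg;
  hopf_coassoc : forall x, tens_assoc (tens_map Delta idfun (Delta x)) =
    tens_map idfun Delta (Delta x);
  hopf_counitl : forall x, tens_lift idfun (fun u v => counit u *: v) (Delta x) = x;
  hopf_counitr : forall x, tens_lift idfun (fun u v => counit v *: u) (Delta x) = x;
  hopf_Delta1 : Delta 1 = tens 1 1;
  hopf_DeltaM : forall x y, Delta (x * y) = tens_mul (Delta x) (Delta y);
  hopf_counit1 : counit 1 = 1;
  hopf_counitM : forall x y, counit (x * y) = counit x * counit y :> K;
  hopf_antipodel : forall x, tens_lift idfun (fun u v => antipode u * v) (Delta x) =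
    counit x *: 1;
  hopf_antipoder : forall x, tens_lift idfun (fun u v => u * antipode v) (Delta x) =
    counit x *: 1;
  hopf_starD : forall x y, star (x + y) = star x + star y;
  hopf_starZ : forall c x, star (c *: x) = c^* *: star x;
  hopf_starM : forall x y, star (x * y) = star y * star x;
  hopf_starK : forall x, star (star x) = x;
  hopf_Delta_star : forall x, Delta (star x) =
    tens_lift Num.conj (fun u v => tens (star u) (star v)) (Delta x);
  hopf_counit_star : forall x, counit (star x) = (counit x)^* :> K
}.

Section Presentation.
Context {K : fieldType}.

Definition two_sided_ideal (A : lalgType K) (S : set A) : {pred A} :=
  lspan (fun x => exists u s v, S s /\ x = u * s * v).

Definition left_ideal (A : lalgType K) (S : set A) : set A :=
  fun x => x \in lspan (fun y => exists u s, S s /\ y = u * s).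

Definition right_ideal (A : lalgType K) (S : set A) : set A :=
  fun x => x \in lspan (fun y => exists s u, S s /\ y = s * u).

Definition gen_subalg (A : lalgType K) (S : set A) : set A :=
  fun x => forall P : {pred A}, subalg_closed P ->
             (forall s, S s -> s \in P) -> x \in P.

Definition free_eval (G : choiceType) (A : lalgType K) (gen : G -> A)
    (p : {malg K[{fmonom G}]}) : A :=
  \sum_(m <- msupp p) p@_m *: \prod_(g <- (m : seq G)) gen g.

Definition presented_by (G : choiceType) (rel : set {malg K[{fmonom G}]})
    (A : lalgType K) (gen : G -> A) : Prop :=
  (forall a, exists p, free_eval gen p = a) /\
  (forall p, free_eval gen p = 0 <-> p \in two_sided_ideal rel).

End Presentation.

(* The number of inversions of s, i.e. its length as a Coxeter group element. *)
Definition perm_length n (s : 'S_n) : nat :=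
  #|[set p : 'I_n * 'I_n | (p.1 < p.2)%N && (s p.2 < s p.1)%N]|.

Section Uq4.
Context {K : numClosedFieldType}.

Definition qdet (A : lalgType K) (q : K) (t : 'I_4 -> 'I_4 -> A) : A :=
  \sum_(s : 'S_4) (- q) ^+ perm_length s *: \prod_(j < 4) t (s j) j.

(* [Some (i, j)] stands for t_ij and [None] for the inverse of D_q. *)
Definition Uq4_gen : choiceType := option ('I_4 * 'I_4).

Local Notation free_alg := {malg K[{fmonom Uq4_gen}]}.

Definition free_t (i j : 'I_4) : free_alg := << fmu (Some (i, j) : Uq4_gen) >>.
Definition free_Dinv : free_alg := << fmu (None : Uq4_gen) >>.

Inductive Uq4_rel (q : K) : set free_alg :=
| Uq4_col (i j k : 'I_4) : (i < j)%N ->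
    Uq4_rel q (free_t i k * free_t j k - q *: (free_t j k * free_t i k))
| Uq4_row (i j k : 'I_4) : (i < j)%N ->
    Uq4_rel q (free_t k i * free_t k j - q *: (free_t k j * free_t k i))
| Uq4_comm (i j k l : 'I_4) : (i < j)%N -> (k < l)%N ->
    Uq4_rel q (free_t i l * free_t j k - free_t j k * free_t i l)
| Uq4_cross (i j k l : 'I_4) : (i < j)%N -> (k < l)%N ->
    Uq4_rel q (free_t i k * free_t j l - free_t j l * free_t i k
               - (q - q^-1) *: (free_t j k * free_t i l))
| Uq4_detVr : Uq4_rel q (qdet q free_t * free_Dinv - 1)
| Uq4_detVl : Uq4_rel q (free_Dinv * qdet q free_t - 1).

(* [two_sided_ideal] is the kernel, so U is the presented algebra up to
   isomorphism; the remaining clauses determine its Hopf *-algebra structure. *)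
Definition is_Uq4 (q : K) (U : hopfStarAlg K) (t : 'I_4 -> 'I_4 -> U)
    (Dinv : U) : Prop :=
  let Dq := qdet q t in
  presented_by (Uq4_rel q)
    (fun g : Uq4_gen => if g is Some (i, j) then t i j else Dinv)
  /\ [/\ forall i j, Delta U (t i j) = \sum_k tens (t i k) (t k j),
         Delta U Dq = tens Dq Dq,
         forall i j, counit U (t i j) = (i == j)%:R
       & counit U Dq = 1]
  /\ (forall i j, star (t i j) = antipode U (t j i)) /\ star Dq = Dinv.

(* The index k of {1, 2, 3, 4}, as an element of 'I_4 = {0, 1, 2, 3}. *)
Definition idx (k : nat) : 'I_4 := inord k.-1.

Section Spheres.
Context {U : hopfStarAlg K} (q : K) (t : 'I_4 -> 'I_4 -> U).
Local Notation "'t_(' i , j )" := (t (idx i) (idx j)).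

Definition ideal_L : set U := left_ideal (fun x =>
  x = t_(4, 4) - 1 \/
  exists2 j, j \in [:: 1; 2; 3]%N & x = t_(j, 4) \/ x = t_(4, j)).

Definition ideal_R : set U := right_ideal (fun x =>
  x \in [:: t_(1, 3); t_(3, 1); t_(1, 4); t_(4, 1);
            t_(2, 4); t_(4, 2); t_(2, 3); t_(3, 2);
            t_(1, 1) - t_(4, 4); t_(1, 2) + t_(4, 3);
            t_(2, 1) + t_(3, 4); t_(2, 2) - t_(3, 3);
            t_(1, 1) * t_(2, 2) - q *: (t_(1, 2) * t_(2, 1)) - 1]).

Definition sphere7 : set U := fun x =>
  tens_map (lpi ideal_L) idfun (Delta U x) = tens (lpi ideal_L 1) x.

Definition sphere4 : set U := fun x =>
  sphere7 x /\ tens_map idfun (lpi ideal_R) (Delta U x) = tens x (lpi ideal_R 1).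

End Spheres.
End Uq4.

(* Main.v *)
(* The 7-sphere is generated by the z_i and z_i^*.  Indeed, the block of (t_ij)
   without row 4 and column k carries a morphism from U_q(3) = U_q(4)/L to U_q(4) localized at
   z_k^*; composing it with the involution and applying it to the coinvariance identity of x
   shows that z_k^n x lies in the algebra B of the z_i, z_i^* for n large, and 1 is in the left
   ideal sum_k B z_k^n.

   The functionals X and Y, read off two 3x3 triangular representations, vanish on the right
   ideal R, so x |-> x_(1) X(x_(2)) and its analogue for Y are left linear over the
   coinvariants and annihilate them.  Let A be the algebra generated by a, a^*, b, b^*, R.
   After inverting R, respectively a polynomial in R with constant term 1, every element of B
   is an A-linear combination of ordered monomials in z_1, z_2, z_1^*, z_2^*, respectively in
   z_4, z_3, z_4^*, z_3^*.  On torus-invariant monomials of degree 2n the composite of the two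
   operators is a nonzero scalar depending on n only, up to lower degree; hence a coinvariant
   combination lies in A.  So R^N x and f(R) x lie in A with f(0) = 1, and therefore so does x. *)
Require Import Defs.
From HB Require Import structures.
From mathcomp Require Import all_boot all_order all_algebra.
From mathcomp Require Import ring zify.
From mathcomp Require Import classical_sets reals complex.
From mathcomp Require Import boolp functions perm finmap monalg.

Set Implicit Arguments.
Unset Strict Implicit.
Unset Printing Implicit Defensive.

Import Order.TTheory GRing.Theory Num.Theory.

Local Open Scope ring_scope.

(** * Noncommutative rewriting over Laurent polynomials in q *)

(** At q = 1 the 4-sphere is the quotient of the 7-sphere by SU(2), the quaternionic projective
    line, with the two charts R != 0 and R != 1. Along the fibre functions split into spins; the two
    operators are raising and lowering operators, and their composite is to leading order a Casimir,
    nonzero on every spin n > 0. [U] is known only through its presentation: neither a basis of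
    monomials nor the absence of zero divisors is at hand. So no coordinate is inverted and no
    coefficients are compared: localizations become germs of sequences or explicit left
    denominators, and the elimination acts on expressions. The 3x3 shape comes from the right ideal.
    The matrix coefficient dual to t_12 alone does not vanish on t_12 + t_43, so two skew primitive
    functionals with opposite signs are added. The relations of U_q(4) fix the ratios of their
    diagonal characters, and the first character of each functional must annihilate the ideal, which
    leaves a common last character. Reality of q gives the adjoint relations and also makes all
    q-integers in base q^2 and q^-2 positive, for negative q too. *)

(* A triple ((c, e), w) stands for c q^e w, w being a word on the alphabet nat. *)
Definition qpoly := seq ((int * int) * seq nat).

(** The concrete operations on [int] let [vm_compute] handle coefficients without passing through
    the ring structures. *)
Definition qcoef_mul (c d : int * int) : int * int :=
  (intRing.mulz c.1 d.1, intZmod.addz c.2 d.2).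

Definition qletter (a : nat) : qpoly := [:: ((1, 0), [:: a])].
Definition qconst (c e : int) : qpoly := [:: ((c, e), [::])].
Definition qmul (p r : qpoly) : qpoly :=
  [seq (qcoef_mul m.1 n.1, m.2 ++ n.2) | m <- p, n <- r].
Definition qscale (c e : int) (p : qpoly) : qpoly :=
  [seq (qcoef_mul (c, e) m.1, m.2) | m <- p].
Definition qsub (p r : qpoly) : qpoly := p ++ qscale (-1) 0 r.
Definition qsum (s : seq nat) (f : nat -> qpoly) : qpoly := flatten (map f s).

Arguments qmul : simpl never.
Arguments qscale : simpl never.
Arguments qsub : simpl never.
Arguments qsum : simpl never.

(** Equal terms are merged and zero coefficients dropped, so that a vanishing expression can end as
    the empty list, which is what [qnull] tests. *)
Fixpoint qinsert (m : (int * int) * seq nat) (p : qpoly) : qpoly :=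
  if p is n :: p' then
    if (m.2 == n.2) && (m.1.2 == n.1.2) then
      let c := intZmod.addz m.1.1 n.1.1 in
      if c == 0 then p' else ((c, m.1.2), m.2) :: p'
    else n :: qinsert m p'
  else [:: m].
Definition qcollect (p : qpoly) : qpoly := foldr qinsert [::] p.

Section Reduction.
Variable rule : nat -> nat -> option qpoly.

Fixpoint qreduce_word (w : seq nat) : option (seq nat * qpoly * seq nat) :=
  if w is a :: w' then
    if w' is b :: w'' then
      if rule a b is Some r then Some ([::], r, w'')
      else if qreduce_word w' is Some (u, r, v) then Some (a :: u, r, v)
      else None
    else None
  else None.

Definition qreduce_term (m : (int * int) * seq nat) : qpoly :=
  if qreduce_word m.2 is Some (u, r, v) then
    [seq (qcoef_mul m.1 n.1, u ++ n.2 ++ v) | n <- r]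
  else [:: m].

Definition qreduce (p : qpoly) : qpoly := qcollect (flatten (map qreduce_term p)).

(** A certificate for identities: only its soundness [qnullP] is used, so neither confluence nor
    termination of the rules has to be known, and the fuel merely has to suffice for the case at
    hand. *)
Definition qnull (fuel : nat) (p : qpoly) : bool :=
  nilp (iter fuel qreduce p).
End Reduction.

Section Evaluation.
Context {K : fieldType} {A : algType K}.
Variables (q : K) (env : nat -> A).
Hypothesis q0 : q != 0.

Definition qword (w : seq nat) : A := \prod_(a <- w) env a.
Definition qcoef (c : int * int) : K := c.1%:~R * q ^ c.2.
Definition qeval (p : qpoly) : A := \sum_(m <- p) qcoef m.1 *: qword m.2.

Lemma qcoefM c d : qcoef (qcoef_mul c d) = qcoef c * qcoef d.
Proof.
rewrite /qcoef /qcoef_mul /= -[intRing.mulz _ _]/(c.1 * d.1).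
by rewrite -[intZmod.addz _ _]/(c.2 + d.2) intrM expfzDr // mulrACA.
Qed.

Lemma qeval_cat p r : qeval (p ++ r) = qeval p + qeval r.
Proof. by rewrite /qeval big_cat. Qed.

Lemma qevalM p r : qeval (qmul p r) = qeval p * qeval r.
Proof.
rewrite /qeval /qmul big_allpairs_dep /= mulr_suml; apply: eq_bigr => m _.
rewrite mulr_sumr; apply: eq_bigr => n _.
by rewrite qcoefM /qword big_cat -scalerAl -scalerAr scalerA.
Qed.

Lemma qevalZ c e p : qeval (qscale c e p) = (c%:~R * q ^ e) *: qeval p.
Proof.
rewrite /qeval /qscale big_map scaler_sumr; apply: eq_bigr => m _ /=.
by rewrite qcoefM scalerA.
Qed.

Lemma qevalB p r : qeval (qsub p r) = qeval p - qeval r.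
Proof. by rewrite /qsub qeval_cat qevalZ expr0z mulr1 scaleN1r. Qed.

Lemma qeval_sum s f : qeval (qsum s f) = \sum_(i <- s) qeval (f i).
Proof.
elim: s => [|i s IH]; first by rewrite /qeval !big_nil.
by rewrite /qsum /= qeval_cat IH big_cons.
Qed.

Lemma qeval_letter a : qeval (qletter a) = env a.
Proof.
by rewrite /qeval big_seq1 /qcoef expr0z mulr1 scale1r /qword big_seq1.
Qed.

Lemma qeval_const c e : qeval (qconst c e) = (c%:~R * q ^ e) *: 1.
Proof. by rewrite /qeval big_seq1 /qword big_nil. Qed.

Lemma qeval_cons m p : qeval (m :: p) = qcoef m.1 *: qword m.2 + qeval p.
Proof. by rewrite /qeval big_cons. Qed.

Lemma qeval_insert m p : qeval (qinsert m p) = qeval (m :: p).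
Proof.
elim: p => [|n p IH] //=; case: ifP => [/andP[/eqP ew /eqP ee]|_]; last first.
  by rewrite !qeval_cons IH !qeval_cons addrCA.
rewrite !qeval_cons; set c := intZmod.addz _ _.
have cE : qcoef (c, m.1.2) = qcoef m.1 + qcoef n.1.
  by rewrite /qcoef /= /c -[intZmod.addz _ _]/(m.1.1 + n.1.1) intrD mulrDl ee.
rewrite addrA -ew -scalerDl -cE; case: eqP => [c0|_]; last by rewrite qeval_cons.
by rewrite /qcoef /= c0 mul0r scale0r add0r.
Qed.

Lemma qeval_collect p : qeval (qcollect p) = qeval p.
Proof.
by elim: p => [|m p IH] //=; rewrite qeval_insert !qeval_cons IH.
Qed.

Variable rule : nat -> nat -> option qpoly.
Hypothesis ruleP : forall a b r, rule a b = Some r -> env a * env b = qeval r.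

Lemma qreduce_wordP w u r v : qreduce_word rule w = Some (u, r, v) ->
  qword w = qword u * qeval r * qword v.
Proof.
elim: w u => [|a [|b w] IH] u //.
have -> : qreduce_word rule [:: a, b & w] =
    if rule a b is Some r' then Some ([::], r', w)
    else if qreduce_word rule (b :: w) is Some (u', r', v') then
      Some (a :: u', r', v') else None by [].
case er: (rule a b) => [r'|].
  by case=> <- <- <-; rewrite /qword !big_cons big_nil mul1r mulrA (ruleP er).
case: (qreduce_word rule (b :: w)) IH => [[[u' r'] v']|] // IH [<- er' ev'].
rewrite /qword [LHS]big_cons -/(qword (b :: w)) (IH u') ?er' ?ev' //.
by rewrite big_cons !mulrA.
Qed.

Lemma qeval_reduce_term m : qeval (qreduce_term rule m) = qcoef m.1 *: qword m.2.
Proof.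
rewrite /qreduce_term; case em: qreduce_word => [[[u r] v]|]; last first.
  by rewrite /qeval big_seq1.
rewrite (qreduce_wordP em) /qeval big_map mulr_sumr mulr_suml scaler_sumr.
apply: eq_bigr => n _ /=; rewrite qcoefM /qword !big_cat /=.
by rewrite -scalerAr -scalerAl scalerA mulrA.
Qed.

Lemma qeval_reduce p : qeval (qreduce rule p) = qeval p.
Proof.
rewrite /qreduce qeval_collect; elim: p => [|m p IH] //=.
by rewrite qeval_cat IH qeval_reduce_term qeval_cons.
Qed.

Lemma qnullP fuel p : qnull rule fuel p -> qeval p = 0.
Proof.
rewrite /qnull => /nilP e.
have <- : qeval (iter fuel (qreduce rule) p) = qeval p.
  by elim: fuel {e} => //= n <-; rewrite qeval_reduce.
by rewrite e /qeval big_nil.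
Qed.

Lemma qnull_eq fuel p r : qnull rule fuel (qsub p r) -> qeval p = qeval r.
Proof. by move=> /qnullP /eqP; rewrite qevalB subr_eq0 => /eqP. Qed.

End Evaluation.

(** * Presented algebras *)

Section FreeAlgebra.
Context {K : fieldType}.

Lemma malg_ind (T : choiceType) (P : {malg K[T]} -> Prop) : P 0 ->
  (forall c k x, P x -> P (c *: << k >> + x)) -> forall x, P x.
Proof.
move=> P0 PD x; rewrite [x]monalgE; elim/big_rec: _ => // k y _ Py.
have -> : << x@_k *g k >> = x@_k *: << k >> :> {malg K[T]}.
  by apply/malgP => l; rewrite mcoeffZ !mcoeffU mulrnAr mulr1.
exact: PD.
Qed.

Lemma malgUZ (T : choiceType) c d (k : T) :
  c *: << d *g k >> = << c * d *g k >> :> {malg K[T]}.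
Proof. by apply/malgP => i; rewrite mcoeffZ !mcoeffU mulrnAr. Qed.

Lemma malgUUM (M : monomType) c d (m n : M) :
  << c *g m >> * << d *g n >> = << c * d *g mmul m n >> :> {malg K[M]}.
Proof. by rewrite malgM_def fgmulUU. Qed.

Lemma malgUM (M : monomType) (m n : M) :
  << m >> * << n >> = << mmul m n >> :> {malg K[M]}.
Proof. by rewrite malgUUM mulr1. Qed.

Lemma malgZr (M : monomType) c (p r : {malg K[M]}) : p * (c *: r) = c *: (p * r : {malg K[M]}).
Proof.
move: p; apply: malg_ind => [|d k p IH]; first by rewrite !mul0r scaler0.
rewrite !mulrDl IH scalerDr; congr (_ + _).
move: r {IH p}; apply: malg_ind => [|e l r IH]; first by rewrite scaler0 mulr0 scaler0.
rewrite scalerDr !mulrDr scalerDr IH; congr (_ + _).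
by rewrite !malgUZ !malgUUM malgUZ !mulr1 mulrCA.
Qed.

Lemma malgZl (M : monomType) c (p r : {malg K[M]}) : (c *: p) * r = c *: (p * r : {malg K[M]}).
Proof. by rewrite scalerAl. Qed.

Section Lift.
Context {T : choiceType} {X : lmodType K} (s : {rmorphism K -> K}) (h : T -> X).

Lemma free_liftD x y : free_lift s h (x + y) = free_lift s h x + free_lift s h y.
Proof. exact: raddfD. Qed.

Lemma free_liftB x y : free_lift s h (x - y) = free_lift s h x - free_lift s h y.
Proof. exact: raddfB. Qed.

Lemma free_lift0 : free_lift s h 0 = 0.
Proof. exact: raddf0. Qed.

Lemma free_lift_sum I r (P : pred I) F :
  free_lift s h (\sum_(i <- r | P i) F i) = \sum_(i <- r | P i) free_lift s h (F i).
Proof. exact: raddf_sum. Qed.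

Lemma free_liftU1 k : free_lift s h << k >> = h k.
Proof. by rewrite free_liftU rmorph1 scale1r. Qed.
End Lift.

Section Eval.
Context {G : choiceType} {A : algType K} (gen : G -> A).

Let h (m : {fmonom G}) := \prod_(g <- (m : seq G)) gen g.

Lemma free_evalE p : free_eval gen p = free_lift idfun h p.
Proof. by []. Qed.

Lemma free_evalD p r : free_eval gen (p + r) = free_eval gen p + free_eval gen r.
Proof. by rewrite !free_evalE free_liftD. Qed.

Lemma free_evalB p r : free_eval gen (p - r) = free_eval gen p - free_eval gen r.
Proof. by rewrite !free_evalE free_liftB. Qed.

Lemma free_evalZ c p : free_eval gen (c *: p) = c *: free_eval gen p.
Proof. by rewrite !free_evalE free_liftZ. Qed.

Lemma free_eval0 : free_eval gen 0 = 0.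
Proof. by rewrite free_evalE free_lift0. Qed.

Lemma free_eval_sum I r (P : pred I) F : free_eval gen (\sum_(i <- r | P i) F i) =
  \sum_(i <- r | P i) free_eval gen (F i).
Proof. by rewrite free_evalE free_lift_sum. Qed.

Lemma free_evalU m : free_eval gen << m >> = \prod_(g <- (m : seq G)) gen g.
Proof. by rewrite free_evalE free_liftU1. Qed.

Lemma free_eval_gen g : free_eval gen << fmu g >> = gen g.
Proof. by rewrite free_evalU fmU big_seq1. Qed.

Lemma free_eval1 : free_eval gen 1 = 1.
Proof. by rewrite (free_evalU (mone : {fmonom G})) fm1 big_nil. Qed.

Lemma free_evalM p r : free_eval gen (p * r) = free_eval gen p * free_eval gen r.
Proof.
move: p; apply: malg_ind => [|c m p IH]; first by rewrite mul0r free_eval0 mul0r.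
rewrite mulrDl malgZl free_evalD IH [in RHS]free_evalD [RHS]mulrDl.
congr (_ + _); rewrite [LHS]free_evalZ [in RHS]free_evalZ -[RHS]scalerAl.
congr (_ *: _); move: r {p IH}.
apply: malg_ind => [|d n r IH]; first by rewrite mulr0 free_eval0 mulr0.
rewrite mulrDr malgZr free_evalD IH [in RHS]free_evalD [RHS]mulrDr.
congr (_ + _); rewrite [LHS]free_evalZ [in RHS]free_evalZ -[RHS]scalerAr.
by congr (_ *: _); rewrite malgUM [LHS]free_evalU fmM big_cat 2!free_evalU.
Qed.

Lemma free_eval_quad c g1 g2 g3 g4 :
  free_eval gen (<< fmu g1 >> * << fmu g2 >> - c *: (<< fmu g3 >> * << fmu g4 >>)) =
  gen g1 * gen g2 - c *: (gen g3 * gen g4).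
Proof.
rewrite free_evalB; congr (_ - _); first by rewrite [LHS]free_evalM !free_eval_gen.
by rewrite [LHS]free_evalZ; congr (_ *: _); rewrite [LHS]free_evalM !free_eval_gen.
Qed.

Lemma free_eval_prod I r (F : I -> {malg K[{fmonom G}]}) :
  free_eval gen (\prod_(i <- r) F i) = \prod_(i <- r) free_eval gen (F i).
Proof. by elim/big_ind2: _ => [|x1 x2 y1 y2 <- <-|//]; rewrite ?free_eval1 ?free_evalM. Qed.

Lemma free_eval_ideal (rel : set {malg K[{fmonom G}]}) p :
  (forall r, rel r -> free_eval gen r = 0) -> p \in two_sided_ideal rel ->
  free_eval gen p = 0.
Proof.
move=> rel0 /lspanP /(_ [pred p | free_eval gen p == 0]) P; apply/eqP/P.
  split=> [|c u v]; rewrite !inE ?free_eval0 // => /eqP u0 /eqP v0.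
  by rewrite free_evalD free_evalZ u0 v0 scaler0 addr0.
by move=> _ [u [s [v [rs ->]]]]; apply/eqP; rewrite !free_evalM (rel0 s rs) mulr0 mul0r.

Qed.
End Eval.

Lemma free_eval_ind (G : choiceType) (A : algType K) (gen : G -> A) (P : A -> Prop) :
  P 0 -> (forall c w x, P x -> P (c *: \prod_(g <- w) gen g + x)) ->
  forall p, P (free_eval gen p).
Proof.
move=> P0 PD; apply: malg_ind => [|c m p IH]; first by rewrite free_eval0.
by rewrite free_evalD free_evalZ free_evalU; exact: PD.
Qed.

Section Universal.
Context {G : choiceType} {A : algType K} (gen : G -> A).
Variables (rel : set {malg K[{fmonom G}]}) (presA : presented_by rel gen).

Lemma presented_rel r : rel r -> free_eval gen r = 0.
Proof.
by move=> rr; apply/presA.2/mem_lspan; exists 1, r, 1; rewrite mul1r mulr1.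
Qed.

Lemma presented_repr a : {p | free_eval gen p = a}.
Proof. by have [p pa] := cid (presA.1 a); exists p. Qed.

Variables (B : algType K) (gen' : G -> B).
Hypothesis rel' : forall r, rel r -> free_eval gen' r = 0.

(** A preimage in the free algebra is chosen; by [rel'] the value does not depend on it. *)
Definition presented_lift (a : A) : B := free_eval gen' (projT1 (cid (presA.1 a))).

Lemma presented_liftE p : presented_lift (free_eval gen p) = free_eval gen' p.
Proof.
rewrite /presented_lift; case: cid => r /= rp; apply/eqP; rewrite -subr_eq0.
rewrite -free_evalB; apply/eqP; apply: free_eval_ideal rel' _.
by apply/presA.2; rewrite free_evalB rp subrr.
Qed.

Lemma presented_lift_gen g : presented_lift (gen g) = gen' g.
Proof. by rewrite -(free_eval_gen gen) presented_liftE free_eval_gen. Qed.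

Lemma presented_lift1 : presented_lift 1 = 1.
Proof. by rewrite -(free_eval1 gen) presented_liftE free_eval1. Qed.

Lemma presented_liftM x y : presented_lift (x * y) = presented_lift x * presented_lift y.
Proof.
have [[p <-] [r <-]] := (presented_repr x, presented_repr y).
by rewrite -free_evalM !presented_liftE free_evalM.
Qed.

Lemma presented_liftD x y : presented_lift (x + y) = presented_lift x + presented_lift y.
Proof.
have [[p <-] [r <-]] := (presented_repr x, presented_repr y).
by rewrite -free_evalD !presented_liftE free_evalD.
Qed.

Lemma presented_liftZ c x : presented_lift (c *: x) = c *: presented_lift x.
Proof.
have [p <-] := presented_repr x.
by rewrite -free_evalZ !presented_liftE free_evalZ.
Qed.
End Universal.
End FreeAlgebra.

(** * Laplace expansion of quantum determinants *)

Section QuantumMinors.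
Context {K : fieldType} {A : algType K} (q : K).

(** Expansion along column 0, where [bump i] deletes row i. Indices are natural numbers, so that
    minors of minors are again plain functions. *)
Fixpoint lapdet n (f : nat -> nat -> A) : A :=
  if n is m.+1 then
    \sum_(i < n) (- q) ^+ i *: (f i 0%N * lapdet m (fun a b => f (bump i a) b.+1))
  else 1.

Lemma perm_lengthE n (s : 'S_n) :
  perm_length s = (\sum_(a < n) \sum_(b < n) ((a < b) && (s b < s a)))%N.
Proof.
rewrite /perm_length cardsE -sum1_card big_mkcond /= pair_bigA /=.
by apply: eq_bigr => p _; rewrite unfold_in; case: ifP.
Qed.

(** The point 0, sent to i, forms an inversion with exactly the i points whose images lie below i;
    all other inversions are those of s. *)
Lemma perm_length_lift n (i : 'I_n.+1) (s : 'S_n) :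
  perm_length (lift_perm ord0 i s) = (i + perm_length s)%N.
Proof.
rewrite !perm_lengthE big_ord_recl; congr (_ + _)%N.
  rewrite big_ord_recl ltnn add0n.
  transitivity (\sum_(b < n) (b < i))%N.
    rewrite [RHS](reindex_inj (@perm_inj _ s)); apply: eq_bigr => b _.
    rewrite lift_perm_id lift_perm_lift /= /bump.
    case: (leqP i (s b)) => h; last by rewrite add0n h.
    by rewrite add1n ltnNge leqW.
  rewrite -[RHS]card_ord -[RHS]sum1_card (big_ord_widen n (fun=> 1%N) (leq_ord i)) [RHS]big_mkcond /=.
  by apply: eq_bigr => b _; case: ifP.
apply: eq_bigr => a _; rewrite big_ord_recl add0n; apply: eq_bigr => b _.
by rewrite !lift_perm_lift /= /bump !add1n ltnS !ltnNge leq_bump2.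
Qed.

Lemma perm_sum_lift n (V : nmodType) (F : 'S_n.+1 -> V) :
  \sum_(s : 'S_n.+1) F s = \sum_(i < n.+1) \sum_(s : 'S_n) F (lift_perm ord0 i s).
Proof.
rewrite (partition_big (fun s : 'S_n.+1 => s ord0) predT) //=.
apply: eq_bigr => i _; rewrite (reindex (lift_perm ord0 i)) /=.
  by apply: eq_bigl => s; rewrite lift_perm_id eqxx.
(* Removing the point k and its image from s inverts [lift_perm]. *)
pose ulsf k (s : 'S_n.+1) j := odflt j (unlift (s k) (s (lift k j))).
have ulsfK k (s : 'S_n.+1) j : lift (s k) (ulsf k s j) = s (lift k j).
  rewrite /ulsf; have := neq_lift k j.
  by rewrite -(can_eq (permK s)) => /unlift_some[] ? ? ->.
have inj_ulsf : injective (ulsf ord0 _).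
  move=> s; apply: can_inj (ulsf (s ord0) s^-1%g) _ => k'.
  by rewrite {1}/ulsf ulsfK !permK liftK.
exists (fun s => perm (inj_ulsf s)) => [s _ | s].
  by apply/permP=> k'; rewrite permE /ulsf lift_perm_lift lift_perm_id liftK.
rewrite inE => /eqP si0; apply/permP=> k.
case: (unliftP ord0 k) => [k'|] ->; rewrite ?lift_perm_id //.
by rewrite lift_perm_lift -si0 permE ulsfK.
Qed.

Lemma lapdetS n (f : nat -> nat -> A) : lapdet n.+1 f =
  \sum_(i < n.+1) (- q) ^+ i *: (f i 0%N * lapdet n (fun a b => f (bump i a) b.+1)).
Proof. by []. Qed.

(** The factors of each product in the determinant are ordered by columns, so the factor from column
    0 comes first and splits off without any commutation. *)
Lemma lapdetE n (f : nat -> nat -> A) :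
  \sum_(s : 'S_n) (- q) ^+ perm_length s *: \prod_(j < n) f (s j) j = lapdet n f.
Proof.
elim: n f => [|n IH] f.
  rewrite (bigD1 (1%g : 'S_0)) //= big_ord0 perm_lengthE big_ord0 expr0 scale1r.
  rewrite big1 ?addr0 // => s /eqP[]; apply/permP; case=> //.
rewrite perm_sum_lift [RHS]/=; apply: eq_bigr => i _; rewrite -IH mulr_sumr scaler_sumr.
apply: eq_bigr => s _; rewrite perm_length_lift exprD -scalerA -scalerAr.
congr (_ *: (_ *: _)); rewrite big_ord_recl lift_perm_id; congr (_ * _).
by apply: eq_bigr => j _; rewrite lift_perm_lift.
Qed.
End QuantumMinors.

(** * The relations of U_q(4) *)

(* The letter of t_ij, for the indices 0, 1, 2, 3. *)
Definition tl (i j : nat) : nat := (4 * i + j)%N.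

(** Written with constructors in order to compute. Here and in the tables below [Negz n] is -(n+1):
    [Negz 0] is the coefficient or exponent -1, [Negz 1] the exponent -2. *)
Definition sgz (n : nat) : int := if odd n then Negz 0 else Posz 1.

Fixpoint qlap n (f : nat -> nat -> nat) : qpoly :=
  if n is m.+1 then
    qsum (iota 0 n) (fun i => qscale (sgz i) (Posz i)
      (qmul (qletter (f i 0%N)) (qlap m (fun a b => f (bump i a) b.+1))))
  else qconst 1 0.

Arguments qlap : simpl never.

(** Sorts letters into row-major order. When row and column both decrease, the cross relation leaves
    a correction t_il t_jk with i < j and k < l, which is already sorted. *)
Definition trule (a b : nat) : option qpoly :=
  if (b < a < 16)%N then
    let j := (a %/ 4)%N in let l := (a %% 4)%N in
    let i := (b %/ 4)%N in let k := (b %% 4)%N in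
    Some (if (i == j) || (k == l) then [:: ((Posz 1, Negz 0), [:: b; a])]
          else if (k < l)%N then
            [:: ((Posz 1, Posz 0), [:: b; a]); ((Negz 0, Posz 1), [:: tl i l; tl j k]);
                ((Posz 1, Negz 0), [:: tl i l; tl j k])]
          else [:: ((Posz 1, Posz 0), [:: b; a])])
  else None.

Definition tdet : qpoly := qlap 4 tl.

(* D_q S(t_ij), as a polynomial in the t_kl. *)
Definition tcof (i j : nat) : qpoly :=
  qscale (sgz (i + j)) (intZmod.addz (Posz i) (intZmod.oppz (Posz j)))
    (qlap 3 (fun a b => tl (bump j a) (bump i b))).

Definition tlet i j := qletter (tl i j).

Definition all4 (P : nat -> bool) : bool := all P (iota 0 4).

Lemma all4P (P : nat -> bool) : all4 P -> forall i, (i < 4)%N -> P i.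
Proof. by move=> /allP P4 i i4; apply: P4; rewrite mem_iota. Qed.

Definition tnull := qnull trule 40.

Lemma tdet_comm : all4 (fun i => all4 (fun j =>
  tnull (qsub (qmul tdet (tlet i j)) (qmul (tlet i j) tdet)))).
Proof. by vm_compute. Qed.

Lemma tcof_tlet : all4 (fun i => all4 (fun j =>
  tnull (qsub (qsum (iota 0 4) (fun k => qmul (tcof i k) (tlet k j)))
     (if i == j then tdet else [::])))).
Proof. by vm_compute. Qed.

(** Up to a factor [tcof l k] is the quantum determinant of the block without row k and column l. It
    is central in the algebra generated by the entries of that block, and t_ij is one of them. *)
Lemma tcof_comm : all4 (fun i => all4 (fun j => all4 (fun k => all4 (fun l =>
  [|| i == k, j == l | tnull (qsub (qmul (tcof l k) (tlet i j)) (qmul (tlet i j) (tcof l k)))])))).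
Proof. by vm_compute. Qed.

(* Row-wise and column-wise expansions of the minors of the first three rows agree. *)
Lemma tminor_row : all4 (fun k =>
  tnull (qsub (qlap 3 (fun a b => tl b (bump k a))) (qscale (sgz (k + 3)) (Posz (3 - k)) (tcof k 3)))).
Proof. by vm_compute. Qed.

(** This is D_q times the antipode axiom composed with S, where S^2(t_3k) = q^(2(3-k)) t_3k for
    indices from 0. It yields the weighted unit relation [sum_ZsZ] among the z_k^* z_k. *)
Lemma tcof_norm :
  tnull (qsub (qsum (iota 0 4) (fun k => qscale 1 (Posz (2 * (3 - k))) (qmul (tcof k 3) (tlet 3 k)))) tdet).
Proof. by vm_compute. Qed.

Lemma tcof_last_ne : all4 (fun i => all4 (fun j => (i == j) ||
  tnull (qsub (qmul (tcof j 3) (tlet 3 i)) (qscale 1 1 (qmul (tlet 3 i) (tcof j 3)))))).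
Proof. by vm_compute. Qed.

Lemma tcof_last_eq : all4 (fun k =>
  tnull (qsub (qmul (tcof k 3) (tlet 3 k)) (qmul (tlet 3 k) (tcof k 3) ++
    qsum (iota 0 k) (fun j => qscale 1 0 (qmul (tlet 3 j) (tcof j 3)) ++
                              qscale (Negz 0) 2 (qmul (tlet 3 j) (tcof j 3)))))).
Proof. by vm_compute. Qed.

Lemma tcof_upper : all4 (fun l => all4 (fun k => (k == 3)%N ||
  tnull (qsub (qmul (tcof l 3) (tlet k l)) (qscale 1 (Negz 0) (qmul (tlet k l) (tcof l 3)) ++
    qsum (iota 0 l) (fun j => qscale 1 (Negz 0) (qmul (tlet k j) (tcof j 3)) ++
                              qscale (Negz 0) 1 (qmul (tlet k j) (tcof j 3))))))).
Proof. by vm_compute. Qed.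

Section Uq4Theory.
Context {K : numClosedFieldType} (q : K) (U : hopfStarAlg K) (t : 'I_4 -> 'I_4 -> U) (Dinv : U).
Hypotheses (q0 : q != 0) (qR : q^* = q) (hU : is_Uq4 q t Dinv).

Definition tgen (i j : nat) : U := t (inord i) (inord j).
Local Notation T := tgen.
Definition tenv (a : nat) : U := T (a %/ 4) (a %% 4).
Local Notation ev := (qeval q tenv).
Local Notation Dq := (qdet q t).

Lemma tenv_tl i j : (j < 4)%N -> tenv (tl i j) = T i j.
Proof.
by move=> j4; rewrite /tenv /tl mulnC divnMDl // divn_small // addn0 modnMDl modn_small.
Qed.

Lemma Uq4_presented : presented_by (Uq4_rel q)
  (fun g : Uq4_gen => if g is Some (i, j) then t i j else Dinv).
Proof. exact: hU.1. Qed.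

Lemma Uq4_relE r : Uq4_rel q r ->
  free_eval (fun g : Uq4_gen => if g is Some (i, j) then t i j else Dinv) r = 0.
Proof. exact: (presented_rel Uq4_presented). Qed.

Lemma T_col i j k : (i < j < 4)%N -> T i k * T j k = q *: (T j k * T i k).
Proof.
case/andP=> ij j4; have lt : ((inord i : 'I_4) < (inord j : 'I_4))%N.
  by rewrite !inordK // (ltn_trans ij).
have := Uq4_relE (Uq4_col q (inord k) lt).
by rewrite free_eval_quad => /eqP; rewrite subr_eq0 => /eqP.
Qed.

Lemma T_row i j k : (i < j < 4)%N -> T k i * T k j = q *: (T k j * T k i).
Proof.
case/andP=> ij j4; have lt : ((inord i : 'I_4) < (inord j : 'I_4))%N.
  by rewrite !inordK // (ltn_trans ij).
have := Uq4_relE (Uq4_row q (inord k) lt).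
by rewrite free_eval_quad => /eqP; rewrite subr_eq0 => /eqP.
Qed.

Lemma T_comm i j k l : (i < j < 4)%N -> (k < l < 4)%N -> T i l * T j k = T j k * T i l.
Proof.
case/andP=> ij j4 /andP[kl l4]; have lt : ((inord i : 'I_4) < (inord j : 'I_4))%N.
  by rewrite !inordK // (ltn_trans ij).
have lt' : ((inord k : 'I_4) < (inord l : 'I_4))%N.
  by rewrite !inordK // (ltn_trans kl).
have := Uq4_relE (Uq4_comm q lt lt').
by rewrite -[X in _ - X]scale1r free_eval_quad scale1r => /eqP; rewrite subr_eq0 => /eqP.
Qed.

Lemma T_cross i j k l : (i < j < 4)%N -> (k < l < 4)%N ->
  T i k * T j l = T j l * T i k + (q - q^-1) *: (T j k * T i l).
Proof.
case/andP=> ij j4 /andP[kl l4]; have lt : ((inord i : 'I_4) < (inord j : 'I_4))%N.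
  by rewrite !inordK // (ltn_trans ij).
have lt' : ((inord k : 'I_4) < (inord l : 'I_4))%N.
  by rewrite !inordK // (ltn_trans kl).
have := Uq4_relE (Uq4_cross q lt lt').
rewrite free_evalB -[X in free_eval _ (_ - X)]scale1r free_eval_quad scale1r.
rewrite [free_eval _ (_ *: _)]free_evalZ [free_eval _ (_ * _)]free_evalM !free_eval_gen => /eqP.
by rewrite -addrA -opprD subr_eq0 => /eqP.
Qed.

Lemma truleP a b r : trule a b = Some r -> tenv a * tenv b = ev r.
Proof.
rewrite /trule; case: ifP => // /andP[ba a16] [<-].
rewrite {1 2}/tenv.
have [a4 b4] : (a %/ 4 < 4)%N /\ (b %/ 4 < 4)%N.
  by rewrite !ltn_divLR // (ltn_trans ba).
have [a4' b4'] : (a %% 4 < 4)%N /\ (b %% 4 < 4)%N by rewrite !ltn_mod.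
have Ea := divn_eq a 4; have Eb := divn_eq b 4.
have leq_ba : (b %/ 4 <= a %/ 4)%N by rewrite leq_div2r // ltnW.
have sg1 : qcoef q (Posz 1, Posz 0) = 1 by rewrite /qcoef mulr1.
have sgq : qcoef q (Posz 1, Negz 0) = q^-1 by rewrite /qcoef mul1r.
have sgm : qcoef q (Negz 0, Posz 1) = - q by rewrite /qcoef mulN1r.
have w2 c d : qword tenv [:: c; d] = tenv c * tenv d.
  by rewrite /qword !big_cons big_nil mulr1.
case: eqP => [ij|/eqP ij].
  have lt : (b %% 4 < a %% 4 < 4)%N.
    by rewrite a4' andbT -(ltn_add2l (a %/ 4 * 4)) -Ea -{1}ij -Eb.
  by rewrite /= qeval_cons w2 sgq /qeval big_nil addr0 /tenv ij (T_row _ lt) scalerA mulVf ?scale1r.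
have ij' : (b %/ 4 < a %/ 4)%N by rewrite ltn_neqAle ij.
case: eqP => [kl|/eqP kl].
  rewrite /= qeval_cons w2 sgq /qeval big_nil addr0 /tenv kl.
  by rewrite (T_col _ (introT andP (conj ij' a4))) scalerA mulVf ?scale1r.
rewrite /=; case: ltnP => kl'.
  rewrite !qeval_cons !w2 sg1 sgq sgm /qeval big_nil addr0 scale1r !tenv_tl //.
  have ija : (b %/ 4 < a %/ 4 < 4)%N by rewrite ij'.
  have kla : (b %% 4 < a %% 4 < 4)%N by rewrite kl'.
  rewrite -scalerDl /tenv (T_cross ija kla) (T_comm ija kla).
  by rewrite -addrA -scalerDl [- q + _]addrC -[q^-1 - q]opprB addrN scale0r addr0.
rewrite !qeval_cons w2 sg1 /qeval big_nil addr0 scale1r /tenv.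
have ija : (b %/ 4 < a %/ 4 < 4)%N by rewrite ij'.
have kla : (a %% 4 < b %% 4 < 4)%N by rewrite ltn_neqAle eq_sym kl kl'.
by rewrite (T_comm ija kla).
Qed.

Lemma tnull_eq p r : tnull (qsub p r) -> ev p = ev r.
Proof. exact: (qnull_eq q0 truleP). Qed.

Lemma eq_lapdet (A : algType K) n (f g : nat -> nat -> A) :
  (forall a b, (a < n)%N -> (b < n)%N -> f a b = g a b) -> lapdet q n f = lapdet q n g.
Proof.
elim: n f g => //= n IH f g fg; apply: eq_bigr => i _; rewrite fg //.
congr (_ *: (_ * _)); apply: IH => a b an bn; rewrite fg //.
by rewrite /bump ltnS (leq_trans _ an) // -[a.+1]add1n leq_add2r leq_b1.
Qed.

Lemma sgzE n : (sgz n)%:~R = (-1) ^+ n :> K.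
Proof. by rewrite /sgz -signr_odd; case: odd. Qed.

Lemma ev_qlap n (f : nat -> nat -> nat) : ev (qlap n f) = lapdet q n (fun a b => tenv (f a b)).
Proof.
elim: n f => [|n IH] f; first by rewrite /= qeval_const expr0z mul1r scale1r.
have -> : qlap n.+1 f = qsum (index_iota 0 n.+1) (fun i => qscale (sgz i) (Posz i)
  (qmul (qletter (f i 0%N)) (qlap n (fun a b => f (bump i a) b.+1)))) by [].
rewrite qeval_sum big_mkord /=.
apply: eq_bigr => i _; rewrite qevalZ // qevalM // qeval_letter IH.
by rewrite sgzE -exprnP [in RHS]exprNn.
Qed.

Lemma ev_tdet : ev tdet = Dq.
Proof.
rewrite ev_qlap -[Dq]/(\sum_(s : 'S_4) _).
rewrite (eq_bigr (fun s : 'S_4 => (- q) ^+ perm_length s *: \prod_(j < 4) T (s j) j)).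
  by rewrite lapdetE; apply: eq_lapdet => a b _ b4; rewrite tenv_tl.
by move=> s _; congr (_ *: _); apply: eq_bigr => j _; rewrite /tgen !inord_val.
Qed.

Lemma ev_tlet i j : (j < 4)%N -> ev (tlet i j) = T i j.
Proof. by move=> j4; rewrite qeval_letter tenv_tl. Qed.

Lemma free_eval_qdet (A : algType K) (gen : Uq4_gen -> A) :
  free_eval gen (qdet q free_t) = qdet q (fun i j => gen (Some (i, j))).
Proof.
rewrite /qdet [LHS]free_eval_sum; apply: eq_bigr => s _.
rewrite [LHS]free_evalZ [free_eval _ _]free_eval_prod; congr (_ *: _).
by apply: eq_bigr => j _; rewrite free_eval_gen.
Qed.

Lemma DqM : Dq * Dinv = 1.
Proof.
have := Uq4_relE (Uq4_detVr q); rewrite free_evalB [free_eval _ (_ * _)]free_evalM [free_eval _ 1]free_eval1 free_eval_gen.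
by rewrite free_eval_qdet => /eqP; rewrite subr_eq0 => /eqP.
Qed.

Lemma DinvM : Dinv * Dq = 1.
Proof.
have := Uq4_relE (Uq4_detVl q); rewrite free_evalB [free_eval _ (_ * _)]free_evalM [free_eval _ 1]free_eval1 free_eval_gen.
by rewrite free_eval_qdet => /eqP; rewrite subr_eq0 => /eqP.
Qed.

Lemma Dq_T i j : (i < 4)%N -> (j < 4)%N -> Dq * T i j = T i j * Dq.
Proof.
move=> i4 j4; have := tnull_eq (all4P (all4P tdet_comm i4) j4).
by rewrite !qevalM // ev_tdet ev_tlet.
Qed.
End Uq4Theory.

(** * Tensor products and the antipode *)

(* Bilinear up to a twist of the scalars, the hypothesis under which tens_lift is meaningful. *)
Definition bilin (K : fieldType) (V W X : lmodType K) (s : K -> K) (f : V -> W -> X) :=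
  [/\ forall v v' w, f (v + v') w = f v w + f v' w,
      forall v w w', f v (w + w') = f v w + f v w',
      forall c v w, f (c *: v) w = s c *: f v w
    & forall c v w, f v (c *: w) = s c *: f v w].

Section BilinearMaps.
Context {K : fieldType} {V W X : lmodType K} (s : {rmorphism K -> K}) (f : V -> W -> X).
Hypothesis bf : bilin s f.

Lemma blift_tens v w : tens_lift s f (tens v w) = f v w.
Proof. by case: bf => *; exact: tens_liftE. Qed.

Lemma bliftD x y : tens_lift s f (x + y) = tens_lift s f x + tens_lift s f y.
Proof. by case: bf => *; exact: tens_liftD. Qed.

Lemma bliftZ c x : tens_lift s f (c *: x) = s c *: tens_lift s f x.
Proof. by case: bf => *; exact: tens_liftZ. Qed.

Lemma blift0 : tens_lift s f 0 = 0.
Proof. by rewrite -[X in tens_lift s f X](scale0r 0) bliftZ rmorph0 scale0r. Qed.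

Lemma blift_sum I (r : seq I) (P : pred I) F :
  tens_lift s f (\sum_(i <- r | P i) F i) = \sum_(i <- r | P i) tens_lift s f (F i).
Proof.
by elim/big_ind2: _ => [|x1 x2 y1 y2 <- <-|//]; rewrite ?blift0 ?bliftD.
Qed.
End BilinearMaps.

(* Stated for an abstract module, as unification tends to unfold tensor. *)
Lemma bilinear_assoc (K : fieldType) (I : Type) (V : lmodType K) (g : I -> V) (m : V -> V -> V) :
  (forall P : V -> Prop, P 0 -> (forall c i x, P x -> P (c *: g i + x)) -> forall x, P x) ->
  (forall x y z, m (x + y) z = m x z + m y z) -> (forall c x y, m (c *: x) y = c *: m x y) ->
  (forall x y z, m x (y + z) = m x y + m x z) -> (forall c x y, m x (c *: y) = c *: m x y) ->
  (forall i j k, m (g i) (m (g j) (g k)) = m (m (g i) (g j)) (g k)) ->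
  forall x y z, m x (m y z) = m (m x y) z.
Proof.
move=> ind Dl Zl Dr Zr E3 x y z.
have m0 u : m 0 u = 0 by rewrite -[X in m X u](scale0r 0) Zl scale0r.
have m0r u : m u 0 = 0 by rewrite -[X in m u X](scale0r 0) Zr scale0r.
have E2 i j : m (g i) (m (g j) z) = m (m (g i) (g j)) z.
  move: z; apply: ind => [|c k z IH]; first by rewrite !m0r.
  by rewrite !Dr !Zr IH E3.
have E1 i : m (g i) (m y z) = m (m (g i) y) z.
  move: y; apply: ind => [|c j y IH]; first by rewrite !(m0, m0r).
  by rewrite !Dl !Zl !Dr !Zr !Dl !Zl IH E2.
move: x; apply: ind => [|c i x IH]; first by rewrite !m0.
by rewrite !Dl !Zl IH E1.
Qed.

Section TensorProducts.
Context {K : fieldType}.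

Lemma tens_eq (V W X : lmodType K) (s : {rmorphism K -> K}) (F G : tensor V W -> X) :
  (forall x y, F (x + y) = F x + F y) -> (forall c x, F (c *: x) = s c *: F x) ->
  (forall x y, G (x + y) = G x + G y) -> (forall c x, G (c *: x) = s c *: G x) ->
  (forall v w, F (tens v w) = G (tens v w)) -> forall x, F x = G x.
Proof.
move=> FD FZ GD GZ FG; apply: tens_ind => [|c v w x IH].
  by rewrite -[0](scale0r 0) FZ GZ rmorph0 !scale0r.
by rewrite FD FZ GD GZ FG IH.
Qed.

Lemma bilin_tens_map (V V' W W' : lmodType K) (f : {linear V -> V'}) (g : {linear W -> W'}) :
  bilin idfun (fun v w => tens (f v) (g w)).
Proof.
by split=> *; rewrite ?linearD ?linearZ ?tensDl ?tensDr ?tensZl ?tensZr.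
Qed.

Section TensMap.
Context {V V' W W' : lmodType K} (f : {linear V -> V'}) (g : {linear W -> W'}).

Lemma tens_mapD x y : tens_map f g (x + y) = tens_map f g x + tens_map f g y.
Proof. exact: bliftD (bilin_tens_map f g) x y. Qed.

Lemma tens_mapZ c x : tens_map f g (c *: x) = c *: tens_map f g x.
Proof. exact: bliftZ (bilin_tens_map f g) c x. Qed.

Lemma tens_map_sum I (r : seq I) (P : pred I) F :
  tens_map f g (\sum_(i <- r | P i) F i) = \sum_(i <- r | P i) tens_map f g (F i).
Proof. exact: blift_sum (bilin_tens_map f g) I r P F. Qed.
End TensMap.

Variable A : algType K.
Implicit Types x y z : tensor A A.

Definition tens_lmul (a b : A) (y : tensor A A) : tensor A A :=
  tens_lift idfun (fun c d => tens (a * c) (b * d)) y.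

Lemma bilin_tens_lmul (a b : A) : bilin idfun (fun c d : A => tens (a * c) (b * d)).
Proof.
by split=> *; rewrite ?mulrDr ?tensDl ?tensDr -?scalerAr ?tensZl ?tensZr.
Qed.

Lemma tens_lmulD a b x y : tens_lmul a b (x + y) = tens_lmul a b x + tens_lmul a b y.
Proof. exact: bliftD (bilin_tens_lmul a b) x y. Qed.

Lemma tens_lmulZ a b c x : tens_lmul a b (c *: x) = c *: tens_lmul a b x.
Proof. exact: bliftZ (bilin_tens_lmul a b) c x. Qed.

Lemma tens_lmul0 a b : tens_lmul a b 0 = 0.
Proof. exact: blift0 (bilin_tens_lmul a b). Qed.

Lemma tens_lmulE a b c d : tens_lmul a b (tens c d) = tens (a * c) (b * d).
Proof. exact: blift_tens (bilin_tens_lmul a b) c d. Qed.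

Lemma bilin_tens_mul y : bilin idfun (fun a b : A => tens_lmul a b y).
Proof.
split=> [a a' b|a b b'|k a b|k a b]; move: y; apply: tens_ind => [|e c d y IH].
- by rewrite !tens_lmul0 addr0.
- rewrite !tens_lmulD !tens_lmulZ !tens_lmulE IH.
  by rewrite mulrDl tensDl scalerDr addrACA.
- by rewrite !tens_lmul0 addr0.
- rewrite !tens_lmulD !tens_lmulZ !tens_lmulE IH.
  by rewrite mulrDl tensDr scalerDr addrACA.
- by rewrite !tens_lmul0 scaler0.
- rewrite !tens_lmulD !tens_lmulZ !tens_lmulE IH.
  by rewrite -scalerAl tensZl scalerDr !scalerA mulrC.
- by rewrite !tens_lmul0 scaler0.
- rewrite !tens_lmulD !tens_lmulZ !tens_lmulE IH.
  by rewrite -scalerAl tensZr scalerDr !scalerA mulrC.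
Qed.

Lemma tens_mulDl x y z : tens_mul (x + y) z = tens_mul x z + tens_mul y z.
Proof. exact: bliftD (bilin_tens_mul z) _ _. Qed.

Lemma tens_mulZl c x y : tens_mul (c *: x) y = c *: tens_mul x y.
Proof. exact: bliftZ (bilin_tens_mul y) _ _. Qed.

Lemma tens_mul_tens (a b c d : A) : tens_mul (tens a b) (tens c d) = tens (a * c) (b * d).
Proof. exact: tens_mulE. Qed.

Lemma tens_mul_tensl (a b : A) y : tens_mul (tens a b) y = tens_lmul a b y.
Proof. exact: blift_tens (bilin_tens_mul y) _ _. Qed.

Lemma tens_mul0l y : tens_mul 0 y = 0.
Proof. exact: blift0 (bilin_tens_mul y). Qed.

Lemma tens_mulDr x y z : tens_mul x (y + z) = tens_mul x y + tens_mul x z.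
Proof.
move: x; apply: tens_ind => [|c a b x IH]; first by rewrite !tens_mul0l addr0.
rewrite !tens_mulDl IH !tens_mulZl !tens_mul_tensl tens_lmulD.
by rewrite scalerDr addrACA.
Qed.

Lemma tens_mulZr c x y : tens_mul x (c *: y) = c *: tens_mul x y.
Proof.
move: x; apply: tens_ind => [|d a b x IH]; first by rewrite !tens_mul0l scaler0.
rewrite !tens_mulDl IH !tens_mulZl !tens_mul_tensl tens_lmulZ.
by rewrite scalerDr !scalerA mulrC.
Qed.

Lemma tens_mul0r x : tens_mul x 0 = 0.
Proof. by rewrite -[X in tens_mul x X](scale0r 0) tens_mulZr scale0r. Qed.

Lemma tens_mul_suml I r (P : pred I) F y :
  tens_mul (\sum_(i <- r | P i) F i) y = \sum_(i <- r | P i) tens_mul (F i) y.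
Proof.
by elim/big_ind2: _ => [|x1 x2 y1 y2 <- <-|//]; rewrite ?tens_mul0l ?tens_mulDl.
Qed.

Lemma tens_mul_sumr I r (P : pred I) F x :
  tens_mul x (\sum_(i <- r | P i) F i) = \sum_(i <- r | P i) tens_mul x (F i).
Proof.
by elim/big_ind2: _ => [|x1 x2 y1 y2 <- <-|//]; rewrite ?tens_mul0r ?tens_mulDr.
Qed.

Lemma tens_mulA x y z : tens_mul x (tens_mul y z) = tens_mul (tens_mul x y) z.
Proof.
apply: (@bilinear_assoc K (A * A)%type (tensor A A) (fun p => tens p.1 p.2) (@tens_mul K A)).
- by move=> P P0 PD; apply: tens_ind => // c v w; exact: (PD c (v, w)).
- exact: tens_mulDl.
- exact: tens_mulZl.
- exact: tens_mulDr.
- exact: tens_mulZr.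
- by move=> i j k; rewrite !tens_mul_tens !mulrA.
Qed.

Lemma tens_mul1 x : tens_mul x (tens 1 1) = x.
Proof.
apply: (@tens_eq A A (tensor A A) idfun (fun x => tens_mul x (tens 1 1)) (fun x => x)) => //.
- by move=> u v; exact: tens_mulDl.
- by move=> c u; exact: tens_mulZl.
- by move=> a b; rewrite tens_mul_tens !mulr1.
Qed.

Lemma tens_mul1l x : tens_mul (tens 1 1) x = x.
Proof.
apply: (@tens_eq A A (tensor A A) idfun (fun x => tens_mul (tens 1 1) x) (fun x => x)) => //.
- by move=> u v; exact: tens_mulDr.
- by move=> c u; exact: tens_mulZr.
- by move=> a b; rewrite tens_mul_tens !mul1r.
Qed.

Lemma tens_expand (V W : lmodType K) (x : tensor V W) :
  exists s : seq (V * W), x = \sum_(p <- s) tens p.1 p.2.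
Proof.
move: x; apply: tens_ind => [|c v w x [s ->]]; first by exists [::]; rewrite big_nil.
by exists ((c *: v, w) :: s); rewrite big_cons tensZl.
Qed.

End TensorProducts.

(** * The antipode as a cofactor matrix, and the relations of the 7-sphere *)

Section SphereRelations.
Context {K : numClosedFieldType} (q : K) (U : hopfStarAlg K) (t : 'I_4 -> 'I_4 -> U) (Dinv : U).
Hypotheses (q0 : q != 0) (qR : q^* = q) (hU : is_Uq4 q t Dinv).

Local Notation T := (tgen t).
Local Notation ev := (qeval q (tenv t)).
Local Notation Dq := (qdet q t).
Definition ST (i j : nat) : U := antipode U (T i j).
Local Notation S := ST.

Lemma Delta_T i j : Delta U (T i j) = \sum_(k < 4) tens (T i k) (T k j).
Proof.
case: hU => _ [[-> _ _ _] _]; apply: eq_bigr => k _.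
by rewrite /tgen inord_val.
Qed.

Lemma counit_T i j : (i < 4)%N -> (j < 4)%N -> counit U (T i j) = (i == j)%:R.
Proof.
move=> i4 j4; case: hU => _ [[_ _ -> _] _]; congr (nat_of_bool _)%:R.
by rewrite -val_eqE /= !inordK.
Qed.

Lemma ST_T i j : (i < 4)%N -> (j < 4)%N ->
  \sum_(k < 4) S i k * T k j = (i == j)%:R.
Proof.
move=> i4 j4; have := hopf_antipodel (T i j); rewrite Delta_T counit_T // -in_algE rmorph_nat.
rewrite blift_sum; first by move=> <-; apply: eq_bigr => k _; rewrite blift_tens //;
  split=> *; rewrite ?linearD ?linearZ ?mulrDl ?mulrDr -?scalerAl -?scalerAr.
by split=> *; rewrite ?linearD ?linearZ ?mulrDl ?mulrDr -?scalerAl -?scalerAr.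
Qed.

Lemma T_ST i j : (i < 4)%N -> (j < 4)%N ->
  \sum_(k < 4) T i k * S k j = (i == j)%:R.
Proof.
move=> i4 j4; have := hopf_antipoder (T i j); rewrite Delta_T counit_T // -in_algE rmorph_nat.
rewrite blift_sum; first by move=> <-; apply: eq_bigr => k _; rewrite blift_tens //;
  split=> *; rewrite ?linearD ?linearZ ?mulrDl ?mulrDr -?scalerAl -?scalerAr.
by split=> *; rewrite ?linearD ?linearZ ?mulrDl ?mulrDr -?scalerAl -?scalerAr.
Qed.

Lemma star_T i j : star (T i j) = S j i.
Proof. by case: hU => _ [_ [-> _]]. Qed.

Lemma star_Dq : star Dq = Dinv.
Proof. by case: hU => _ [_ [_ ->]]. Qed.

Lemma star_Dinv : star Dinv = Dq.
Proof. by rewrite -star_Dq hopf_starK. Qed.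

Lemma Dinv_T i j : (i < 4)%N -> (j < 4)%N -> Dinv * T i j = T i j * Dinv.
Proof.
move=> i4 j4; rewrite -[LHS]mulr1 -(DqM hU) -mulrA (mulrA (T i j)) -(Dq_T q0 hU) //.
by rewrite -mulrA mulrA (DinvM hU) mul1r.
Qed.

Lemma ev_tsum p r n : (n <= 4)%N ->
  ev (qsum (iota 0 n) (fun k => qmul (p k) (r k))) = \sum_(k < n) ev (p k) * ev (r k).
Proof.
move=> n4; rewrite qeval_sum -[in iota _ _](subn0 n) -/(index_iota 0 n) big_mkord.
by apply: eq_bigr => k _; rewrite qevalM.
Qed.

(** The cofactor matrix is a left inverse of (t_ij) up to the factor D_q, and S is a right inverse;
    multiplying the triple product out in both ways identifies them. *)
Lemma ST_cof i j : (i < 4)%N -> (j < 4)%N -> Dq * S i j = ev (tcof i j).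
Proof.
move=> i4 j4.
have cof k : (k < 4)%N -> \sum_(l < 4) ev (tcof i l) * T l k = if i == k then Dq else 0.
  move=> k4; have := tnull_eq q0 hU (all4P (all4P tcof_tlet i4) k4).
  rewrite ev_tsum // (eq_bigr (fun l : 'I_4 => ev (tcof i l) * T l k)).
    by move=> ->; case: eqP => _; rewrite ?(ev_tdet t q0) // /qeval big_nil.
  by move=> l _; rewrite ev_tlet.
transitivity (\sum_(k < 4) (if i == k then Dq else 0) * S k j).
  rewrite (bigD1 (Ordinal i4)) //= eqxx big1 ?addr0 // => k; rewrite -val_eqE /= eq_sym.
  by move/negbTE->; rewrite mul0r.
transitivity (\sum_(l < 4) ev (tcof i l) * \sum_(k < 4) T l k * S k j).
  rewrite (eq_bigr (fun k : 'I_4 => \sum_(l < 4) ev (tcof i l) * (T l k * S k j))).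
    by rewrite exchange_big /=; apply: eq_bigr => l _; rewrite mulr_sumr.
  by move=> k _; rewrite -cof // mulr_suml; apply: eq_bigr => l _; rewrite mulrA.
rewrite (bigD1 (Ordinal j4)) //= T_ST // eqxx mulr1 big1 ?addr0 // => l.
by rewrite -val_eqE /= => /negbTE lj; rewrite T_ST // lj mulr0.
Qed.

Lemma STE i j : (i < 4)%N -> (j < 4)%N -> S i j = Dinv * ev (tcof i j).
Proof. by move=> i4 j4; rewrite -ST_cof // mulrA (DinvM hU) mul1r. Qed.

Lemma ST_T_comm i j k l : (i < 4)%N -> (j < 4)%N -> (k < 4)%N -> (l < 4)%N ->
  i != k -> j != l -> S l k * T i j = T i j * S l k.
Proof.
move=> i4 j4 k4 l4 /negbTE ik /negbTE jl.
have := all4P (all4P (all4P (all4P tcof_comm i4) j4) k4) l4; rewrite ik jl /=.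
move/(tnull_eq q0 hU); rewrite !qevalM // ev_tlet // => e.
by rewrite STE // -mulrA e [LHS]mulrA Dinv_T // -mulrA.
Qed.

(* z_(i+1) and its adjoint. *)
Definition zcoord i := T 3 i.
Definition zstar i := S i 3.
Local Notation Z := zcoord.
Local Notation Zs := zstar.

Lemma star_Z i : star (Z i) = Zs i.
Proof. exact: star_T. Qed.

Lemma star_Zs i : star (Zs i) = Z i.
Proof. by rewrite -star_Z hopf_starK. Qed.

Lemma Z_Z i j : (i < j < 4)%N -> Z i * Z j = q *: (Z j * Z i).
Proof. exact: (T_row hU). Qed.

Lemma Zs_Zs i j : (i < j < 4)%N -> Zs j * Zs i = q *: (Zs i * Zs j).
Proof.
by move=> ij; rewrite -!star_Z -!hopf_starM Z_Z // hopf_starZ qR.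
Qed.

Lemma Zs_Z i j : (i < 4)%N -> (j < 4)%N -> i != j -> Zs j * Z i = q *: (Z i * Zs j).
Proof.
move=> i4 j4 /negbTE ij; have := all4P (all4P tcof_last_ne i4) j4; rewrite ij /=.
move/(tnull_eq q0 hU); rewrite qevalZ // !qevalM // ev_tlet // mul1r => e.
by rewrite /zstar STE // -mulrA e /= -scalerAr !mulrA Dinv_T.
Qed.

Lemma ZsZ k : (k < 4)%N ->
  Zs k * Z k = Z k * Zs k + (1 - q ^+ 2) *: \sum_(j < k) Z j * Zs j.
Proof.
move=> k4; have := tnull_eq q0 hU (all4P tcof_last_eq k4).
rewrite qeval_cat // !qevalM // ev_tlet // qeval_sum // => e.
rewrite /zstar STE // -mulrA e mulrDr; congr (_ + _); first by rewrite !mulrA Dinv_T.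
rewrite -[in iota _ _](subn0 k) -/(index_iota 0 k) big_mkord scaler_sumr mulr_sumr.
apply: eq_bigr => j _; have j4 := ltn_trans (ltn_ord j) k4.
rewrite qeval_cat // !qevalZ // !qevalM // ev_tlet // STE // -scalerDl -scalerAr.
rewrite [in RHS]mulrA -Dinv_T // -mulrA; congr (_ *: _).
by rewrite mulN1r expr0z mulr1.
Qed.

Lemma sum_ZZs : \sum_(k < 4) Z k * Zs k = 1.
Proof. by rewrite T_ST. Qed.

Lemma sum_ZsZ : \sum_(k < 4) q ^+ (2 * (3 - k)) *: (Zs k * Z k) = 1.
Proof.
have := tnull_eq q0 hU tcof_norm; rewrite (ev_tdet t q0) qeval_sum => e.
rewrite -(DinvM hU) -e -[iota _ _]/(index_iota 0 4) big_mkord mulr_sumr.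
by apply: eq_bigr => k _; rewrite qevalZ // qevalM // ev_tlet // mul1r -scalerAr mulrA -STE.
Qed.

(** The one exchange of a z_l^* with the first three rows that [ST_T_comm] leaves open: the column
    of the letter is l itself. *)
Lemma Zs_upper k l : (k < 3)%N -> (l < 4)%N ->
  Zs l * T k l = q^-1 *: (T k l * Zs l) + (q^-1 - q) *: \sum_(j < l) T k j * Zs j.
Proof.
move=> k3 l4; have k4 : (k < 4)%N by exact: ltnW.
have := all4P (all4P tcof_upper l4) k4; rewrite (ltn_eqF k3) orFb.
move/(tnull_eq q0 hU); rewrite qeval_cat // qevalZ // !qevalM // ev_tlet // qeval_sum // => e.
rewrite /zstar STE // -mulrA e mulrDr; congr (_ + _).
  by rewrite -scalerAr !mulrA Dinv_T // mul1r.
rewrite -[in iota _ _](subn0 l) -/(index_iota 0 l) big_mkord scaler_sumr mulr_sumr.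
apply: eq_bigr => j _; have j4 := ltn_trans (ltn_ord j) l4.
rewrite qeval_cat // !qevalZ // !qevalM // ev_tlet // STE // -scalerDl -scalerAr.
rewrite [in RHS]mulrA -Dinv_T // -mulrA; congr (_ *: _).
by rewrite mulN1r mul1r.
Qed.

(** Up to D_q and a scalar z_k^* is a maximal minor of the first three rows, written transposed to
    match [kappa] below. *)
Lemma minor_row k : (k < 4)%N ->
  lapdet q 3 (fun i j => T j (bump k i)) =
    ((-1) ^+ (k + 3) * q ^+ (3 - k)) *: (Dq * Zs k).
Proof.
move=> k4; have := tnull_eq q0 hU (all4P tminor_row k4).
rewrite ev_qlap // qevalZ // /zstar ST_cof // sgzE => <-; apply: eq_lapdet => a b a3 b3.
rewrite tenv_tl // /bump -[4%N]/(1 + 3)%N -addnS leq_add //; exact: leq_b1.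
Qed.
End SphereRelations.

(** * The 7-sphere as a set of coinvariants *)

Section GeneratedSubalgebra.
Context {K : fieldType} {A : algType K} (S : set A).
Local Notation B := (gen_subalg S).

Lemma galg_gen x : S x -> B x.
Proof. by move=> Sx P _; exact. Qed.

Lemma galg1 : B 1.
Proof. by move=> P [P1 _ _]. Qed.

Lemma galgZD c x y : B x -> B y -> B (c *: x + y).
Proof.
by move=> Bx By P Psub PS; case: (Psub) => _ PZD _; apply: PZD; [exact: Bx | exact: By].
Qed.

Lemma galgM x y : B x -> B y -> B (x * y).
Proof.
by move=> Bx By P Psub PS; case: (Psub) => _ _ PM; apply: PM; [exact: Bx | exact: By].
Qed.

Lemma galg0 : B 0.
Proof. by rewrite -(addNr 1) -scaleN1r; apply: galgZD; exact: galg1. Qed.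

Lemma galgZ c x : B x -> B (c *: x).
Proof. by move=> Bx; rewrite -[_ *: _]addr0; apply: galgZD => //; exact: galg0. Qed.

Lemma galgD x y : B x -> B y -> B (x + y).
Proof. by move=> Bx By; rewrite -[x]scale1r; exact: galgZD. Qed.

Lemma galgB x y : B x -> B y -> B (x - y).
Proof. by move=> Bx By; rewrite -scaleN1r addrC; exact: galgZD. Qed.

Lemma galgX x n : B x -> B (x ^+ n).
Proof.
by move=> Bx; elim: n => [|n IH]; rewrite ?expr0 ?exprS; [exact: galg1 | exact: galgM].
Qed.

Lemma galg_sum I (r : seq I) (P : pred I) F : (forall i, P i -> B (F i)) ->
  B (\sum_(i <- r | P i) F i).
Proof. by move=> BF; elim/big_ind: _ => //; [exact: galg0 | exact: galgD]. Qed.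

Lemma galg_ind (P : A -> Prop) : P 1 -> (forall c x y, P x -> P y -> P (c *: x + y)) ->
  (forall x y, P x -> P y -> P (x * y)) -> (forall x, S x -> P x) ->
  forall x, B x -> P x.
Proof.
move=> P1 PZD PM PS x Bx; apply/asboolP; apply: (Bx (fun y => `[< P y >])).
  split; first exact/asboolP.
    by move=> c u v /asboolP Pu /asboolP Pv; apply/asboolP/PZD.
  by move=> u v /asboolP Pu /asboolP Pv; apply/asboolP/PM.
by move=> s Ss; apply/asboolP/PS.
Qed.
End GeneratedSubalgebra.

(** * Germs of sequences, in place of a localization *)

Section Germs.
Context {K : fieldType} {V : lmodType K}.

Definition evz (f : nat -> V) : Prop := exists N, forall n, (N <= n)%N -> f n = 0.

Lemma evzZD c (f g : nat -> V) : evz f -> evz g -> evz (fun n => c *: f n + g n).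
Proof.
move=> [M fM] [N gN]; exists (M + N)%N => n le; rewrite fM ?gN ?scaler0 ?addr0 //.
  by rewrite (leq_trans _ le) ?leq_addl.
by rewrite (leq_trans _ le) ?leq_addr.
Qed.

Lemma lspan_evz (f : nat -> V) : f \in lspan (evz : set (nat -> V)) <-> evz f.
Proof.
split=> [/lspanP/(_ (fun g => `[< evz g >])) P|]; last exact: mem_lspan.
apply/asboolP; apply: P => [|g eg]; last exact/asboolP.
split; first by apply/asboolP; exists 0%N.
move=> c u v /asboolP [M uM] /asboolP [N vN]; apply/asboolP; exists (M + N)%N => n le.
rewrite -[LHS]/(c *: u n + v n) uM ?vN ?scaler0 ?addr0 //.
  by rewrite (leq_trans _ le) ?leq_addl.
by rewrite (leq_trans _ le) ?leq_addr.
Qed.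

(** The sequences s^n x and s^n y have the same germ exactly when s^n (x - y) = 0 for all large n,
    that is when x and y agree after inverting s. No knowledge about zero divisors is involved. *)
Definition germ := lquot (evz : set (nat -> V)).
Definition togerm (f : nat -> V) : germ := lpi (evz : set (nat -> V)) f.

Lemma germ_eq f g : togerm f = togerm g <-> evz (fun n => f n - g n).
Proof.
rewrite /togerm; split=> [/lpi_eq/lspan_evz //|e].
by apply/lpi_eq/lspan_evz.
Qed.

Lemma germD f g : togerm (fun n => f n + g n) = togerm f + togerm g.
Proof. by rewrite /togerm -raddfD. Qed.

Lemma germZ c f : togerm (fun n => c *: f n) = c *: togerm f.
Proof. by rewrite /togerm -linearZ. Qed.

Lemma germ_sum I (r : seq I) (F : I -> nat -> V) :
  togerm (fun n => \sum_(i <- r) F i n) = \sum_(i <- r) togerm (F i).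
Proof.
elim: r => [|i r IH].
  rewrite big_nil -(raddf0 (lpi (evz : set (nat -> V)))); congr lpi.
  by apply: funext => n; rewrite big_nil.
rewrite big_cons -IH -germD; congr togerm; apply: funext => n.
by rewrite big_cons.
Qed.
End Germs.

(** * The block morphism attached to a column k *)

Section Retraction.
Context {K : numClosedFieldType} (q : K) (U : hopfStarAlg K) (t : 'I_4 -> 'I_4 -> U) (Dinv : U).
Hypotheses (q0 : q != 0) (qR : q^* = q) (hU : is_Uq4 q t Dinv).
Variable k : nat.
Hypothesis k4 : (k < 4)%N.

Local Notation T := (tgen t).
Local Notation Z := (zcoord t).
Local Notation Zs := (zstar t).
Local Notation Dq := (qdet q t).
Local Notation gen := (fun g : Uq4_gen => if g is Some (i, j) then t i j else Dinv).
Local Notation free_alg := {malg K[{fmonom Uq4_gen}]}.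

(* Deleting column k of (t_ij) and transposing turns the first three rows into a
   representation of U_q(3); its quantum determinant is, up to scalars, D_q z_k^*, so D_q^{-1}
   becomes available after multiplication by a power of z_k^*. *)
Definition kappa (g : Uq4_gen) : U :=
  if g is Some (i, j) then
    if (i == 3 :> nat) then (j == 3 :> nat)%:R
    else if (j == 3 :> nat) then 0 else T j (bump k i)
  else Dinv.

Definition kappa_word (w : seq Uq4_gen) : U := \prod_(g <- w) kappa g.

(** The sign and the power of q that occur in [minor_row]. *)
Definition kgam : K := (-1) ^+ (k + 3) * q ^+ (3 - k).
Definition ks : U := kgam *: Zs k.

Lemma kgam0 : kgam != 0.
Proof. by rewrite mulf_neq0 // ?expf_neq0 // ?signr_eq0 // oppr_eq0 oner_eq0. Qed.

Lemma kgamR : kgam^* = kgam.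
Proof. by rewrite /kgam rmorphM rmorph_sign rmorphXn /= qR. Qed.

Lemma star_scale c (x : U) : star (c *: x) = c^* *: star x.
Proof. exact: hopf_starZ. Qed.

Lemma star0 : star (0 : U) = 0.
Proof. by rewrite -[X in star X](scale0r 0) star_scale rmorph0 scale0r. Qed.

Lemma star1 : star (1 : U) = 1.
Proof.
have := hopf_starM (1 : U) (star 1); rewrite mul1r hopf_starK => e.
by rewrite -[LHS]mul1r -e.
Qed.

Lemma starX (x : U) n : star (x ^+ n) = star x ^+ n.
Proof. by elim: n => [|n IH]; rewrite ?star1 // exprS hopf_starM IH exprSr. Qed.

Lemma star_ks : star ks = kgam *: Z k.
Proof. by rewrite /ks star_scale kgamR (star_Zs hU). Qed.

Lemma Dq_Z i : (i < 4)%N -> Dq * Z i = Z i * Dq.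
Proof. by move=> i4; exact: (Dq_T q0 hU). Qed.

Lemma Dq_Zs i : (i < 4)%N -> Dq * Zs i = Zs i * Dq.
Proof.
move=> i4; have := congr1 (@star K U) (Dinv_T q0 hU (isT : (3 < 4)%N) i4).
by rewrite !hopf_starM (star_Dinv hU) -/(Z i) (star_Z hU).
Qed.

Lemma bump4 i : (i < 3)%N -> (bump k i < 4)%N.
Proof. by move=> i3; rewrite /bump (leq_ltn_trans (leq_add (leq_b1 _) (leqnn i))). Qed.

Lemma ks_kap g : ks * kappa g = kappa g * ks.
Proof.
rewrite /ks -scalerAl -scalerAr; congr (_ *: _).
case: g => [[i j]|] /=; last first.
  have := congr1 (@star K U) (Dq_Z k4).
  by rewrite !hopf_starM (star_Z hU) (star_Dq hU).
case: ifP => [_|/negbT i3]; first by rewrite -scaler_nat -scalerAr -scalerAl mulr1 mul1r.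
case: ifP => [_|/negbT j3]; first by rewrite mulr0 mul0r.
have {}i3 : (i < 3)%N by rewrite ltn_neqAle i3 -ltnS ltn_ord.
have {}j3 : (j < 3)%N by rewrite ltn_neqAle j3 -ltnS ltn_ord.
rewrite (ST_T_comm q0 hU) ?bump4 ?ltn_ord //; first by rewrite neq_ltn j3.
by rewrite eq_sym neq_bump.
Qed.

Lemma ks_kword w : ks * kappa_word w = kappa_word w * ks.
Proof.
elim: w => [|g w IH]; first by rewrite /kappa_word big_nil mulr1 mul1r.
by rewrite /kappa_word big_cons mulrA ks_kap -!mulrA; congr (_ * _).
Qed.

Lemma ksX_kword n w : ks ^+ n * kappa_word w = kappa_word w * ks ^+ n.
Proof.
by elim: n => [|n IH]; rewrite ?expr0 ?mul1r ?mulr1 // exprS -mulrA IH !mulrA ks_kword.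
Qed.

Definition ndinv (w : seq Uq4_gen) : nat := count (pred1 None) w.

(** Stands for ks^n kappa(p), where kappa(D_q^-1) should be ks^-1 D_q^-1: each letter D_q^-1 lowers
    the exponent by one, so the value is meaningful only when n is at least the number of these
    letters. It is antilinear because [star] is applied to it later. *)
Definition kapn (n : nat) (p : free_alg) : U :=
  free_lift Num.conj (fun m : {fmonom Uq4_gen} => ks ^+ (n - ndinv m) * kappa_word m) p.

Lemma kapnD n p r : kapn n (p + r) = kapn n p + kapn n r.
Proof. exact: free_liftD. Qed.

Lemma kapnB n p r : kapn n (p - r) = kapn n p - kapn n r.
Proof. exact: free_liftB. Qed.

Lemma kapnZ n c p : kapn n (c *: p) = c^* *: kapn n p.
Proof. exact: free_liftZ. Qed.

Lemma kapn0 n : kapn n 0 = 0.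
Proof. exact: free_lift0. Qed.

Lemma kapnU n m : kapn n << m >> = ks ^+ (n - ndinv m) * kappa_word m.
Proof. exact: free_liftU1. Qed.

Lemma kapn1 n : kapn n 1 = ks ^+ n.
Proof. by rewrite (kapnU n mone) /ndinv /kappa_word fm1 big_nil subn0 mulr1. Qed.

Lemma kapn_mid n u p v : kapn n (<< u >> * p * << v >>) =
  kappa_word u * kapn (n - ndinv u - ndinv v) p * kappa_word v.
Proof.
move: p; apply: malg_ind => [|c m p IH].
  by rewrite mulr0 mul0r !kapn0 mulr0 mul0r.
rewrite mulrDr malgZr mulrDl malgZl kapnD IH [in RHS]kapnD mulrDr mulrDl.
congr (_ + _); rewrite [LHS]kapnZ [in RHS]kapnZ -[in RHS]scalerAr -[RHS]scalerAl.
congr (_ *: _); rewrite malgUM malgUM [LHS]kapnU [in RHS]kapnU !fmM /ndinv !count_cat.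
rewrite {1}/kappa_word !big_cat /= -/(kappa_word u) -/(kappa_word m) -/(kappa_word v) !mulrA.
rewrite -[in RHS]ksX_kword; congr (_ ^+ _ * _ * _ * _).
by rewrite -!subnDA -addnA [(count _ m + _)%N]addnC.
Qed.

Lemma kapn_mul n u p : kapn n (<< u >> * p) = kappa_word u * kapn (n - ndinv u) p.
Proof.
have := kapn_mid n u p mone; rewrite -[<< mone >>]/(1 : free_alg) mulr1 => ->.
by rewrite /ndinv fm1 /kappa_word big_nil mulr1 subn0.
Qed.

Lemma kapn_Some n i j p : kapn n (free_t i j * p) = kappa (Some (i, j)) * kapn n p.
Proof. by rewrite kapn_mul /ndinv fmU /kappa_word big_seq1 subn0. Qed.

Lemma kapn_free n i j : kapn n (free_t i j) = kappa (Some (i, j)) * ks ^+ n.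
Proof. by rewrite -[free_t i j]mulr1 kapn_Some kapn1. Qed.

Lemma kapn_quad n c i j i' j' k1 l k' l' :
  kapn n (free_t i j * free_t i' j' - c *: (free_t k1 l * free_t k' l')) =
  (kappa (Some (i, j)) * kappa (Some (i', j')) -
    c^* *: (kappa (Some (k1, l)) * kappa (Some (k', l')))) * ks ^+ n.
Proof.
rewrite kapnB mulrBl; congr (_ - _); first by rewrite [LHS]kapn_Some kapn_free mulrA.
by rewrite [LHS]kapnZ -scalerAl; congr (_ *: _); rewrite [LHS]kapn_Some kapn_free mulrA.
Qed.

Lemma kappa_lt (i j : 'I_4) : (i < 3)%N -> (j < 3)%N -> kappa (Some (i, j)) = T j (bump k i).
Proof. by move=> i3 j3; rewrite /kappa (ltn_eqF i3) (ltn_eqF j3). Qed.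

Lemma kappa_lt3 (i j : 'I_4) : (i < 3)%N -> j = 3 :> nat -> kappa (Some (i, j)) = 0.
Proof. by move=> i3 j3; rewrite /kappa (ltn_eqF i3) j3 eqxx. Qed.

Lemma kappa_3lt (i j : 'I_4) : i = 3 :> nat -> (j < 3)%N -> kappa (Some (i, j)) = 0.
Proof. by move=> i3 j3; rewrite /kappa i3 eqxx (ltn_eqF j3). Qed.

Lemma kappa_33 (i j : 'I_4) : i = 3 :> nat -> j = 3 :> nat -> kappa (Some (i, j)) = 1.
Proof. by move=> i3 j3; rewrite /kappa i3 j3 !eqxx. Qed.

Lemma ord4P (i : 'I_4) : (i < 3)%N \/ i = 3 :> nat.
Proof.
by have := ltn_ord i; rewrite ltnS leq_eqVlt => /orP[/eqP|]; [right | left].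
Qed.

Lemma bump_lt i j : (i < j)%N -> (j < 3)%N -> (bump k i < bump k j < 4)%N.
Proof. by move=> ij j3; rewrite bump4 // andbT !ltnNge leq_bump2 -ltnNge. Qed.

Lemma ltn34 i : (i < 3)%N -> (i < 4)%N. Proof. exact: ltnW. Qed.

Lemma kappa_col (i j l : 'I_4) : (i < j)%N ->
  kappa (Some (i, l)) * kappa (Some (j, l)) = q *: (kappa (Some (j, l)) * kappa (Some (i, l))).
Proof.
move=> ij; have i3 : (i < 3)%N by rewrite (leq_trans ij) // -ltnS.
have [l3|l3] := ord4P l; last by rewrite (kappa_lt3 i3 l3) mulr0 mul0r scaler0.
have [j3|j3] := ord4P j; last by rewrite (kappa_3lt j3 l3) mulr0 mul0r scaler0.
by rewrite !kappa_lt // (T_row hU) // bump_lt.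
Qed.

Lemma kappa_row (i j l : 'I_4) : (i < j)%N ->
  kappa (Some (l, i)) * kappa (Some (l, j)) = q *: (kappa (Some (l, j)) * kappa (Some (l, i))).
Proof.
move=> ij; have i3 : (i < 3)%N by rewrite (leq_trans ij) // -ltnS.
have [l3|l3] := ord4P l; last by rewrite (kappa_3lt l3 i3) mulr0 mul0r scaler0.
have [j3|j3] := ord4P j; last by rewrite (kappa_lt3 l3 j3) mulr0 mul0r scaler0.
by rewrite !kappa_lt // (T_col hU) // ij ltn34.
Qed.

Lemma kappa_comm (i j k1 l : 'I_4) : (i < j)%N -> (k1 < l)%N ->
  kappa (Some (i, l)) * kappa (Some (j, k1)) = kappa (Some (j, k1)) * kappa (Some (i, l)).
Proof.
move=> ij kl; have i3 : (i < 3)%N by rewrite (leq_trans ij) // -ltnS.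
have k3 : (k1 < 3)%N by rewrite (leq_trans kl) // -ltnS.
have [l3|l3] := ord4P l; last by rewrite (kappa_lt3 i3 l3) mulr0 mul0r.
have [j3|j3] := ord4P j; last by rewrite (kappa_3lt j3 k3) mulr0 mul0r.
by rewrite !kappa_lt // (T_comm hU (i := k1) (j := l)) ?bump_lt // kl ltn34.
Qed.

Lemma kappa_cross (i j k1 l : 'I_4) : (i < j)%N -> (k1 < l)%N ->
  kappa (Some (i, k1)) * kappa (Some (j, l)) - kappa (Some (j, l)) * kappa (Some (i, k1)) =
  (q - q^-1) *: (kappa (Some (j, k1)) * kappa (Some (i, l))).
Proof.
move=> ij kl; have i3 : (i < 3)%N by rewrite (leq_trans ij) // -ltnS.
have k3 : (k1 < 3)%N by rewrite (leq_trans kl) // -ltnS.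
have [l3|l3] := ord4P l; have [j3|j3] := ord4P j.
- have kl4 : (k1 < l < 4)%N by rewrite kl ltn34.
  rewrite !kappa_lt // (T_cross hU kl4 (bump_lt ij j3)) addrC addrA addNr add0r.
  by rewrite (T_comm hU kl4 (bump_lt ij j3)).
- by rewrite (kappa_3lt j3 l3) (kappa_3lt j3 k3) mulr0 !mul0r subr0 scaler0.
- by rewrite (kappa_lt3 i3 l3) (kappa_lt3 j3 l3) mulr0 mul0r mulr0 subr0 scaler0.
- by rewrite (kappa_33 j3 l3) (kappa_3lt j3 k3) mulr1 !mul1r mul0r subrr scaler0.
Qed.

#[local] Arguments lapdet : simpl never.

Lemma lapdet_block (A : algType K) n (f : nat -> nat -> A) :
  (forall j, (j < n)%N -> f n j = 0) -> lapdet q n.+1 f = lapdet q n f * f n n.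
Proof.
elim: n f => [|n IH] f f0.
  by rewrite lapdetS big_ord1 expr0 scale1r mulr1 mul1r.
rewrite lapdetS big_ord_recr /= f0 // mul0r scaler0 addr0 lapdetS mulr_suml; apply: eq_bigr => i _.
have lein : (i <= n)%N by rewrite -ltnS ltn_ord.
rewrite IH => [|j jn]; first by rewrite -[in RHS]scalerAl mulrA /bump /= lein add1n.
by rewrite /bump /= lein add1n f0.
Qed.

Lemma kappa_qdet : qdet q (fun i j => kappa (Some (i, j))) = kgam *: (Dq * Zs k).
Proof.
pose f i j := kappa (Some (inord i, inord j)).
have -> : qdet q (fun i j => kappa (Some (i, j))) = lapdet q 4 f.
  rewrite -lapdetE /qdet; apply: eq_bigr => s _; congr (_ *: _).
  by apply: eq_bigr => j _; rewrite /f !inord_val.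
rewrite lapdet_block; last first.
  by move=> j j3; rewrite /f kappa_3lt ?inordK // ltn34.
rewrite /f [kappa _]kappa_33 ?inordK // mulr1 -(minor_row q0 hU k4).
by apply: eq_lapdet => a b a3 b3; rewrite kappa_lt ?inordK // ltn34.
Qed.

Lemma kapn_qdet n : kapn n (qdet q free_t) = kgam *: (Dq * Zs k) * ks ^+ n.
Proof.
rewrite -kappa_qdet /qdet [kapn _ _]free_lift_sum mulr_suml; apply: eq_bigr => s _.
rewrite -/(kapn n _) [kapn n _]kapnZ rmorphXn rmorphN /= qR -scalerAl; congr (_ *: _).
elim: (index_enum 'I_4) => [|j r IH]; first by rewrite !big_nil kapn1 mul1r.
by rewrite !big_cons [LHS]kapn_Some IH mulrA.
Qed.

(** The entries of [kappa] satisfy the quadratic relations outright. Their determinant is D_q [ks],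
    whose factor [ks] makes up for the exponent given up for D_q^-1; this takes n > 0. *)
Lemma kapn_rel r n : Uq4_rel q r -> (0 < n)%N -> kapn n r = 0.
Proof.
case=> [i j l ij|i j l ij|i j k1 l ij kl|i j k1 l ij kl||] n0.
- by rewrite /= kapn_quad qR kappa_col // subrr mul0r.
- by rewrite /= kapn_quad qR kappa_row // subrr mul0r.
- by rewrite /= -[X in _ - X]scale1r kapn_quad rmorph1 scale1r kappa_comm // subrr mul0r.
- rewrite /= kapnB -[X in kapn n (_ - X)]scale1r kapn_quad rmorph1 scale1r kappa_cross //.
  rewrite [kapn n (_ *: _)]kapnZ [kapn n (_ * _)]kapn_Some kapn_free.
  by rewrite rmorphB fmorphV /= qR -scalerAl mulrA subrr.
- have := kapn_mid n mone (qdet q free_t) (fmu (None : Uq4_gen)).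
  rewrite -[<< mone >>]/(1 : free_alg) mul1r /ndinv fm1 fmU /kappa_word big_nil big_seq1 mul1r.
  rewrite /= subn0 kapnB kapn1 kapn_qdet => ->; apply/eqP; rewrite subr_eq0; apply/eqP.
  have -> : kgam *: (Dq * Zs k) * ks ^+ (n - 1) * Dinv =
      kgam *: Zs k * (Dq * ks ^+ (n - 1) * Dinv).
    by rewrite Dq_Zs // -!scalerAl !mulrA.
  have -> : Dq * ks ^+ (n - 1) * Dinv = ks ^+ (n - 1).
    have Dks : Dq * ks = ks * Dq by rewrite /ks -scalerAl -scalerAr Dq_Zs.
    have -> : Dq * ks ^+ (n - 1) = ks ^+ (n - 1) * Dq.
      by elim: (n - 1)%N => [|m IH]; rewrite ?mul1r ?mulr1 // exprS mulrA Dks -!mulrA IH.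
    by rewrite -mulrA (DqM hU) mulr1.
  by rewrite -/ks -exprS subn1 prednK.
- rewrite /= kapnB kapn1 [kapn n (_ * _)]kapn_mul kapn_qdet /ndinv fmU /kappa_word big_seq1 /=.
  rewrite -[X in Dinv * X]scalerAl -scalerAr !mulrA (DinvM hU) mul1r scalerAl -/ks.
  by rewrite -exprS subn1 prednK // subrr.
Qed.

(** The letters D_q^-1 around a relation reduce the exponent left for it, so the bound on n depends
    on the element and vanishing holds only eventually. *)
Lemma evz_ideal p : p \in two_sided_ideal (Uq4_rel q) -> evz (kapn^~ p).
Proof.
move=> /lspanP /(_ [pred p | `[< evz (kapn^~ p) >]]) P; apply/asboolP/P.
  split=> [|c u v].
    by apply/asboolP; exists 0%N => n _; rewrite kapn0.
  rewrite !inE => /asboolP eu /asboolP ev; apply/asboolP.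
  have [N e] := evzZD c^* eu ev; exists N => n le.
  by rewrite kapnD kapnZ; exact: e.
move=> _ [u [r [v [rr ->]]]]; apply/asboolP.
move: u; apply: malg_ind => [|c u x [N IH]].
  by exists 0%N => n _; rewrite !mul0r kapn0.
suff [M e] : evz (kapn^~ (<< u >> * r * v)).
  exists (M + N)%N => n le; rewrite !mulrDl malgZl malgZl kapnD kapnZ.
  have e1 := e n (leq_trans (leq_addr _ _) le).
  have e2 := IH n (leq_trans (leq_addl _ _) le).
  by apply: etrans (congr2 (fun a b => c^* *: a + b) e1 e2) _; rewrite scaler0 addr0.
move: v {IH N}; apply: malg_ind => [|d v y [N IH]].
  by exists 0%N => n _; rewrite mulr0 kapn0.
(* The summand 1 keeps the exponent positive after the letters D_q^-1 of u and v have taken their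
   share. *)
exists (ndinv u + ndinv v + 1 + N)%N => n le.
rewrite mulrDr malgZr kapnD kapnZ.
have e1 : kapn n (<< u >> * r * << v >>) = 0.
  rewrite kapn_mid kapn_rel ?mulr0 ?mul0r //.
  by rewrite -subnDA subn_gt0 -addn1 (leq_trans _ le) // leq_addr.
have e2 := IH n (leq_trans (leq_addl _ _) le).
by apply: etrans (congr2 (fun a b => d^* *: a + b) e1 e2) _; rewrite scaler0 addr0.
Qed.

Lemma evz_eval p r : free_eval gen p = free_eval gen r -> evz (fun n => kapn n p - kapn n r).
Proof.
move=> e; have [N eN] : evz (kapn^~ (p - r)).
  by apply/evz_ideal/(Uq4_presented hU).2; rewrite free_evalB e subrr.
by exists N => n le; rewrite -kapnB eN.
Qed.
End Retraction.

Definition zgen (K : numClosedFieldType) (U : hopfStarAlg K) (t : 'I_4 -> 'I_4 -> U) : set U :=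
  fun y => exists2 i, (i < 4)%N & y = zcoord t i \/ y = zstar t i.

Section SphereCoinvariants.
Context {K : numClosedFieldType} (q : K) (U : hopfStarAlg K) (t : 'I_4 -> 'I_4 -> U) (Dinv : U).
Hypotheses (q0 : q != 0) (qR : q^* = q) (hU : is_Uq4 q t Dinv).

Local Notation T := (tgen t).
Local Notation Z := (zcoord t).
Local Notation Zs := (zstar t).
Local Notation Dq := (qdet q t).
Local Notation B := (gen_subalg (zgen t)).

Lemma B_Z i : (i < 4)%N -> B (Z i).
Proof. by move=> i4; apply: galg_gen; exists i => //; left. Qed.

Lemma B_Zs i : (i < 4)%N -> B (Zs i).
Proof. by move=> i4; apply: galg_gen; exists i => //; right. Qed.

Lemma Dq_B b : B b -> Dq * b = b * Dq.
Proof.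
move: b; apply: galg_ind => [|c x y Dx Dy|x y Dx Dy|x [i i4 [->|->]]].
- by rewrite mulr1 mul1r.
- by rewrite mulrDr mulrDl -scalerAr -scalerAl Dx Dy.
- by rewrite mulrA Dx -mulrA Dy mulrA.
- exact: Dq_Z q0 hU _ i4.
- exact: Dq_Zs q0 hU _ i4.
Qed.

(* Moving b past T k j yields coefficients independent of the row k < 3. *)
Lemma B_T b : B b -> forall j, (j < 4)%N -> exists2 b' : nat -> U, (forall l, B (b' l)) &
  forall k, (k < 3)%N -> b * T k j = \sum_(l < 4) T k l * b' l.
Proof.
have single j (c : U) : (j < 4)%N -> B c -> exists2 b' : nat -> U, (forall l, B (b' l)) &
  forall k, T k j * c = \sum_(l < 4) T k l * b' l.
  move=> j4 Bc; exists (fun l => if l == j then c else 0) => [l|k].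
    by case: ifP => _ //; exact: galg0.
  rewrite (bigD1 (Ordinal j4)) //= eqxx big1 ?addr0 // => l.
  by rewrite -val_eqE /= => /negbTE ->; rewrite mulr0.
move: b; apply: galg_ind => [|c x y IHx IHy|x y IHx IHy|x [i i4 [->|->]]] j j4.
- have [b' Bb' e] := single j 1 j4 (@galg1 _ _ _).
  by exists b' => // k _; rewrite mul1r -e mulr1.
- have [u Bu eu] := IHx j j4; have [v Bv ev] := IHy j j4.
  exists (fun l => c *: u l + v l) => [l|k k3]; first by apply: galgZD.
  rewrite mulrDl -scalerAl eu // ev // scaler_sumr -big_split /=.
  by apply: eq_bigr => l _; rewrite mulrDr -scalerAr.
- have [v Bv ev] := IHy j j4.
  have [u Hu] : exists u : nat -> nat -> U, forall m, (m < 4)%N -> (forall l, B (u m l)) /\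
      forall k, (k < 3)%N -> x * T k m = \sum_(l < 4) T k l * u m l.
    have [f Hf] := choice (fun m : 'I_4 => let: ex_intro2 u Bu eu := IHx m (ltn_ord m) in
      ex_intro (fun u : nat -> U => (forall l, B (u l)) /\
        forall k, (k < 3)%N -> x * T k m = \sum_(l < 4) T k l * u l) u (conj Bu eu)).
    exists (fun m => f (inord m)) => m m4; have [Bf ef] := Hf (inord m).
    by split=> // k k3; rewrite -ef // inordK.
  exists (fun l => \sum_(m < 4) u m l * v m) => [l|k k3].
    by apply: galg_sum => m _; apply: galgM => //; exact: (Hu m (ltn_ord m)).1.
  rewrite -mulrA ev // mulr_sumr.
  rewrite (eq_bigr (fun m : 'I_4 => \sum_(l < 4) T k l * (u m l * v m))).
    by rewrite exchange_big /=; apply: eq_bigr => l _; rewrite mulr_sumr.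
  move=> m _; rewrite mulrA (Hu m (ltn_ord m)).2 // mulr_suml.
  by apply: eq_bigr => l _; rewrite mulrA.
- case: (ltngtP i j) => [ij|ji|->].
  + have [b' Bb' e] := single j _ j4 (B_Z i4).
    by exists b' => // k k3; rewrite -e (T_comm hU (i := k) (j := 3)) ?k3 ?ij.
  + have [b' Bb' e] := single j _ j4 (B_Z i4).
    have [b'' Bb'' e'] := single i _ i4 (B_Z j4).
    (* The cross relation reads z_i T_kj = T_kj z_i - (q - q^-1) T_ki z_j. *)
    exists (fun l => b' l + (- (q - q^-1)) *: b'' l) => [l|k k3].
      by apply: galgD => //; exact: galgZ.
    have k34 : (k < 3 < 4)%N by rewrite k3.
    have ji4 : (j < i < 4)%N by rewrite ji.
    rewrite (eq_bigr (fun l : 'I_4 => T k l * b' l + (- (q - q^-1)) *: (T k l * b'' l))).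
      rewrite big_split /= -scaler_sumr -e -e' /zcoord (T_cross hU k34 ji4) (T_comm hU k34 ji4).
      by rewrite scaleNr addrK.
    by move=> l _; rewrite mulrDr -scalerAr.
  + have [b' Bb' e] := single j _ j4 (galgZ q^-1 (B_Z j4)).
    exists b' => // k k3; rewrite -e /zcoord -scalerAr (T_col hU j (i := k)) ?k3 //.
    by rewrite scalerA mulVf // scale1r.
- have [ij|ij] := eqVneq i j; last first.
    have [b' Bb' e] := single j _ j4 (B_Zs i4).
    exists b' => // k k3; rewrite -e /zstar (ST_T_comm q0 hU) ?(ltn34 k3) //.
      by rewrite neq_ltn k3.
    by rewrite eq_sym.
  subst i; exists (fun l => if (l < j)%N then (q^-1 - q) *: Zs l
      else if l == j then q^-1 *: Zs j else 0) => [l|k k3].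
    case: ltnP => [lj|_]; first by apply/galgZ/B_Zs/(ltn_trans lj).
    by case: eqP => _; [exact/galgZ/B_Zs | exact: galg0].
  rewrite (Zs_upper q0 hU k3 j4) addrC -(big_mkord xpredT (fun l => T k l * Zs l)).
  rewrite -(big_mkord xpredT (fun l => T k l * (if (l < j)%N then (q^-1 - q) *: Zs l
      else if l == j then q^-1 *: Zs j else 0))).
  rewrite [RHS](big_cat_nat (n := j)) //=; last exact: ltnW.
  congr (_ + _).
    rewrite [RHS]big_nat [in LHS]big_nat scaler_sumr; apply: eq_bigr => l /andP[_ ->].
    by rewrite -scalerAr.
  rewrite big_ltn // ltnn eqxx -scalerAr big_nat big1 ?addr0 // => l /andP[jl _].
  by rewrite ltnNge (ltnW jl) /= (gtn_eqF jl) mulr0.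
Qed.
End SphereCoinvariants.

(** * Powers of z_k times a coinvariant *)

Section SphereRetraction.
Context {K : numClosedFieldType} (q : K) (U : hopfStarAlg K) (t : 'I_4 -> 'I_4 -> U) (Dinv : U).
Hypotheses (q0 : q != 0) (qR : q^* = q) (hU : is_Uq4 q t Dinv).
Variable k : nat.
Hypothesis k4 : (k < 4)%N.

Local Notation T := (tgen t).
Local Notation Z := (zcoord t).
Local Notation Dq := (qdet q t).
Local Notation S := (ST t).
Local Notation gen := (fun g : Uq4_gen => if g is Some (i, j) then t i j else Dinv).
Local Notation free_alg := {malg K[{fmonom Uq4_gen}]}.
Local Notation B := (gen_subalg (zgen t)).
Local Notation kap := (kappa t Dinv k).
Local Notation kword := (kappa_word t Dinv k).
Local Notation kapn := (kapn q t Dinv k).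
Local Notation ks := (ks q t k).
Local Notation L := (ideal_L t).

Lemma kapn_mulr n p v : kapn n (p * << v >>) = kapn (n - ndinv v) p * kword v.
Proof.
have := kapn_mid q0 hU k4 n mone p v; rewrite -[<< mone >>]/(1 : free_alg) mul1r => ->.
by rewrite /ndinv fm1 /kappa_word big_nil mul1r subn0.
Qed.

Lemma kapn_mul_free n p i j : kapn n (p * free_t i j) = kapn n p * kap (Some (i, j)).
Proof. by rewrite kapn_mulr /ndinv fmU /kappa_word big_seq1 subn0. Qed.

Lemma kapn_L0 s : (s = t (idx 4) (idx 4) - 1 \/
    (exists2 j, j \in [:: 1; 2; 3]%N & s = t (idx j) (idx 4) \/ s = t (idx 4) (idx j))) ->
  exists2 r, free_eval gen r = s & forall n p, kapn n (p * r) = 0.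
Proof.
have i3 : idx 4 = 3 :> nat by rewrite /idx inordK.
case=> [->|[j j3]].
  exists (free_t (idx 4) (idx 4) - 1) => [|n p].
    by rewrite free_evalB [free_eval _ 1]free_eval1 free_eval_gen.
  by rewrite mulrBr mulr1 kapnB kapn_mul_free kappa_33 // mulr1 subrr.
have lt : (idx j < 3)%N by move: j3; rewrite !inE => /or3P[] /eqP->; rewrite /idx inordK.
case=> ->.
  exists (free_t (idx j) (idx 4)) => [|n p]; first by rewrite free_eval_gen.
  by rewrite kapn_mul_free kappa_lt3 // mulr0.
exists (free_t (idx 4) (idx j)) => [|n p]; first by rewrite free_eval_gen.
by rewrite kapn_mul_free kappa_3lt // mulr0.
Qed.

Lemma evz_L x : x \in lspan L -> forall p, free_eval gen p = x -> evz (kapn^~ p).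
Proof.
pose P := [pred x | `[< forall p, free_eval gen p = x -> evz (kapn^~ p) >]].
have Psub : submod_closed P.
  split=> [|c u v].
    apply/asboolP => p p0; apply: (evz_ideal q0 qR hU k4).
    exact/(Uq4_presented hU).2.
  rewrite !inE => /asboolP Pu /asboolP Pv; apply/asboolP => p pE.
  have [pu puE] := presented_repr (Uq4_presented hU) u.
  have [pv pvE] := presented_repr (Uq4_presented hU) v.
  have e : free_eval gen p = free_eval gen (c *: pu + pv).
    by rewrite pE free_evalD [free_eval _ (_ *: _)]free_evalZ puE pvE.
  have [N1 e1] := evz_eval q0 qR hU k4 e.
  have [N2 e2] := evzZD c^* (Pu pu puE) (Pv pv pvE).
  exists (N1 + N2)%N => n le; have := e1 n (leq_trans (leq_addr _ _) le).
  move/eqP; rewrite subr_eq0 => /eqP ->.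
  by rewrite kapnD kapnZ; exact: e2 (leq_trans (leq_addl _ _) le).
(* [L] is itself a linear span, so the span is unfolded twice. *)
move=> /lspanP /(_ P Psub) H; apply/asboolP; apply: H => y /lspanP /(_ P Psub) H.
apply: H => _ [u [s [Ls ->]]]; apply/asboolP => p pE.
have [pu puE] := presented_repr (Uq4_presented hU) u.
have [r rE r0] := kapn_L0 Ls.
have e : free_eval gen p = free_eval gen (pu * r).
  by rewrite pE [RHS]free_evalM puE rE.
have [N eN] := evz_eval q0 qR hU k4 e.
by exists N => n le; have := eN n le; rewrite r0 subr0.
Qed.

Definition frepr (x : U) : free_alg := projT1 (presented_repr (Uq4_presented hU) x).

Lemma freprK x : free_eval gen (frepr x) = x.
Proof. by rewrite /frepr; case: presented_repr. Qed.

(** The map c, v |-> star(kappa(c)) v. By [evz_L] another representative of c changes only finitely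
    many terms of the sequence. *)
Definition PhiL (c : lquot L) (v : U) : @germ K U :=
  togerm (fun n => star (kapn n (frepr (lrepr c))) * v).

Lemma star_sub (x y : U) : star (x - y) = star x - star y.
Proof. by rewrite -!scaleN1r hopf_starD hopf_starZ rmorphN1 scaleN1r. Qed.

Lemma PhiLE p v : PhiL (lpi L (free_eval gen p)) v = togerm (fun n => star (kapn n p) * v).
Proof.
apply/germ_eq; set c := lpi L _.
have cL : lrepr c - free_eval gen p \in lspan L by apply/lpi_eq; rewrite lreprK.
have e : free_eval gen (frepr (lrepr c) - p) = lrepr c - free_eval gen p.
  by rewrite free_evalB freprK.
have [N eN] := evz_L cL e; exists N => n le.
have {eN le} := eN n le; rewrite kapnB => e0.
by rewrite -mulrBl -star_sub e0 star0 mul0r.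
Qed.

Lemma bilin_PhiL : bilin idfun PhiL.
Proof.
split=> [c c' v|c v v'|a c v|a c v].
- rewrite -[c]lreprK -[c']lreprK -[lrepr c]freprK -[lrepr c']freprK.
  rewrite -raddfD -free_evalD !PhiLE -germD; congr togerm; apply: funext => n.
  by rewrite kapnD hopf_starD mulrDl.
- rewrite -[c]lreprK -[lrepr c]freprK !PhiLE -germD; congr togerm; apply: funext => n.
  by rewrite mulrDr.
- rewrite -[c]lreprK -[lrepr c]freprK -linearZ -free_evalZ !PhiLE -germZ.
  congr togerm; apply: funext => n.
  by rewrite kapnZ hopf_starZ conjCK -scalerAl.
- rewrite -[c]lreprK -[lrepr c]freprK !PhiLE -germZ; congr togerm; apply: funext => n.
  by rewrite -scalerAr.
Qed.

(** The sum of star(kappa(x_(1))) x_(2). For a coinvariant x this is the germ of star(ks^n) x, while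
    on every word it is the germ of such powers times a fixed element of the algebra of the z_i and
    z_i^*; comparing the two gives [sphere7_ZX]. *)
Definition Omega (x : U) : @germ K U :=
  tens_lift idfun PhiL (tens_map (lpi L) idfun (Delta U x)).

Lemma OmegaD x y : Omega (x + y) = Omega x + Omega y.
Proof.
by rewrite /Omega linearD tens_mapD (bliftD bilin_PhiL).
Qed.

Lemma OmegaZ c x : Omega (c *: x) = c *: Omega x.
Proof.
by rewrite /Omega linearZ tens_mapZ (bliftZ bilin_PhiL).
Qed.

Lemma Omega_sum (I : Type) (l : seq I) (f g : I -> U) x :
  Delta U x = \sum_(e <- l) tens (f e) (g e) ->
  Omega x = \sum_(e <- l) PhiL (lpi L (f e)) (g e).
Proof.
rewrite /Omega => ->; rewrite tens_map_sum (blift_sum bilin_PhiL).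
apply: eq_bigr => e _; by rewrite tens_mapE (blift_tens bilin_PhiL).
Qed.

Lemma Delta_Dinv : Delta U Dinv = tens Dinv Dinv.
Proof.
have DD : Delta U Dq = tens Dq Dq by case: hU => _ [[_ -> _ _] _].
have e1 : tens_mul (Delta U Dq) (Delta U Dinv) = tens 1 1.
  rewrite -hopf_DeltaM (DqM hU) hopf_Delta1; reflexivity.
have e2 : tens_mul (tens Dinv Dinv) (Delta U Dq) = tens 1 1.
  rewrite DD tens_mul_tens (DinvM hU); reflexivity.
rewrite -[LHS]tens_mul1l -e2 -tens_mulA e1 tens_mul1; reflexivity.
Qed.

#[local] Arguments kappa : simpl never.

(** For i < 3, moving b to the right leaves an antipode sum over the first three rows only. It
    differs from a Kronecker delta by a product z^* z, which stays in B. *)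
Lemma kappa_step b i j : B b -> B (\sum_(l < 4) star (kap (Some (i, l))) * b * t l j).
Proof.
have tT (l m : 'I_4) : t l m = T l m by rewrite /tgen !inord_val.
have o3 : (ord_max : 'I_4) = 3 :> nat by [].
move=> Bb; rewrite big_ord_recr /=; have [i3|i3] := ord4P i; last first.
  rewrite kappa_33 // star1 mul1r tT big1 ?add0r => [|l _].
    by apply: galgM => //; apply: B_Z.
  by rewrite kappa_3lt //= ?star0 ?mul0r // ltn_ord.
rewrite kappa_lt3 // star0 !mul0r addr0.
have [b' Bb' e] := B_T q0 hU Bb (ltn_ord j).
rewrite (eq_bigr (fun l : 'I_3 => \sum_(m < 4) S (bump k i) l * T l m * b' m)) => [|l _].
  rewrite exchange_big /=; apply: galg_sum => m _; rewrite -mulr_suml.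
  apply: galgM => //; have := ST_T hU (bump4 k i3) (ltn_ord m).
  rewrite big_ord_recr /= => /eqP; rewrite eq_sym -subr_eq => /eqP <-.
  apply: galgB; first by rewrite -scaler_nat; apply: galgZ; exact: galg1.
  by apply: galgM; [apply: B_Zs; exact: bump4 | apply: B_Z].
rewrite tT kappa_lt //= ?ltn_ord // (star_T hU) -mulrA e //= mulr_sumr.
by apply: eq_bigr => m _; rewrite mulrA.
Qed.

(** Induction on the last letter: [star] reverses products, so a new letter wraps around the old sum
    as in [kappa_step]. Since D_q^-1 is group-like, all words in the coproduct contain it equally
    often, whence one common exponent of [ks]. *)
Lemma word_coaction w : exists l : seq (seq Uq4_gen * U),
  [/\ all (fun e => ndinv e.1 == ndinv w) l,
      Delta U (\prod_(g <- w) gen g) = \sum_(e <- l) tens (\prod_(g <- e.1) gen g) e.2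
    & B (\sum_(e <- l) star (kword e.1) * e.2)].
Proof.
elim/last_ind: w => [|w g [l [lw lD lB]]].
  exists [:: ([::], 1)]; rewrite !big_seq1 !big_nil /kappa_word /= big_nil star1 mulr1 hopf_Delta1.
  by split=> //; exact: galg1.
have kr u h : kword (rcons u h) = kword u * kap h.
  by rewrite /kappa_word -cats1 big_cat big_seq1.
have gr u h : \prod_(g <- rcons u h) gen g = \prod_(g <- u) gen g * gen h.
  by rewrite -cats1 big_cat big_seq1.
have nr u h : ndinv (rcons u h) = (ndinv u + (h == None))%N.
  by rewrite /ndinv -cats1 count_cat /= addn0.
case: g => [[i j]|].
  exists [seq (rcons e.1 (Some (i, m)), e.2 * t m j) | e <- l, m <- index_enum 'I_4]; split.
  - apply/allP => _ /allpairsP[[e m] /= [el _ ->]] /=.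
    by rewrite !nr; move/allP/(_ _ el)/eqP: lw => ->.
  - rewrite big_allpairs_dep gr hopf_DeltaM lD tens_mul_suml; apply: eq_bigr => e _.
    have -> : Delta U (t i j) = \sum_m tens (t i m) (t m j) by case: hU => _ [[-> _ _ _] _].
    rewrite tens_mul_sumr; apply: eq_bigr => m _.
    by rewrite tens_mul_tens gr.
  - rewrite big_allpairs_dep exchange_big /=.
    have := kappa_step i j lB; congr (gen_subalg _ _); apply: eq_bigr => m _.
    rewrite mulr_sumr mulr_suml; apply: eq_bigr => e _.
    by rewrite kr hopf_starM !mulrA.
exists [seq (rcons e.1 None, e.2 * Dinv) | e <- l]; split.
- apply/allP => _ /mapP[e el ->] /=.
  by rewrite !nr; move/allP/(_ _ el)/eqP: lw => ->.
- rewrite big_map gr hopf_DeltaM lD Delta_Dinv tens_mul_suml; apply: eq_bigr => e _.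
  by rewrite tens_mul_tens gr.
- have := lB; congr (gen_subalg _ _); rewrite big_map -[LHS]mulr1 -(DqM hU) mulrA -(Dq_B q0 hU lB).
  rewrite mulr_sumr mulr_suml; apply: eq_bigr => e _.
  by rewrite kr hopf_starM /= (star_Dinv hU) !mulrA.
Qed.

Lemma Omega_word w : exists2 b, B b &
  Omega (\prod_(g <- w) gen g) = togerm (fun n => star (ks ^+ (n - ndinv w)) * b).
Proof.
have [l [lw lD lB]] := word_coaction w.
exists (\sum_(e <- l) star (kword e.1) * e.2) => //.
rewrite (Omega_sum lD).
have -> : (fun n => star (ks ^+ (n - ndinv w)) * (\sum_(e <- l) star (kword e.1) * e.2)) =
    (fun n => \sum_(e <- l) star (ks ^+ (n - ndinv w)) * (star (kword e.1) * e.2)).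
  by apply: funext => n; rewrite mulr_sumr.
rewrite germ_sum big_seq [RHS]big_seq; apply: eq_bigr => e el.
have -> : \prod_(g <- e.1) gen g = free_eval gen << FMonom e.1 >> by rewrite free_evalU.
rewrite PhiLE; congr togerm; apply: funext => n.
move/allP/(_ _ el)/eqP: lw => nd.
by rewrite kapnU /= nd (ksX_kword q0 hU) // hopf_starM mulrA.
Qed.

Lemma Omega_B x : exists2 f : nat -> U, (forall n, B (f n)) & Omega x = togerm f.
Proof.
have [p <-] := presented_repr (Uq4_presented hU) x.
move: p; apply: (@free_eval_ind K _ U gen (fun x => exists2 f : nat -> U, (forall n, B (f n)) & Omega x = togerm f)) => [|c w y [f Bf fE]].
  exists (fun=> 0) => [n|]; first exact: galg0.
  have := OmegaZ 0 0; rewrite !scale0r => ->.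
  rewrite -(scale0r (togerm (fun=> 0 : U))) -germZ; congr togerm.
  by apply: funext => n; rewrite scaler0.
have [b Bb bE] := Omega_word w.
exists (fun n => c *: (star (ks ^+ (n - ndinv w)) * b) + f n) => [n|].
  apply: galgZD => //; apply: galgM => //; rewrite starX (star_ks qR hU).
  by apply/galgX/galgZ/B_Z.
by rewrite OmegaD OmegaZ bE fE -germZ -germD.
Qed.

Lemma sphere7_ZX x : sphere7 t x -> exists N, forall n, (N <= n)%N -> B (Z k ^+ n * x).
Proof.
move=> x7; have [f Bf] := Omega_B x.
have -> : Omega x = togerm (fun n => star (ks ^+ n) * x).
  rewrite /Omega x7; rewrite (blift_tens bilin_PhiL).
  rewrite -(free_eval1 gen) PhiLE; congr togerm; apply: funext => n.
  by rewrite kapn1.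
move/germ_eq => [N eN]; exists N => n /eN /eqP; rewrite subr_eq0 => /eqP e.
have := Bf n; rewrite -e starX (star_ks qR hU) exprZn -scalerAl => /(galgZ (kgam q k ^- n)).
by rewrite scalerA mulVf ?scale1r // expf_neq0 // kgam0.
Qed.
End SphereRetraction.

(** * Coinvariants and operators *)

Section Qcommutation.
Context {K : fieldType} {A : algType K}.

Definition qcomm (u v : A) := exists c : K, u * v = c *: (v * u).

Lemma qcommMl u v w : qcomm u w -> qcomm v w -> qcomm (u * v) w.
Proof.
move=> [c uw] [d vw]; exists (d * c).
by rewrite -mulrA vw -scalerAr [u * (w * v)]mulrA uw -scalerAl scalerA mulrA.
Qed.

Lemma qcommMr u v w : qcomm u v -> qcomm u w -> qcomm u (v * w).
Proof.
move=> [c uv] [d uw]; exists (c * d).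
by rewrite mulrA uv -scalerAl -[v * u * w]mulrA uw -scalerAr scalerA mulrA.
Qed.

Lemma qcomm1r u : qcomm u 1.
Proof. by exists 1; rewrite mul1r mulr1 scale1r. Qed.

Lemma qcomm1l u : qcomm 1 u.
Proof. by exists 1; rewrite mul1r mulr1 scale1r. Qed.

Lemma qcommXr u v n : qcomm u v -> qcomm u (v ^+ n).
Proof.
move=> uv; elim: n => [|n IH]; first by rewrite expr0; exact: qcomm1r.
by rewrite exprS; exact: qcommMr.
Qed.

Lemma qcommXl u v n : qcomm u v -> qcomm (u ^+ n) v.
Proof.
move=> uv; elim: n => [|n IH]; first by rewrite expr0; exact: qcomm1l.
by rewrite exprS; exact: qcommMl.
Qed.
End Qcommutation.

Section LinearSpans.
Context {K : fieldType}.

Lemma lspan_map (V W : lmodType K) (A : set V) (B : set W) (f : V -> W) :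
  (forall c u v, f (c *: u + v) = c *: f u + f v) ->
  (forall a, A a -> f a \in lspan B) -> forall x, x \in lspan A -> f x \in lspan B.
Proof.
move=> fl fA x /lspanP /(_ [pred y | f y \in lspan B]) P; apply: P => //.
split=> [|c u v]; rewrite !inE.
  by have := fl (-1) 0 0; rewrite scaler0 addr0 scaleN1r addNr => ->; rewrite rpred0.
by move=> fu fv; rewrite fl rpredD // rpredZ.
Qed.

End LinearSpans.

Section Coinvariants.
Context {K : numClosedFieldType} (U : hopfStarAlg K).

Definition lcoinv (A : set U) (x : U) :=
  tens_map (lpi A) idfun (Delta U x) = tens (lpi A 1) x.
Definition rcoinv (A : set U) (x : U) :=
  tens_map idfun (lpi A) (Delta U x) = tens x (lpi A 1).

Lemma lcoinv1 A : lcoinv A 1.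
Proof. by rewrite /lcoinv hopf_Delta1 tens_mapE. Qed.

Lemma lcoinvZD A c x y : lcoinv A x -> lcoinv A y -> lcoinv A (c *: x + y).
Proof.
by rewrite /lcoinv linearD linearZ tens_mapD tens_mapZ => -> ->; rewrite tensDr tensZr.
Qed.

Lemma rcoinv1 A : rcoinv A 1.
Proof. by rewrite /rcoinv hopf_Delta1 tens_mapE. Qed.

Lemma rcoinvZD A c x y : rcoinv A x -> rcoinv A y -> rcoinv A (c *: x + y).
Proof.
by rewrite /rcoinv linearD linearZ tens_mapD tens_mapZ => -> ->; rewrite tensDl tensZl.
Qed.

Definition expansion (x : U) : seq (U * U) := projT1 (cid (tens_expand (Delta U x))).

Lemma expansionE x : Delta U x = \sum_(p <- expansion x) tens p.1 p.2.
Proof. by rewrite /expansion; case: cid. Qed.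

Lemma Delta_mul x y : Delta U (x * y) =
  \sum_(p <- expansion x) \sum_(r <- expansion y) tens (p.1 * r.1) (p.2 * r.2).
Proof.
rewrite hopf_DeltaM (expansionE x) (expansionE y) tens_mul_suml; apply: eq_bigr => p _.
by rewrite tens_mul_sumr; apply: eq_bigr => r _; rewrite tens_mul_tens.
Qed.

Lemma lcoinvE A x : lcoinv A x ->
  \sum_(p <- expansion x) tens (lpi A p.1) p.2 = tens (lpi A 1) x.
Proof.
rewrite /lcoinv expansionE tens_map_sum => <-.
by apply: eq_bigr => p _; rewrite tens_mapE.
Qed.

Lemma rcoinvE A x : rcoinv A x ->
  \sum_(p <- expansion x) tens p.1 (lpi A p.2) = tens x (lpi A 1).
Proof.
rewrite /rcoinv expansionE tens_map_sum => <-.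
by apply: eq_bigr => p _; rewrite tens_mapE.
Qed.

(** Left multiplication descends to the quotient by a left ideal; [F] and [G] turn the coinvariance
    identities of y and of x into the two halves of the one for x y. *)
Lemma lcoinvM A x y : (forall u v, v \in lspan A -> u * v \in lspan A) ->
  lcoinv A x -> lcoinv A y -> lcoinv A (x * y).
Proof.
move=> Al /lcoinvE cx /lcoinvE cy; rewrite /lcoinv Delta_mul.
have lpiM a u : lpi A (a * lrepr (lpi A u)) = lpi A (a * u).
  by apply/lpi_eq; rewrite -mulrBr; apply/Al/lpi_eq; rewrite lreprK.
have [F FE bF] : exists2 F : U -> U -> lquot A -> U -> tensor (lquot A) U,
    forall a b u v, F a b (lpi A u) v = tens (lpi A (a * u)) (b * v) &
    forall a b, bilin idfun (F a b).
  pose F a b (c : lquot A) (v : U) := tens (lpi A (a * lrepr c)) (b * v).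
  have FE a b u v : F a b (lpi A u) v = tens (lpi A (a * u)) (b * v).
    by rewrite /F lpiM; reflexivity.
  exists F; [exact: FE | move=> a b]; split=> [c c' v|c v v'|k c v|k c v].
  - rewrite -[c]lreprK -[c']lreprK -raddfD !FE mulrDr raddfD; exact: tensDl.
  - rewrite /F mulrDr; exact: tensDr.
  - rewrite -[c]lreprK -linearZ !FE -scalerAr linearZ; exact: tensZl.
  - rewrite /F -scalerAr; exact: tensZr.
have gy a b : \sum_(r <- expansion y) tens (lpi A (a * r.1)) (b * r.2) =
    tens (lpi A a) (b * y).
  have := congr1 (tens_lift idfun (F a b)) cy.
  rewrite (blift_sum (bF a b)) [X in _ = X -> _](blift_tens (bF a b)) [X in _ = X -> _]FE mulr1 => <-.
  by apply: eq_bigr => r _; rewrite (blift_tens (bF a b)) FE; reflexivity.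
have [G GE bG] : exists2 G : lquot A -> U -> tensor (lquot A) U,
    forall c v, G c v = tens c (v * y) & bilin idfun G.
  exists (fun c v => tens c (v * y)); first reflexivity.
  split=> [c c' v|c v v'|k c v|k c v].
  - exact: tensDl.
  - rewrite mulrDl; exact: tensDr.
  - exact: tensZl.
  - rewrite -scalerAl; exact: tensZr.
have := congr1 (tens_lift idfun G) cx.
rewrite (blift_sum bG) [X in _ = X -> _](blift_tens bG) [X in _ = X -> _]GE tens_map_sum => <-.
apply: eq_bigr => p _; rewrite [RHS](blift_tens bG) GE -gy tens_map_sum.
by apply: eq_bigr => r _; rewrite tens_mapE; reflexivity.
Qed.

Section RightIdeal.
Variable A : set U.
Hypothesis Ar : forall u v, u \in lspan A -> u * v \in lspan A.

(** Right multiplication by d descends to the quotient by a right ideal. So x_(1), x_(2) may be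
    replaced by x, 1 inside products, under every bilinear f that kills the ideal in its second
    argument. *)
Lemma rcoinv_mul_expand (V : lmodType K) (f : U -> U -> V) x c d :
  bilin idfun f -> (forall u v, v \in lspan A -> f u v = 0) ->
  rcoinv A x -> \sum_(p <- expansion x) f (p.1 * c) (p.2 * d) = f (x * c) d.
Proof.
move=> bf fA /rcoinvE cx; have [fDl fDr fZl fZr] := bf.
have [G GE bG] : exists2 G : U -> lquot A -> V,
    forall u v, G u (lpi A v) = f (u * c) (v * d) & bilin idfun G.
  pose G (u : U) (r : lquot A) := f (u * c) (lrepr r * d).
  have GE u v : G u (lpi A v) = f (u * c) (v * d).
    apply/eqP; rewrite -subr_eq0 /G; apply/eqP.
    have -> : f (u * c) (lrepr (lpi A v) * d) - f (u * c) (v * d) =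
        f (u * c) ((lrepr (lpi A v) - v) * d).
      by rewrite mulrBl fDr -[- (v * d)]scaleN1r fZr /= scaleN1r.
    by apply/fA/Ar/lpi_eq; rewrite lreprK.
  exists G; first exact: GE.
  split=> [u u' r|u r r'|k u r|k u r].
  - by rewrite /G mulrDl fDl.
  - by rewrite -[r]lreprK -[r']lreprK -raddfD !GE mulrDl fDr.
  - by rewrite /G -scalerAl fZl.
  - by rewrite -[r]lreprK -linearZ !GE -scalerAl fZr.
have := congr1 (tens_lift idfun G) cx.
rewrite (blift_sum bG) [X in _ = X -> _](blift_tens bG) [X in _ = X -> _]GE mul1r => <-.
by apply: eq_bigr => p _; rewrite (blift_tens bG) GE.
Qed.

Lemma bilin_tens_lpi : bilin idfun (fun u v : U => tens u (lpi A v)).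
Proof.
split=> [u u' v|u v v'|k u v|k u v].
- exact: tensDl.
- rewrite raddfD; exact: tensDr.
- exact: tensZl.
- rewrite linearZ; exact: tensZr.
Qed.

Lemma rcoinvM x y : rcoinv A x -> rcoinv A y -> rcoinv A (x * y).
Proof.
move=> cx /rcoinvE cy; rewrite /rcoinv Delta_mul exchange_big /= tens_map_sum.
have [G GE bG] : exists2 G : U -> lquot A -> tensor U (lquot A),
    forall u r, G u r = tens (x * u) r & bilin idfun G.
  exists (fun u r => tens (x * u) r); first reflexivity.
  split=> [u u' r|u r r'|k u r|k u r].
  - rewrite mulrDr; exact: tensDl.
  - exact: tensDr.
  - rewrite -scalerAr; exact: tensZl.
  - exact: tensZr.
have := congr1 (tens_lift idfun G) cy.
rewrite (blift_sum bG) [X in _ = X -> _](blift_tens bG) [X in _ = X -> _]GE => <-; apply: eq_bigr => p _.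
rewrite [RHS](blift_tens bG) GE tens_map_sum.
rewrite -(rcoinv_mul_expand p.1 p.2 bilin_tens_lpi _ cx).
  by apply: eq_bigr => r _; rewrite tens_mapE; reflexivity.
move=> u v /lpi_eq0 ->.
by rewrite -[X in tens _ X](scale0r 0) tensZr scale0r.
Qed.
End RightIdeal.

(* The action x |-> x_(1) f(x_(2)) of a functional f on U. *)
Definition oper (f : U -> K) (x : U) : U := tens_lift idfun (fun u v : U => f v *: u) (Delta U x).

Section Operators.
Variable f : U -> K.
Hypothesis fl : forall c u v, f (c *: u + v) = c * f u + f v.

Lemma functional0 : f 0 = 0.
Proof. by have := fl (-1) 0 0; rewrite scaler0 addr0 mulN1r addNr. Qed.

Lemma functionalD u v : f (u + v) = f u + f v.
Proof. by have := fl 1 u v; rewrite scale1r mul1r. Qed.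

Lemma functionalZ c u : f (c *: u) = c * f u.
Proof. by have := fl c u 0; rewrite !addr0 functional0 addr0. Qed.

Lemma bilin_oper : bilin idfun (fun u v : U => f v *: u).
Proof.
split=> [u u' v|u v v'|k u v|k u v] /=.
- by rewrite scalerDr.
- by rewrite functionalD scalerDl.
- by rewrite !scalerA mulrC.
- by rewrite functionalZ scalerA.
Qed.

Lemma operD x y : oper f (x + y) = oper f x + oper f y.
Proof. by rewrite /oper linearD (bliftD bilin_oper). Qed.

Lemma operZ c x : oper f (c *: x) = c *: oper f x.
Proof. by rewrite /oper linearZ (bliftZ bilin_oper). Qed.

Lemma operE I (r : seq I) (g h : I -> U) x : Delta U x = \sum_(i <- r) tens (g i) (h i) ->
  oper f x = \sum_(i <- r) f (h i) *: g i.
Proof.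
rewrite /oper => ->; rewrite (blift_sum bilin_oper); apply: eq_bigr => i _.
by rewrite (blift_tens bilin_oper).
Qed.

Lemma oper_expansion x : oper f x = \sum_(p <- expansion x) f p.2 *: p.1.
Proof. exact/operE/expansionE. Qed.

Lemma oper_mul_expansion x y : oper f (x * y) =
  \sum_(p <- expansion x) \sum_(r <- expansion y) f (p.2 * r.2) *: (p.1 * r.1).
Proof.
rewrite /oper Delta_mul (blift_sum bilin_oper); apply: eq_bigr => p _.
rewrite (blift_sum bilin_oper); apply: eq_bigr => r _.
by rewrite (blift_tens bilin_oper).
Qed.

Variable A : set U.
Hypothesis Ar : forall u v, u \in lspan A -> u * v \in lspan A.
Hypothesis fA : forall u, u \in lspan A -> f u = 0.

Lemma oper_coinv x : rcoinv A x -> oper f x = f 1 *: x.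
Proof.
move=> cx; have := rcoinv_mul_expand Ar 1 1 bilin_oper _ cx; rewrite mulr1 => <-.
  by rewrite oper_expansion; apply: eq_bigr => p _; rewrite !mulr1.
by move=> u v /fA ->; rewrite scale0r.
Qed.

Lemma oper_coinvM x y : rcoinv A x -> oper f (x * y) = x * oper f y.
Proof.
move=> cx; rewrite oper_mul_expansion exchange_big /= oper_expansion mulr_sumr.
apply: eq_bigr => r _; rewrite (rcoinv_mul_expand Ar r.1 r.2 bilin_oper _ cx) ?scalerAr //.
by move=> u v /fA ->; rewrite scale0r.
Qed.
End Operators.

(** The coproduct of a functional prescribes the Leibniz rule of its action: one term for a
    character, two for a skew primitive functional. *)
Lemma operM (f : U -> K) (I : Type) (s : seq I) (g h : I -> U -> K) x y :
  (forall c u v, f (c *: u + v) = c * f u + f v) ->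
  (forall i, forall c u v, g i (c *: u + v) = c * g i u + g i v) ->
  (forall i, forall c u v, h i (c *: u + v) = c * h i u + h i v) ->
  (forall u v, f (u * v) = \sum_(i <- s) g i u * h i v) ->
  oper f (x * y) = \sum_(i <- s) oper (g i) x * oper (h i) y.
Proof.
move=> fl gl hl fM; rewrite (oper_mul_expansion fl).
rewrite (eq_bigr (fun p : U * U => \sum_(i <- s) (g i p.2 *: p.1) * oper (h i) y)).
  by rewrite exchange_big /=; apply: eq_bigr => i _; rewrite -mulr_suml (oper_expansion (gl i)).
move=> p _; rewrite (eq_bigr (fun r : U * U => \sum_(i <- s) (g i p.2 *: p.1) * (h i r.2 *: r.1))).
  by rewrite exchange_big /=; apply: eq_bigr => i _; rewrite -mulr_sumr (oper_expansion (hl i)).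
move=> r _; rewrite fM scaler_suml; apply: eq_bigr => i _.
by rewrite -scalerAl -scalerAr scalerA.
Qed.
End Coinvariants.

(** * The 7-sphere is generated by its coordinates *)

Section Spheres.
Context {K : numClosedFieldType} (q : K) (U : hopfStarAlg K) (t : 'I_4 -> 'I_4 -> U) (Dinv : U).
Hypotheses (q0 : q != 0) (qR : q^* = q) (hU : is_Uq4 q t Dinv).

Local Notation T := (tgen t).
Local Notation Z := (zcoord t).
Local Notation Zs := (zstar t).
Local Notation S := (ST t).
Local Notation B := (gen_subalg (zgen t)).

Lemma qcomm_Z i j : (i < 4)%N -> (j < 4)%N -> qcomm (Z i) (Z j).
Proof.
move=> i4 j4; case: (ltngtP i j) => [ij|ji|->].
- by exists q; rewrite (Z_Z hU) // ij.
- by exists q^-1; rewrite (Z_Z hU (introT andP (conj ji i4))) scalerA mulVf // scale1r.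
- by exists 1; rewrite scale1r.
Qed.

Lemma qcomm_ZX i j m n : (i < 4)%N -> (j < 4)%N -> qcomm (Z i ^+ m) (Z j ^+ n).
Proof. by move=> i4 j4; apply/qcommXl/qcommXr/qcomm_Z. Qed.

(** An ordered monomial of degree 4N contains some z_k^N and so carries x into B. The weighted unit
    relation writes 1 as a combination of the z_k^* z_k, which lets the degree of the monomial in
    front of x be lowered to 0. *)
Lemma sphere7_B x : sphere7 t x -> B x.
Proof.
move=> x7; have [N HN] : exists N, forall k, (k < 4)%N -> B (Z k ^+ N * x).
  have HZ k (k4 : (k < 4)%N) := sphere7_ZX q0 qR hU k4 x7.
  have [N0 h0] := HZ 0%N isT; have [N1 h1] := HZ 1%N isT.
  have [N2 h2] := HZ 2%N isT; have [N3 h3] := HZ 3%N isT.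
  exists (N0 + N1 + N2 + N3)%N; case=> [|[|[|[|]]]] // _; [apply: h0|apply: h1|apply: h2|apply: h3]; lia.
pose mon a b c d := Z 0 ^+ a * Z 1 ^+ b * Z 2 ^+ c * Z 3 ^+ d.
have BZX i n : (i < 4)%N -> B (Z i ^+ n) by move=> i4; apply/galgX/B_Z.
have key k e u v : (k < 4)%N -> (N <= e)%N -> B u -> B v -> qcomm (Z k ^+ e) v ->
    B (u * Z k ^+ e * v * x).
  move=> k4 Ne Bu Bv [s es]; rewrite -(mulrA u) es -scalerAr -scalerAl; apply: galgZ.
  rewrite -(subnK Ne) exprD !mulrA -[_ * _ * x]mulrA; apply: galgM; last exact: HN.
  by apply: galgM; [exact: galgM | exact: BZX].
(* M bounds the degree still missing to 4N. *)
suff H M : forall a b c d, (4 * N <= a + b + c + d + M)%N -> B (mon a b c d * x).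
  by have := H (4 * N)%N 0%N 0%N 0%N 0%N (leqnn _); rewrite /mon !expr0 !mulr1 mul1r.
elim: M => [|M IH] a b c d le.
  (* Degree at least 4N forces one of the four exponents to be at least N. *)
  have [ha|ha] := leqP N a.
    have -> : mon a b c d = 1 * Z 0 ^+ a * (Z 1 ^+ b * Z 2 ^+ c * Z 3 ^+ d).
      by rewrite /mon mul1r !mulrA.
    apply: key => //; first exact: galg1.
      by do ?[exact: BZX | apply: galgM].
    by do ?[exact: qcomm_ZX | apply: qcommMr].
  have [hb|hb] := leqP N b.
    have -> : mon a b c d = Z 0 ^+ a * Z 1 ^+ b * (Z 2 ^+ c * Z 3 ^+ d).
      by rewrite /mon !mulrA.
    apply: key => //; first exact: BZX.
      by do ?[exact: BZX | apply: galgM].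
    by do ?[exact: qcomm_ZX | apply: qcommMr].
  have [hc|hc] := leqP N c.
    by rewrite /mon; apply: key => //; [do ?[exact: BZX | apply: galgM]|exact: BZX|exact: qcomm_ZX].
  rewrite /mon -[_ * Z 3 ^+ d]mulr1; apply: key => //; last exact: qcomm1r.
  - lia.
  - by do ?[exact: BZX | apply: galgM].
  - exact: galg1.
rewrite -[mon _ _ _ _ * x]mul1r -(sum_ZsZ q0 hU) mulr_suml; apply: galg_sum => k _.
rewrite -scalerAl; apply: galgZ; rewrite -mulrA; apply: galgM.
  exact/B_Zs/(ltn_ord k).
case: k; case=> [|[|[|[|]]]] //= _; rewrite mulrA.
- have -> : Z 0 * mon a b c d = mon a.+1 b c d by rewrite /mon exprS !mulrA.
  by apply: IH; lia.
- have [s es] : qcomm (Z 1) (Z 0 ^+ a) by apply/qcommXr/qcomm_Z.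
  have -> : Z 1 * mon a b c d = s *: mon a b.+1 c d.
    by rewrite /mon exprS !mulrA es -!scalerAl ?mulrA.
  by rewrite -scalerAl; apply/galgZ/IH; lia.
- have [s es] : qcomm (Z 2) (Z 0 ^+ a * Z 1 ^+ b).
    by do ?[by apply/qcommXr/qcomm_Z | apply: qcommMr].
  have -> : Z 2 * mon a b c d = s *: mon a b c.+1 d.
    by rewrite /mon exprS !mulrA -(mulrA (Z 2)) es -!scalerAl ?mulrA.
  by rewrite -scalerAl; apply/galgZ/IH; lia.
- have [s es] : qcomm (Z 3) (Z 0 ^+ a * Z 1 ^+ b * Z 2 ^+ c).
    by do ?[by apply/qcommXr/qcomm_Z | apply: qcommMr].
  have -> : Z 3 * mon a b c d = s *: mon a b c d.+1.
    by rewrite /mon exprS mulrA es -!scalerAl ?mulrA.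
  by rewrite -scalerAl; apply/galgZ/IH; lia.
Qed.

Local Notation L := (ideal_L t).
Local Notation RI := (ideal_R q t).

Lemma L_closed u v : v \in lspan L -> u * v \in lspan L.
Proof.
apply: (lspan_map (f := fun v => u * v)) => [c x y|x Lx].
  by rewrite mulrDr -scalerAr.
apply: mem_lspan; move: Lx; apply: (lspan_map (f := fun v => u * v)) => [c y z|y].
  by rewrite mulrDr -scalerAr.
by move=> [w [s [Ls ->]]]; apply: mem_lspan; exists (u * w), s; rewrite mulrA.
Qed.

Lemma R_closed u v : u \in lspan RI -> u * v \in lspan RI.
Proof.
apply: (lspan_map (f := fun u => u * v)) => [c x y|x Rx].
  by rewrite mulrDl -scalerAl.
apply: mem_lspan; move: Rx; apply: (lspan_map (f := fun u => u * v)) => [c y z|y].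
  by rewrite mulrDl -scalerAl.
by move=> [s [w [Rs ->]]]; apply: mem_lspan; exists s, (w * v); rewrite mulrA.
Qed.

Lemma L_gen s : (s = T 3 3 - 1 \/ exists2 j, (j < 3)%N & s = T j 3 \/ s = T 3 j) -> s \in lspan L.
Proof.
move=> Ls; apply: mem_lspan; apply: mem_lspan; exists 1, s; rewrite mul1r; split=> //.
case: Ls => [->|[j j3 e]]; [by left | right; exists j.+1; last exact: e].
by case: j j3 {e} => [|[|[|]]].
Qed.

Lemma lpi_T3 j : (j < 4)%N -> lpi L (T 3 j) = (j == 3)%:R *: lpi L 1.
Proof.
move=> j4; case: eqP => [->|/eqP j3].
  by rewrite scale1r; apply/lpi_eq/L_gen; left.
rewrite scale0r; apply/lpi_eq0/L_gen; right; exists j; last by right.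
by rewrite ltn_neqAle j3.
Qed.

Lemma lpi_S3 j : (j < 4)%N -> lpi L (S j 3) = (j == 3)%:R *: lpi L 1.
Proof.
move=> j4; rewrite -linearZ; apply/lpi_eq.
have := ST_T hU j4 (isT : (3 < 4)%N); rewrite big_ord_recr /= => e.
(* Modulo the left ideal, the antipode sum of S_ji T_i3 over i reduces to its last term S_j3. *)
have -> : S j 3 - (j == 3)%:R *: 1 = - (\sum_(i < 3) S j i * T i 3) - S j 3 * (T 3 3 - 1).
  by rewrite scaler_nat -e mulrBr mulr1 opprB opprD addrCA.
rewrite rpredB ?rpredN //; last by apply/L_closed/L_gen; left.
rewrite rpred_sum // => i _; apply/L_closed/L_gen; right; exists i => //; by left.
Qed.

Lemma Delta_Z i : Delta U (Z i) = \sum_(k < 4) tens (Z k) (T k i).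
Proof. exact: Delta_T hU 3 i. Qed.

Lemma bilin_star : bilin Num.conj (fun u v : U => tens (star u) (star v)).
Proof.
split=> [u u' v|u v v'|c u v|c u v].
- rewrite hopf_starD; exact: tensDl.
- rewrite hopf_starD; exact: tensDr.
- rewrite hopf_starZ; exact: tensZl.
- rewrite hopf_starZ; exact: tensZr.
Qed.

Lemma Delta_Zs i : Delta U (Zs i) = \sum_(k < 4) tens (Zs k) (S i k).
Proof.
rewrite -(star_Z hU) hopf_Delta_star Delta_Z (blift_sum bilin_star).
apply: eq_bigr => k _; rewrite (blift_tens bilin_star) (star_Z hU) (star_T hU); reflexivity.
Qed.

Lemma B_sphere7 x : B x -> sphere7 t x.
Proof.
move: x; apply: galg_ind => [|c x y|x y|x [i i4 zx]]; rewrite /sphere7.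
- exact: lcoinv1.
- exact: lcoinvZD.
- by apply: lcoinvM; exact: L_closed.
- case: zx => ->.
    rewrite Delta_Z tens_map_sum (eq_bigr (fun k : 'I_4 => (k == 3 :> nat)%:R *: tens (lpi L 1) (T k i))).
      rewrite big_ord_recr /= big1 ?add0r ?scale1r => [|k _]; first reflexivity.
      by rewrite ltn_eqF ?scale0r.
    by move=> k _; rewrite tens_mapE /= /zcoord lpi_T3 // tensZl; reflexivity.
  rewrite Delta_Zs tens_map_sum (eq_bigr (fun k : 'I_4 => (k == 3 :> nat)%:R *: tens (lpi L 1) (S i k))).
    rewrite big_ord_recr /= big1 ?add0r ?scale1r => [|k _]; first reflexivity.
    by rewrite ltn_eqF ?scale0r.
  by move=> k _; rewrite tens_mapE /= /zstar lpi_S3 // tensZl; reflexivity.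
Qed.
End Spheres.

(** * Coinvariance of the generators of the 4-sphere *)

Section RightIdealCalculus.
Context {K : numClosedFieldType} (q : K) (U : hopfStarAlg K) (t : 'I_4 -> 'I_4 -> U) (Dinv : U).
Hypotheses (q0 : q != 0) (qR : q^* = q) (hU : is_Uq4 q t Dinv).

Local Notation T := (tgen t).
Local Notation Z := (zcoord t).
Local Notation Zs := (zstar t).
Local Notation S := (ST t).
Local Notation RI := (ideal_R q t).

(** The ideal is only a right ideal: a congruence applies at the left end of a word alone. Therefore
    the lemmas below carry an arbitrary right factor x, and letters are first commuted to the
    front. *)
Definition rr (x : U) : lquot RI := lpi RI x.

Lemma rrD x y : rr (x + y) = rr x + rr y. Proof. exact: raddfD. Qed.
Lemma rrB x y : rr (x - y) = rr x - rr y. Proof. exact: raddfB. Qed.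
Lemma rrZ c x : rr (c *: x) = c *: rr x. Proof. exact: linearZ. Qed.
Definition rgens : seq U :=
  [:: T 0 2; T 2 0; T 0 3; T 3 0; T 1 3; T 3 1; T 1 2; T 2 1;
      T 0 0 - T 3 3; T 0 1 + T 3 2; T 1 0 + T 2 3; T 1 1 - T 2 2;
      T 0 0 * T 1 1 - q *: (T 0 1 * T 1 0) - 1].

Lemma rr_gen s x : s \in rgens -> rr (s * x) = 0.
Proof.
move=> sR; apply/lpi_eq0; apply: mem_lspan; apply: mem_lspan; exists s, x; split=> //.
Qed.

Lemma rr_off i j x : (i < 4)%N -> (j < 4)%N -> (i < 2)%N != (j < 2)%N -> rr (T i j * x) = 0.
Proof.
move=> i4 j4 ij; apply: rr_gen; move: i i4 j j4 ij.
by case=> [|[|[|[|i]]]] // _ [|[|[|[|j]]]] // _ _; rewrite !inE eqxx ?orbT.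
Qed.

Lemma rr_eq s s' x : s - s' \in rgens -> rr (s' * x) = rr (s * x).
Proof. by move/(rr_gen x); rewrite mulrBl rrB => /eqP; rewrite subr_eq0 => /eqP. Qed.

Lemma rr_opp s s' x : s + s' \in rgens -> rr (s' * x) = - rr (s * x).
Proof. by move/(rr_gen x); rewrite mulrDl rrD => /eqP; rewrite addrC addr_eq0 => /eqP. Qed.

Lemma rr33 x : rr (T 3 3 * x) = rr (T 0 0 * x).
Proof. by apply: rr_eq; rewrite !inE eqxx ?orbT. Qed.
Lemma rr22 x : rr (T 2 2 * x) = rr (T 1 1 * x).
Proof. by apply: rr_eq; rewrite !inE eqxx ?orbT. Qed.
Lemma rr32 x : rr (T 3 2 * x) = - rr (T 0 1 * x).
Proof. by apply: rr_opp; rewrite !inE eqxx ?orbT. Qed.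
Lemma rr23 x : rr (T 2 3 * x) = - rr (T 1 0 * x).
Proof. by apply: rr_opp; rewrite !inE eqxx ?orbT. Qed.

Lemma rr_minor01 x : rr (T 0 0 * T 1 1 * x) - q *: rr (T 0 1 * T 1 0 * x) = rr x.
Proof.
have := @rr_gen (T 0 0 * T 1 1 - q *: (T 0 1 * T 1 0) - 1) x.
rewrite !inE eqxx ?orbT => /(_ isT); rewrite !mulrBl mul1r -scalerAl 2!rrB rrZ.
by move/eqP; rewrite subr_eq0 => /eqP.
Qed.

(** Replacing front letters and commuting turns the lower minor into the upper one; the corrections
    from the cross relation begin with a letter off the diagonal blocks and vanish. *)
Lemma rr_minor23 x : rr (T 2 2 * T 3 3 * x) - q *: rr (T 2 3 * T 3 2 * x) = rr x.
Proof.
rewrite -[RHS]rr_minor01 -!mulrA rr22 rr23.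
have -> : T 1 1 * (T 3 3 * x) = T 3 3 * (T 1 1 * x) + (q - q^-1) *: (T 3 1 * (T 1 3 * x)).
  by rewrite !mulrA (T_cross hU (i := 1) (j := 3) (k := 1) (l := 3)) // mulrDl -scalerAl.
have -> : T 1 0 * (T 3 2 * x) = T 3 2 * (T 1 0 * x) + (q - q^-1) *: (T 3 0 * (T 1 2 * x)).
  by rewrite !mulrA (T_cross hU (i := 1) (j := 3) (k := 0) (l := 2)) // mulrDl -scalerAl.
rewrite !rrD !rrZ (rr_off (i := 3) (j := 1)) // (rr_off (i := 3) (j := 0)) // !scaler0 !addr0 rr33 rr32.
by rewrite opprK.
Qed.

Lemma rr_row i l : (i < 4)%N -> (l < 4)%N ->
  rr (T i 0 * S 0 l) + rr (T i 1 * S 1 l) + rr (T i 2 * S 2 l) + rr (T i 3 * S 3 l) =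
  (i == l)%:R *: rr 1.
Proof.
move=> i4 l4; rewrite -rrZ scaler_nat -[in RHS](T_ST hU i4 l4) !big_ord_recr big_ord0 /= add0r.
by rewrite !rrD.
Qed.

Lemma rr_row0 l : (l < 4)%N -> rr (T 0 0 * S 0 l) + rr (T 0 1 * S 1 l) = (0 == l)%:R *: rr 1.
Proof. by move=> l4; rewrite -(rr_row _ l4) // !(rr_off (i := 0) (j := _.+2)) // !addr0. Qed.
Lemma rr_row1 l : (l < 4)%N -> rr (T 1 0 * S 0 l) + rr (T 1 1 * S 1 l) = (1 == l)%:R *: rr 1.
Proof. by move=> l4; rewrite -(rr_row _ l4) // !(rr_off (i := 1) (j := _.+2)) // !addr0. Qed.
Lemma rr_row2 l : (l < 4)%N -> rr (T 2 2 * S 2 l) + rr (T 2 3 * S 3 l) = (2 == l)%:R *: rr 1.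
Proof.
by move=> l4; rewrite -(rr_row _ l4) // (rr_off (i := 2) (j := 0)) // (rr_off (i := 2) (j := 1)) // !add0r.
Qed.
Lemma rr_row3 l : (l < 4)%N -> rr (T 3 2 * S 2 l) + rr (T 3 3 * S 3 l) = (3 == l)%:R *: rr 1.
Proof.
by move=> l4; rewrite -(rr_row _ l4) // (rr_off (i := 3) (j := 0)) // (rr_off (i := 3) (j := 1)) // !add0r.
Qed.

Lemma T_ST_mul i l x : (i < 4)%N -> (l < 4)%N ->
  T i 0 * (S 0 l * x) + T i 1 * (S 1 l * x) + T i 2 * (S 2 l * x) + T i 3 * (S 3 l * x) =
  (i == l)%:R *: x.
Proof.
move=> i4 l4; rewrite !mulrA -!mulrDl scaler_nat -[x in RHS]mul1r -mulrnAl.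
by rewrite -(T_ST hU i4 l4) !big_ord_recr big_ord0 /= add0r.
Qed.

(** T_jk lies off the diagonal blocks. Exchanging the two letters brings it to the front, with a
    correction that begins with T_ik, off the blocks as well. *)
Lemma rr_lower i j k x : (i < 4)%N -> (j < 4)%N -> (1 < i)%N -> (1 < j)%N -> (i != j) -> (k < 2)%N ->
  forall m, (1 < m)%N -> (m < 4)%N -> rr (T i m * (T j k * x)) = 0.
Proof.
move=> i4 j4 i1 j1 ij k2 m m1 m4; have km : (k < m < 4)%N by rewrite (leq_trans k2).
have k4 : (k < 4)%N by rewrite (leq_trans k2).
have [lt|gt|e] := ltngtP i j; last by rewrite e eqxx in ij.
  have lt4 : (i < j < 4)%N by rewrite lt.
  rewrite mulrA (T_comm hU lt4 km) -mulrA rr_off //.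
  by rewrite k2 ltnNge j1.
have gt4 : (j < i < 4)%N by rewrite gt.
have := T_cross hU gt4 km => /eqP; rewrite -subr_eq => /eqP e.
rewrite mulrA -e mulrBl rrB -scalerAl rrZ -!mulrA !rr_off ?scaler0 ?subr0 //.
  by rewrite k2 ltnNge i1.
by rewrite k2 ltnNge j1.
Qed.

(** The lower block has quantum determinant 1 modulo the ideal, so this row of S is a row of the
    quantum adjugate of a 2x2 matrix: the minor is inserted in front and contracted with S by
    [T_ST_mul]. *)
Lemma rr_S3 j x : (j < 4)%N ->
  rr (S 3 j * x) = (3 == j)%:R *: rr (T 2 2 * x) - (2 == j)%:R *: (q *: rr (T 3 2 * x)).
Proof.
move=> j4; rewrite -(rr_minor23 (S 3 j * x)) -!mulrA.
have -> : T 2 3 * (T 3 2 * (S 3 j * x)) = T 3 2 * (T 2 3 * (S 3 j * x)).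
  by rewrite !mulrA (T_comm hU (i := 2) (j := 3) (k := 2) (l := 3)).
have e3 : T 3 3 * (S 3 j * x) = (3 == j)%:R *: x -
    (T 3 0 * (S 0 j * x) + T 3 1 * (S 1 j * x) + T 3 2 * (S 2 j * x)).
  by rewrite -(T_ST_mul x (i := 3)) // addrC addKr.
have e2 : T 2 3 * (S 3 j * x) = (2 == j)%:R *: x -
    (T 2 0 * (S 0 j * x) + T 2 1 * (S 1 j * x) + T 2 2 * (S 2 j * x)).
  by rewrite -(T_ST_mul x (i := 2)) // addrC addKr.
rewrite e3 e2 !mulrBr !mulrDr !(rrB, rrD) !(rr_lower (k := 0)) // !(rr_lower (k := 1)) // !add0r.
rewrite -!scalerAr !rrZ.
have -> : T 2 2 * (T 3 2 * (S 2 j * x)) = q *: (T 3 2 * (T 2 2 * (S 2 j * x))).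
  by rewrite !mulrA (T_col hU _ (i := 2) (j := 3)) // -!scalerAl.
rewrite rrZ scalerBr !scalerA opprB addrA subrK mulrC; reflexivity.
Qed.

Lemma rr_S2 j x : (j < 4)%N ->
  rr (S 2 j * x) = (2 == j)%:R *: rr (T 3 3 * x) - (3 == j)%:R *: (q^-1 *: rr (T 2 3 * x)).
Proof.
move=> j4; have -> : rr (S 2 j * x) =
    rr (T 3 3 * (T 2 2 * (S 2 j * x))) - q^-1 *: rr (T 2 3 * (T 3 2 * (S 2 j * x))).
  rewrite -(rr_minor23 (S 2 j * x)) (T_cross hU (i := 2) (j := 3) (k := 2) (l := 3)) //.
  rewrite -(T_comm hU (i := 2) (j := 3) (k := 2) (l := 3)) // mulrDl rrD -!mulrA -scalerAl rrZ -!mulrA.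
  by rewrite -addrA; congr (_ + _); rewrite -scalerBl addrAC subrr add0r scaleNr.
have e3 : T 3 2 * (S 2 j * x) = (3 == j)%:R *: x -
    (T 3 0 * (S 0 j * x) + T 3 1 * (S 1 j * x) + T 3 3 * (S 3 j * x)).
  by rewrite -(T_ST_mul x (i := 3)) // [X in X - _]addrAC [X in X - _]addrC addrK.
have e2 : T 2 2 * (S 2 j * x) = (2 == j)%:R *: x -
    (T 2 0 * (S 0 j * x) + T 2 1 * (S 1 j * x) + T 2 3 * (S 3 j * x)).
  by rewrite -(T_ST_mul x (i := 2)) // [X in X - _]addrAC [X in X - _]addrC addrK.
rewrite e3 e2 !mulrBr !mulrDr !(rrB, rrD) !(rr_lower (k := 0)) // !(rr_lower (k := 1)) // !add0r.
rewrite -!scalerAr !rrZ.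
have -> : T 2 3 * (T 3 3 * (S 3 j * x)) = q *: (T 3 3 * (T 2 3 * (S 3 j * x))).
  by rewrite !mulrA (T_col hU _ (i := 2) (j := 3)) // -!scalerAl.
rewrite rrZ scalerBr !scalerA opprB mulVf // scale1r addrA subrK mulrC; reflexivity.
Qed.

Lemma rr_tens_mul (x y : U) (f g f' g' : 'I_4 -> U) :
  Delta U x = \sum_k tens (f k) (g k) -> Delta U y = \sum_k tens (f' k) (g' k) ->
  tens_map idfun (lpi RI) (Delta U (x * y)) =
  \sum_k \sum_l tens (f k * f' l) (rr (g k * g' l)).
Proof.
move=> ex ey; rewrite hopf_DeltaM ex ey tens_mul_suml tens_map_sum; apply: eq_bigr => k _.
rewrite tens_mul_sumr tens_map_sum; apply: eq_bigr => l _.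
rewrite tens_mul_tens tens_mapE; reflexivity.
Qed.

Lemma sum_delta4 (V : lmodType K) (i : nat) (F : nat -> V) : (i < 4)%N ->
  \sum_(j < 4) (j == i :> nat)%:R *: F j = F i.
Proof.
move=> i4; rewrite (bigD1 (Ordinal i4)) //= eqxx scale1r big1 ?addr0 // => j.
by rewrite -val_eqE /= => /negbTE ->; rewrite scale0r.
Qed.

Lemma sum_delta_pair (V : lmodType K) (X : nat -> nat -> V) c k0 k1 l0 l1 :
  (k0 < 4)%N -> (k1 < 4)%N -> (l0 < 4)%N -> (l1 < 4)%N ->
  \sum_(k < 4) \sum_(l < 4) (((k == k0 :> nat) && (l == l0 :> nat))%:R *: X k l +
    c *: (((k == k1 :> nat) && (l == l1 :> nat))%:R *: X k l)) = X k0 l0 + c *: X k1 l1.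
Proof.
move=> k04 k14 l04 l14.
have dd i j : (i < 4)%N -> (j < 4)%N ->
    \sum_(k < 4) \sum_(l < 4) ((k == i :> nat) && (l == j :> nat))%:R *: X k l = X i j.
  move=> i4 j4; rewrite -[RHS](sum_delta4 (fun k => X k j) i4); apply: eq_bigr => k _.
  rewrite -(sum_delta4 (X k) j4) scaler_sumr; apply: eq_bigr => l _.
  by rewrite scalerA -natrM mulnb.
rewrite -(dd k0 l0) // -(dd k1 l1) // scaler_sumr -big_split; apply: eq_bigr => k _.
by rewrite scaler_sumr -big_split.
Qed.

(** Reduces the coinvariance of a quadratic element with two terms to one congruence modulo the
    ideal for each pair (k, l). *)
Lemma rcoinv_pair c (F G g g' h h' : nat -> U) k0 k1 l0 l1 :
  (k0 < 4)%N -> (k1 < 4)%N -> (l0 < 4)%N -> (l1 < 4)%N ->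
  Delta U (F k0) = \sum_(k < 4) tens (F k) (g k) -> Delta U (F k1) = \sum_(k < 4) tens (F k) (g' k) ->
  Delta U (G l0) = \sum_(k < 4) tens (G k) (h k) -> Delta U (G l1) = \sum_(k < 4) tens (G k) (h' k) ->
  (forall k l, (k < 4)%N -> (l < 4)%N -> rr (g k * h l) + c *: rr (g' k * h' l) =
    ((k == k0) && (l == l0))%:R *: rr 1 + c *: (((k == k1) && (l == l1))%:R *: rr 1)) ->
  rcoinv RI (F k0 * G l0 + c *: (F k1 * G l1)).
Proof.
move=> k04 k14 l04 l14 e0 e1 e0' e1' H; rewrite /rcoinv linearD linearZ tens_mapD tens_mapZ.
rewrite (rr_tens_mul e0 e0') (rr_tens_mul e1 e1') scaler_sumr -big_split /=.
rewrite tensDl tensZl -/(rr 1).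
rewrite -[RHS](sum_delta_pair (fun k l => tens (F k * G l) (rr 1)) c k04 k14 l04 l14).
apply: eq_bigr => k _; rewrite scaler_sumr -big_split /=; apply: eq_bigr => l _.
rewrite -tensZr -tensDr H ?ltn_ord // tensDr !tensZr; reflexivity.
Qed.

Lemma rcoinv_r : rcoinv RI (Z 0 * Zs 0 + 1 *: (Z 1 * Zs 1)).
Proof.
apply: (rcoinv_pair (g := fun k => T k 0) (g' := fun k => T k 1) (h := fun l => S 0 l)
  (h' := fun l => S 1 l) (F := Z) (G := Zs)) => //; try exact: (Delta_Z hU); try exact: (Delta_Zs hU).
move=> [|[|[|[|k]]]] l // _ l4; rewrite !scale1r /=.
- by rewrite rr_row0 // scale0r addr0 eq_sym.
- by rewrite rr_row1 // scale0r add0r eq_sym.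
- by rewrite !rr_off // !scale0r.
- by rewrite !rr_off // !scale0r.
Qed.

Lemma rcoinv_a : rcoinv RI (Z 0 * Zs 3 + (-1) *: (Z 1 * Zs 2)).
Proof.
apply: (rcoinv_pair (g := fun k => T k 0) (g' := fun k => T k 1) (h := fun l => S 3 l)
  (h' := fun l => S 2 l) (F := Z) (G := Zs)) => //; try exact: (Delta_Z hU); try exact: (Delta_Zs hU).
move=> [|[|[|[|k]]]] l // _ l4; rewrite !scaleN1r /=.
- by rewrite scale0r oppr0 addr0 -rr33 -rr32 addrC rr_row3 // eq_sym.
- by rewrite scale0r add0r -[rr (T 1 0 * _)]opprK -rr23 -rr22 -opprD addrC rr_row2 // eq_sym.
- by rewrite !rr_off // !scale0r.
- by rewrite !rr_off // !scale0r.
Qed.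

Lemma rcoinv_as : rcoinv RI (Z 3 * Zs 0 + (-1) *: (Z 2 * Zs 1)).
Proof.
apply: (rcoinv_pair (g := fun k => T k 3) (g' := fun k => T k 2) (h := fun l => S 0 l)
  (h' := fun l => S 1 l) (F := Z) (G := Zs)) => //; try exact: (Delta_Z hU); try exact: (Delta_Zs hU).
move=> [|[|[|[|k]]]] l // _ l4; rewrite !scaleN1r /=.
- by rewrite !rr_off // !scale0r.
- by rewrite !rr_off // !scale0r.
- by rewrite scale0r add0r rr23 rr22 -opprD rr_row1 // eq_sym.
- by rewrite scale0r oppr0 addr0 rr33 rr32 opprK rr_row0 // eq_sym.
Qed.

Lemma rr_minor23_1 : rr (T 2 2 * T 3 3) - q *: rr (T 2 3 * T 3 2) = rr 1.
Proof. by rewrite -[RHS]rr_minor23 !mulr1. Qed.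

Lemma rr_TT0 l : (l < 4)%N ->
  rr (T 0 0 * T l 2) + q^-1 *: rr (T 0 1 * T l 3) = (l == 2)%:R *: rr 1.
Proof.
rewrite -rr33 -[rr (T 0 1 * _)]opprK -rr32 scalerN => l4.
have [l3|] := ltnP l 3; last first.
  rewrite leq_eqVlt ltnNge -ltnS l4 orbF => /eqP <-.
  rewrite (T_row hU _ (i := 2) (j := 3)) // rrZ scalerA mulVf // scale1r subrr scale0r; reflexivity.
have l34 : (l < 3 < 4)%N by rewrite l3.
(* Bringing the letters of row l to the front exchanges q^-1 for q. For l < 2 the front letters are
   off the blocks, for l = 2 the lower minor appears. *)
have e : T 3 3 * T l 2 - q^-1 *: (T 3 2 * T l 3) = T l 2 * T 3 3 - q *: (T l 3 * T 3 2).
  rewrite (T_cross hU (k := 2) (l := 3) l34) // (T_comm hU (k := 2) (l := 3) l34) //.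
  by rewrite -addrA -scalerBl addrAC subrr add0r scaleNr.
rewrite -rrZ -rrB e rrB rrZ; case: l l4 l3 {l34 e} => [|[|[|l]]] // _ _ /=.
- by rewrite !rr_off // scaler0 subr0 scale0r.
- by rewrite !rr_off // scaler0 subr0 scale0r.
- by rewrite rr_minor23_1 scale1r.
Qed.

Lemma rr_TT1 l : (l < 4)%N ->
  rr (T 1 0 * T l 2) + q^-1 *: rr (T 1 1 * T l 3) = q^-1 *: ((l == 3)%:R *: rr 1).
Proof.
rewrite -rr22 -[rr (T 1 0 * _)]opprK -rr23 => l4.
case: l l4 => [|[|[|[|l]]]] // _ /=; last first.
- rewrite scale1r -rr_minor23_1 scalerBr scalerA mulVf // scale1r addrC; reflexivity.
- rewrite (T_row hU _ (i := 2) (j := 3)) // rrZ scalerA mulVf // scale1r addNr scale0r scaler0; reflexivity.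
- have e : T 2 2 * T 1 3 = T 1 3 * T 2 2 by rewrite (T_comm hU (i := 1) (j := 2) (k := 2) (l := 3)).
  have e' : T 2 3 * T 1 2 = T 1 2 * T 2 3 - (q - q^-1) *: (T 2 2 * T 1 3).
    by rewrite (T_cross hU (i := 1) (j := 2) (k := 2) (l := 3)) // addrK.
  by rewrite e' e rrB rrZ !rr_off // !scaler0 subr0 oppr0 addr0 scale0r scaler0.
- have e : T 2 2 * T 0 3 = T 0 3 * T 2 2 by rewrite (T_comm hU (i := 0) (j := 2) (k := 2) (l := 3)).
  have e' : T 2 3 * T 0 2 = T 0 2 * T 2 3 - (q - q^-1) *: (T 2 2 * T 0 3).
    by rewrite (T_cross hU (i := 0) (j := 2) (k := 2) (l := 3)) // addrK.
  by rewrite e' e rrB rrZ !rr_off // !scaler0 subr0 oppr0 addr0 scale0r scaler0.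
Qed.

Lemma rcoinv_b : rcoinv RI (Z 0 * Z 2 + q^-1 *: (Z 1 * Z 3)).
Proof.
apply: (rcoinv_pair (g := fun k => T k 0) (g' := fun k => T k 1) (h := fun l => T l 2)
  (h' := fun l => T l 3) (F := Z) (G := Z)) => //; try exact: (Delta_Z hU).
move=> [|[|[|[|k]]]] l // _ l4 /=.
- by rewrite rr_TT0 // scale0r scaler0 addr0.
- by rewrite rr_TT1 // scale0r add0r.
- by rewrite !rr_off // !(scale0r, scaler0).
- by rewrite !rr_off // !(scale0r, scaler0).
Qed.

Lemma rcoinv_bs : rcoinv RI (Zs 2 * Zs 0 + q^-1 *: (Zs 3 * Zs 1)).
Proof.
apply: (rcoinv_pair (g := fun k => S 2 k) (g' := fun k => S 3 k) (h := fun l => S 0 l)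
  (h' := fun l => S 1 l) (F := Zs) (G := Zs)) => //; try exact: (Delta_Zs hU).
move=> k l k4 l4; rewrite rr_S2 // rr_S3 // !rr33 !rr22 !rr32 !rr23.
case: k k4 => [|[|[|[|k]]]] // _ /=; rewrite ?scale0r ?scaler0 ?scale1r ?subr0 ?sub0r ?addr0 ?add0r //.
- by rewrite scaler0.
- by rewrite scaler0.
- by rewrite !scalerN opprK scalerA mulVf // scale1r rr_row0 // eq_sym.
- by rewrite !scalerN opprK -scalerDr rr_row1 // eq_sym.
Qed.
End RightIdealCalculus.

(** * Elimination of coinvariants in a chart *)

Section LeftSpans.
Context {K : fieldType} {U : algType K} (A : U -> Prop).
Hypotheses (A1 : A 1) (AZD : forall c x y, A x -> A y -> A (c *: x + y)).
Hypothesis (AM : forall x y, A x -> A y -> A (x * y)).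

(** The left A-submodule spanned by P, given by explicit expressions, as it is on these that the
    elimination acts. *)
Definition aspan (P : U -> Prop) (x : U) : Prop := exists l : seq (U * U),
  (forall e, e \in l -> A e.1 /\ P e.2) /\ x = \sum_(e <- l) e.1 * e.2.

Lemma A0 : A 0.
Proof. by have := AZD (-1) A1 A1; rewrite scaleN1r addNr. Qed.

Lemma AZ c x : A x -> A (c *: x).
Proof. by move=> Ax; rewrite -[_ *: _]addr0; apply: AZD => //; exact: A0. Qed.

Lemma AD x y : A x -> A y -> A (x + y).
Proof. by move=> Ax Ay; rewrite -[x]scale1r; exact: AZD. Qed.

Lemma aspan0 P : aspan P 0.
Proof. by exists [::]; rewrite big_nil. Qed.

Lemma aspan_gen (P : U -> Prop) m : P m -> aspan P m.
Proof.
move=> Pm; exists [:: (1, m)]; rewrite big_seq1 mul1r; split=> // e.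
by rewrite inE => /eqP ->.
Qed.

Lemma aspanD P x y : aspan P x -> aspan P y -> aspan P (x + y).
Proof.
move=> [l [lA ->]] [l' [lA' ->]]; exists (l ++ l'); rewrite big_cat; split=> // e.
by rewrite mem_cat => /orP[/lA|/lA'].
Qed.

Lemma aspanM P a x : A a -> aspan P x -> aspan P (a * x).
Proof.
move=> Aa [l [lA ->]]; exists [seq (a * e.1, e.2) | e <- l]; split.
  by move=> _ /mapP[e /lA [Ae Pe] ->]; split=> //; exact: AM.
by rewrite big_map mulr_sumr; apply: eq_bigr => e _; rewrite mulrA.
Qed.

Lemma aspanZ P c x : aspan P x -> aspan P (c *: x).
Proof.
by move=> Px; rewrite -[x]mul1r scalerAl; apply: aspanM => //; exact: AZ.
Qed.

Lemma aspanB P x y : aspan P x -> aspan P y -> aspan P (x - y).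
Proof. by move=> Px Py; rewrite -scaleN1r; apply: aspanD => //; exact: aspanZ. Qed.

Lemma aspan_ind (P Q : U -> Prop) : Q 0 -> (forall x y, Q x -> Q y -> Q (x + y)) ->
  (forall a m, A a -> P m -> Q (a * m)) -> forall x, aspan P x -> Q x.
Proof.
move=> Q0 QD QM _ [l [lA ->]]; elim: l lA => [|e l IH] lA; first by rewrite big_nil.
rewrite big_cons; apply: QD; last by apply: IH => e' el; apply: lA; rewrite inE el orbT.
by have [Ae Pe] := lA e (mem_head _ _); exact: QM.
Qed.

Lemma aspan_sub (P Q : U -> Prop) : (forall m, P m -> aspan Q m) -> forall x, aspan P x -> aspan Q x.
Proof.
move=> PQ; apply: aspan_ind => [|x y|a m Aa Pm]; [exact: aspan0 | exact: aspanD |].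
exact/aspanM/PQ.
Qed.

(* Removing the eigenvectors of Th with eigenvalue other than 1 from the expression of a
   fixed point. *)
Lemma aspan_fixed (Th : U -> U) (P P0 : U -> Prop) x :
  (forall x y, Th (x + y) = Th x + Th y) -> (forall c x, Th (c *: x) = c *: Th x) ->
  (forall a x, A a -> Th (a * x) = a * Th x) ->
  (forall m, P m -> exists2 c, Th m = c *: m & c = 1 -> P0 m) ->
  aspan P x -> Th x = x -> aspan P0 x.
Proof.
move=> ThD ThZ ThM ThP [l [lA xE]] Thx.
have Th0 : Th 0 = 0 by rewrite -[X in Th X](scale0r 0) ThZ scale0r.
(* z collects the terms of eigenvalue 1 met so far, and n bounds the number of terms still to be
   treated. *)
suff H n : forall (l : seq (U * U)) z, (size l <= n)%N -> (forall e, e \in l -> A e.1 /\ P e.2) ->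
    (exists2 l' : seq (U * U), (forall e, e \in l' -> [/\ A e.1, P0 e.2 & exists c, Th e.2 = c *: e.2])
       & z = \sum_(e <- l') e.1 * e.2) ->
    x = \sum_(e <- l) e.1 * e.2 + z -> aspan P0 x.
  apply: (H (size l) l 0) => //; last by rewrite addr0.
  by exists [::] => //; rewrite big_nil.
elim: n => [|n IH] {lA xE} {}l z.
  rewrite leqn0 => /nilP -> _ [l' lA' ->] ->; rewrite big_nil add0r.
  by exists l'; split=> // e /lA'[].
case: l => [_ _ [l' lA' ->] ->|[a m] l sl lA [l' lA' zE] xE].
  by rewrite big_nil add0r; exists l'; split=> // e /lA'[].
have [Aa Pm] := lA _ (mem_head _ _); have [c cE cP] := ThP m Pm.
have lA1 e : e \in l -> A e.1 /\ P e.2 by move=> el; apply: lA; rewrite inE el orbT.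
have [c1|c1] := eqVneq c 1.
  apply: (IH l ((a * m) + z)) => //.
    exists ((a, m) :: l') => [e|]; last by rewrite big_cons zE.
    rewrite inE => /orP[/eqP -> /=|/lA' //]; split; [by [] | exact: cP | by exists c].
  by rewrite xE big_cons addrAC addrC.
(* (Th - c)/(1 - c) fixes x, kills the head m of eigenvalue c and only rescales the coefficients of
   the other eigenvectors, so the list gets shorter. *)
have shift (P' : U -> Prop) (s : seq (U * U)) :
    (forall e, e \in s -> [/\ A e.1, P' e.2 & exists c, Th e.2 = c *: e.2]) ->
    exists s' : seq (U * U), [/\ size s' = size s,
      forall e, e \in s' -> [/\ A e.1, P' e.2 & exists c, Th e.2 = c *: e.2] &
      (1 - c)^-1 *: (Th (\sum_(e <- s) e.1 * e.2) - c *: \sum_(e <- s) e.1 * e.2) =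
        \sum_(e <- s') e.1 * e.2].
  elim: s => [|[b p] s IHs] sA.
    by exists [::]; split=> //; rewrite !big_nil Th0 scaler0 subr0 scaler0.
  have [Ab Pp [d dE]] := sA _ (mem_head _ _).
  have [s' [ss sA' sE]] := IHs (fun e es => sA e (mem_behead (s := (b, p) :: s) es)).
  exists ((((1 - c)^-1 * (d - c)) *: b, p) :: s'); split=> [|e|]; first by rewrite /= ss.
    rewrite inE => /orP[/eqP -> /=|/sA' //]; split=> //; first exact: AZ.
    by exists d.
  rewrite !big_cons -sE ThD ThM // dE /= [c *: (_ + _)]scalerDr opprD addrACA scalerDr; congr (_ + _).
  by rewrite -scalerAr -scalerBl scalerA -scalerAl.
have [|s [ss sA sE]] := shift P l.
  by move=> e /lA1[Ae Pe]; split=> //; have [d dE _] := ThP _ Pe; exists d.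
have [s' [_ sA' sE']] := shift P0 l' lA'.
apply: (IH s (\sum_(e <- s') e.1 * e.2)); rewrite ?ss //.
- by move=> e /sA[].
- by exists s'.
have nz : 1 - c != 0 by rewrite subr_eq0 eq_sym.
apply: (scalerI nz); rewrite -sE -sE' -zE -scalerDr scalerA mulfV // scale1r.
rewrite scalerBl scale1r -[X in X - _]Thx xE big_cons ThD ThD ThM // cE.
rewrite /= !scalerDr !opprD -scalerAr.
set X := c *: (a * m); set Y := Th _; set Y' := c *: \sum_(e <- l) _; set W := Th z; set W' := c *: z.
by rewrite [LHS]addrACA [X + Y + _]addrACA subrr add0r.
Qed.
End LeftSpans.

(** * Ordered monomials in the four letters of a chart *)

Section ChartMonomials.
Context {K : fieldType} {U : algType K} (A : U -> Prop) (al th ph ph0 : K) (u v w x R p p2 : U).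
Hypotheses (A1 : A 1) (AZD : forall c x y, A x -> A y -> A (c *: x + y)).
Hypotheses (AM : forall x y, A x -> A y -> A (x * y)) (AR : A R).
Hypotheses (vu : v * u = al *: (u * v)) (wv : qcomm w v) (xu : qcomm x u).
Hypotheses (xw : qcomm x w) (wx : qcomm w x) (wu : w * u = ph *: (u * w) + ph0 *: 1).
Hypotheses (vx : v * x = p - u * w) (xv : x * v = p2 - th *: (u * w)).
Hypotheses (uR : qcomm u R) (vR : qcomm v R) (wR : qcomm w R) (xR : qcomm x R).
Hypotheses (pE : exists c d, p = c *: 1 + d *: R) (p2E : exists c d, p2 = c *: 1 + d *: R).

Definition mono_uvw i j k := u ^+ i * v ^+ j * w ^+ k.
Definition mono_uwx i j k := u ^+ i * w ^+ j * x ^+ k.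

(** Both v x and x v are polynomials in R up to a multiple of u w, so v and x never have to occur
    together; hence two families. *)
Definition chart_mono (m : U) := exists i j k, m = mono_uvw i j k \/ m = mono_uwx i j k.

Local Notation span := (aspan A chart_mono).

Lemma mono1_span i j k : span (mono_uvw i j k).
Proof. by apply: aspan_gen => //; exists i, j, k; left. Qed.

Lemma mono2_span i j k : span (mono_uwx i j k).
Proof. by apply: aspan_gen => //; exists i, j, k; right. Qed.

Lemma aspan_qcomm P m g m' r : qcomm g r -> aspan A P (m * (r * g) * m') -> aspan A P (m * (g * r) * m').
Proof. by move=> [c ->] H; rewrite -scalerAr -scalerAl; exact: aspanZ. Qed.

(** r is a polynomial in R, and R commutes with m up to a scalar: the factor moves to the far left
    and is absorbed by the coefficients in A. *)
Lemma aspan_pull P m r m' : (exists c d, r = c *: 1 + d *: R) -> qcomm m R ->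
  aspan A P (m * m') -> aspan A P (m * r * m').
Proof.
move=> [c [d ->]] [e mR] H; rewrite mulrDr mulrDl -!scalerAr mulr1 mR scalerA.
apply: aspanD; first by rewrite -scalerAl; exact: aspanZ.
by rewrite -!scalerAl -mulrA; apply: aspanZ => //; exact: aspanM.
Qed.

Lemma aspan_mulr P g : (forall m, P m -> aspan A P (m * g)) -> forall y, aspan A P y -> aspan A P (y * g).
Proof.
move=> Pg; apply: (aspan_ind (Q := fun y => aspan A P (y * g))) => [|y z Py Pz|a m Aa Pm].
- by rewrite mul0r; exact: aspan0.
- by rewrite mulrDl; exact: aspanD.
- by rewrite -mulrA; apply: aspanM => //; exact: Pg.
Qed.

(** For membership in the span only the shape of the lower term matters, so its coefficient stays
    anonymous. *)
Lemma wXu k : exists2 c, w ^+ k.+1 * u = ph ^+ k.+1 *: (u * w ^+ k.+1) + c *: w ^+ k & True.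
Proof.
elim: k => [|k [c cE _]]; first by exists ph0; rewrite // !expr1 wu expr0.
exists (ph ^+ k.+1 * ph0 + c) => //.
rewrite exprS -mulrA cE mulrDr -!scalerAr [w * (u * _)]mulrA wu mulrDl -!scalerAl scalerDr !scalerA -exprS.
by rewrite mul1r -exprSr -exprS -[u * w * _]mulrA -exprS scalerDl addrA.
Qed.

Lemma span_w y : span y -> span (y * w).
Proof.
apply: aspan_mulr => _ [i [j [k [->|->]]]].
  by rewrite /mono_uvw -mulrA -exprSr; exact: mono1_span.
rewrite /mono_uwx -mulrA -[_ * _]mulr1; apply: aspan_qcomm; first exact: qcommXl.
rewrite mulr1 mulrA -[_ * w]mulrA -exprSr; exact: mono2_span.
Qed.

Lemma span_u y : span y -> span (y * u).
Proof.
apply: aspan_mulr => _ [i [j [k [->|->]]]].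
  have vju : u ^+ i * v ^+ j * u = al ^+ j *: (u ^+ i.+1 * v ^+ j).
    rewrite -mulrA exprSr -[in RHS]mulrA scalerAr; congr (_ * _).
    elim: j => [|j IH]; first by rewrite !expr0 mul1r mulr1 scale1r.
    by rewrite exprSr -mulrA vu -scalerAr [_ ^+ j * (u * v)]mulrA IH -scalerAl scalerA -exprS !mulrA.
  rewrite /mono_uvw; case: k => [|k].
    by rewrite expr0 mulr1 vju; apply: aspanZ => //; rewrite -[X in aspan _ _ X]mulr1; exact: (mono1_span _ _ 0).
  have [c wku _] := wXu k; rewrite -mulrA wku mulrDr -!scalerAr; apply: aspanD; apply: aspanZ => //.
    by rewrite mulrA vju -scalerAl; apply: aspanZ => //; exact: mono1_span.
  exact: mono1_span.
rewrite /mono_uwx -mulrA -[_ * _]mulr1; apply: aspan_qcomm; first exact: qcommXl.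
rewrite mulr1 mulrA; case: j => [|j].
  rewrite expr0 mulr1 -exprSr -[u ^+ _]mulr1; exact: (mono2_span _ 0).
have [c wju _] := wXu j; rewrite -[u ^+ i * _ * u]mulrA wju mulrDr mulrDl -!scalerAr -!scalerAl.
apply: aspanD; apply: aspanZ => //; last exact: mono2_span.
by rewrite mulrA -exprSr; exact: mono2_span.
Qed.

Lemma span_x y : span y -> span (y * x).
Proof.
apply: aspan_mulr => _ [i [j [k [->|->]]]]; last first.
  by rewrite /mono_uwx -mulrA -exprSr; exact: mono2_span.
rewrite /mono_uvw -mulrA -[_ * _]mulr1; apply: aspan_qcomm; first exact: qcommXl.
rewrite mulr1; case: j => [|j].
  rewrite expr0 mulr1; have := @aspan_qcomm chart_mono (u ^+ i) (x) 1 (w ^+ k).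
  rewrite !mulr1; apply; first exact: qcommXr.
  rewrite mulrA -[x]expr1; exact: mono2_span.
rewrite mulrA exprSr !mulrA -[_ * v * x]mulrA vx mulrBr mulrBl; apply: aspanB => //.
  apply: aspan_pull => //; last exact: mono1_span.
  by apply: qcommMl; exact: qcommXl.
rewrite !mulrA -[_ * w * _]mulrA -exprS.
have [c vju] : qcomm (v ^+ j) u by apply: qcommXl; exists al.
rewrite -[_ * _ * u]mulrA vju -scalerAr mulrA -exprSr -scalerAl; apply: aspanZ => //.
exact: mono1_span.
Qed.

Lemma span_v y : span y -> span (y * v).
Proof.
apply: aspan_mulr => _ [i [j [k [->|->]]]].
  rewrite /mono_uvw -mulrA -[_ * _]mulr1; apply: aspan_qcomm; first exact: qcommXl.
  by rewrite mulr1 mulrA -[_ * v]mulrA -exprSr; exact: mono1_span.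
case: k => [|k].
  rewrite /mono_uwx expr0 mulr1 -mulrA -[_ * _]mulr1; apply: aspan_qcomm; first exact: qcommXl.
  by rewrite mulr1 mulrA -[v]expr1; exact: mono1_span.
rewrite /mono_uwx exprSr !mulrA -mulrA xv mulrBr; apply: aspanB => //.
  rewrite -[_ * p2]mulr1; apply: aspan_pull => //.
    by apply: qcommMl; [apply: qcommMl|]; exact: qcommXl.
  rewrite mulr1; exact: mono2_span.
rewrite -scalerAr mulrA; apply: aspanZ => //; apply/span_w/span_u; exact: mono2_span.
Qed.
End ChartMonomials.

(** * Raising and lowering operators on a chart *)

Section ChartElimination.
Context {K : numFieldType} {U : algType K} (A C : U -> Prop) (al et : K) (u v w x R p : U).
Hypotheses (A1 : A 1) (AZD : forall c x y, A x -> A y -> A (c *: x + y)).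
Hypotheses (AM : forall x y, A x -> A y -> A (x * y)) (AR : A R).
Hypotheses (C1 : C 1) (CM : forall x y, C x -> C y -> C (x * y)).
Hypotheses (Cu : C u) (Cv : C v) (Cw : C w) (Cx : C x).
Hypotheses (al0 : al != 0) (et0 : et != 0).
Hypotheses (vu : v * u = al *: (u * v)) (xw : x * w = al^-1 *: (w * x)).
Hypotheses (vx : v * x = p - u * w).
Hypotheses (uR : qcomm u R) (vR : qcomm v R) (wR : qcomm w R) (xR : qcomm x R).
Hypotheses (pE : exists c d, p = c *: 1 + d *: R).

Variables (E F Th : U -> U) (k g : {rmorphism U -> U}).
Local Notation be := (et * al).

(** The twisted Leibniz rule is available only on the chart C, since outside it both skew primitive
    functionals act; linearity over A holds everywhere. *)
Definition skew_derivation (D : U -> U) :=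
  [/\ forall x y, D (x + y) = D x + D y, forall c x, D (c *: x) = c *: D x,
      forall a x, A a -> D (a * x) = a * D x &
      forall x y, C x -> C y -> D (x * y) = D x * k y + g x * D y].

Hypotheses (dE : skew_derivation E) (dF : skew_derivation F).
Hypotheses (Eu : E u = 0) (Ev : E v = u) (Ew : E w = - al *: x) (Ex : E x = 0).
Hypotheses (Fu : F u = v) (Fv : F v = 0) (Fw : F w = 0) (Fx : F x = - al^-1 *: w).
Hypotheses (ku : k u = be *: u) (kv : k v = be^-1 *: v) (kw : k w = be^-1 *: w) (kx : k x = be *: x).
Hypotheses (gu : g u = et *: u) (gv : g v = et^-1 *: v) (gw : g w = et^-1 *: w) (gx : g x = et *: x).
Hypotheses (ThD : forall x y, Th (x + y) = Th x + Th y) (ThZ : forall c x, Th (c *: x) = c *: Th x).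
Hypotheses (ThM : forall x y, Th (x * y) = Th x * Th y) (Th1 : Th 1 = 1).
Hypotheses (ThA : forall a, A a -> Th a = a).
Hypotheses (Thu : Th u = 2 *: u) (Thv : Th v = 2^-1 *: v) (Thw : Th w = 2^-1 *: w) (Thx : Th x = 2 *: x).

(** The q-integer [n] in base al^2. *)
Definition qn n := \sum_(s < n) al ^+ (2 * s).
Hypothesis qn_neq0 : forall n, qn n.+1 != 0.

Let ED := let: And4 h _ _ _ := dE in h.
Let EZ := let: And4 _ h _ _ := dE in h.
Let EA := let: And4 _ _ h _ := dE in h.
Let EM := let: And4 _ _ _ h := dE in h.
Let FD := let: And4 h _ _ _ := dF in h.
Let FZ := let: And4 _ h _ _ := dF in h.
Let FA := let: And4 _ _ h _ := dF in h.
Let FM := let: And4 _ _ _ h := dF in h.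

Let be0 : be != 0. Proof. by rewrite mulf_neq0. Qed.

Lemma qn0 : qn 0 = 0. Proof. by rewrite /qn big_ord0. Qed.
Lemma qnSr n : qn n.+1 = qn n + al ^+ (2 * n).
Proof. by rewrite /qn big_ord_recr. Qed.
Lemma qnD m n : qn (m + n) = qn m + al ^+ (2 * m) * qn n.
Proof.
elim: n => [|n IH]; first by rewrite addn0 qn0 mulr0 addr0.
by rewrite addnS !qnSr IH mulrDr addrA -exprD -mulnDr.
Qed.
Lemma qn1 : qn 1 = 1. Proof. by rewrite qnSr qn0 add0r expr0. Qed.
Lemma qnS n : qn n.+1 = 1 + al ^+ 2 * qn n.
Proof. by rewrite -add1n qnD qn1. Qed.

Lemma CX y n : C y -> C (y ^+ n).
Proof. by move=> Cy; elim: n => [|n IH]; rewrite ?expr0 // exprS; exact: CM. Qed.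

Lemma skew_sub D y z : skew_derivation D -> D (y - z) = D y - D z.
Proof. by move=> [DD DZ _ _]; rewrite DD -scaleN1r DZ scaleN1r. Qed.

Lemma skew1 D : skew_derivation D -> D 1 = 0.
Proof.
move=> [DD DZ _ DM]; have := DM 1 1 C1 C1; rewrite !rmorph1 !mulr1 mul1r => e.
by apply: (addrI (D 1)); rewrite addr0 -e.
Qed.

Lemma skewX0 D y n : skew_derivation D -> C y -> D y = 0 -> D (y ^+ n) = 0.
Proof.
move=> dD Cy Dy; have [_ _ _ DM] := dD; elim: n => [|n IH]; first exact: skew1.
by rewrite exprS DM //; [rewrite Dy IH mul0r mulr0 addr0 | exact: CX].
Qed.

Lemma vXu j : v ^+ j * u = al ^+ j *: (u * v ^+ j).
Proof.
elim: j => [|j IH]; first by rewrite !expr0 mul1r mulr1 scale1r.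
by rewrite exprSr -mulrA vu -scalerAr [_ * (u * v)]mulrA IH -scalerAl scalerA -exprS mulrA.
Qed.

Lemma xwX j : x * w ^+ j = al ^- j *: (w ^+ j * x).
Proof.
elim: j => [|j IH]; first by rewrite !expr0 mul1r mulr1 invr1 scale1r.
by rewrite exprSr [LHS]mulrA IH -scalerAl -[_ * x * w]mulrA xw -scalerAr scalerA -invfM mulrC exprS mulrA.
Qed.

Lemma rmorphXZ (f : {rmorphism U -> U}) c y n : f y = c *: y -> f (y ^+ n) = c ^+ n *: y ^+ n.
Proof. by move=> fy; rewrite rmorphXn /= fy exprZn. Qed.

Lemma F_uX i : F (u ^+ i.+1) = (et ^+ i * qn i.+1) *: (u ^+ i * v).
Proof.
elim: i => [|i IH]; first by rewrite expr1 Fu qn1 mulr1 !expr0 scale1r mul1r.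
rewrite exprSr FM ?IH ?Fu ?ku ?(rmorphXZ _ gu) //; last exact: CX.
rewrite -scalerAl -!scalerAr -[u ^+ i * v * u]mulrA vu -scalerAr mulrA -exprSr -scalerAl.
by rewrite !scalerA -scalerDl [qn i.+2]qnS !exprS; congr (_ *: _); ring.
Qed.

Lemma E_vX j : E (v ^+ j.+1) = (be ^- j * qn j.+1) *: (u * v ^+ j).
Proof.
elim: j => [|j IH]; first by rewrite expr1 Ev qn1 mulr1 !expr0 invr1 scale1r mulr1.
rewrite exprS EM ?IH ?Ev ?gv ?(rmorphXZ _ kv) //; last exact: CX.
rewrite -scalerAl -!scalerAr [v * (u * _)]mulrA vu -!scalerAl -[u * v * _]mulrA -exprS.
by rewrite !scalerA -scalerDl [qn j.+2]qnS exprVn !exprS; congr (_ *: _); field; rewrite ?expf_neq0 ?et0 ?al0.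
Qed.

Lemma E_wX j : E (w ^+ j.+1) = (- al * be ^- j * qn j.+1) *: (x * w ^+ j).
Proof.
elim: j => [|j IH]; first by rewrite expr1 Ew qn1 mulr1 !expr0 invr1 !mulr1.
have wx : w * x = al *: (x * w) by rewrite xw scalerA mulfV // scale1r.
rewrite exprS EM ?IH ?Ew ?gw ?(rmorphXZ _ kw) //; last exact: CX.
rewrite -!scalerAl -!scalerAr [w * (x * _)]mulrA wx -!scalerAl -[x * w * _]mulrA -exprS.
by rewrite !scalerA -scalerDl [qn j.+2]qnS exprVn !exprS; congr (_ *: _); field; rewrite ?expf_neq0 ?et0 ?al0.
Qed.

Lemma F_xX l : F (x ^+ l.+1) = (- al^-1 * et ^+ l * al ^- l * qn l.+1) *: (w * x ^+ l).
Proof.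
elim: l => [|l IH]; first by rewrite expr1 Fx qn1 !expr0 invr1 !mulr1.
rewrite exprS FM ?IH ?Fx ?gx ?(rmorphXZ _ kx) //; last exact: CX.
rewrite -!scalerAl -!scalerAr [x * (w * _)]mulrA xw -!scalerAl -[w * x * _]mulrA -exprS.
rewrite !scalerA -scalerDl [qn l.+2]qnSr mulnC exprM expr2 exprMn !exprS; congr (_ *: _); field.
by rewrite ?expf_neq0 ?et0 ?al0.
Qed.

(** The chart monomials of torus weight zero: [Th] multiplies u and x by 2, v and w by 1/2. Half the
    degree is i + j. *)
Definition lev N (m : U) := exists i j, (i + j < N)%N /\
  (m = mono_uvw u v w (i + j) i j \/ m = mono_uwx u w x i (i + j) j).

(** The Casimir value [n][n+1] of spin n, rescaled by the twists k and g of the two derivations. *)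
Definition lam n := qn n * qn n.+1 * (et ^+ n * be ^- n * be) ^+ 2.

Lemma lam_neq0 n : lam n.+1 != 0.
Proof. by rewrite /lam !mulf_neq0 ?invr_neq0 ?mulf_neq0 ?expf_neq0. Qed.

Local Notation mono1 := (mono_uvw u v w).
Local Notation mono2 := (mono_uwx u w x).

Lemma levZ N c m : aspan A (lev N) m -> aspan A (lev N) (c *: m).
Proof. exact: aspanZ. Qed.

Lemma mono1_lev N i j : (i + j < N)%N -> aspan A (lev N) (mono1 (i + j) i j).
Proof. by move=> ijN; apply: aspan_gen => //; exists i, j; split; [|left]. Qed.

Lemma mono2_lev N i j : (i + j < N)%N -> aspan A (lev N) (mono2 i (i + j) j).
Proof. by move=> ijN; apply: aspan_gen => //; exists i, j; split; [|right]. Qed.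

Lemma E_mono2 i m l : E (mono2 i m.+1 l) =
  (et ^+ i * (- al * be ^- m * qn m.+1) * be ^+ l) *: (u ^+ i * (x * w ^+ m * x ^+ l)).
Proof.
rewrite /mono_uwx EM; [|apply: CM|]; try exact: CX.
rewrite (skewX0 _ dE Cx Ex) mulr0 addr0 EM; try exact: CX.
rewrite (skewX0 _ dE Cu Eu) mul0r add0r E_wX (rmorphXZ _ gu) (rmorphXZ _ kx).
by rewrite -!scalerAl -!scalerAr -!scalerAl !scalerA !mulrA; congr (_ *: _); ring.
Qed.

Lemma F_mono2 m l : F (x * w ^+ m * x ^+ l) =
  (- (al ^- m * et ^- m * al^-1 * et ^+ l * al ^- l * qn l.+1)) *: (w ^+ m.+1 * x ^+ l).
Proof.
rewrite xwX -scalerAl FZ -[w ^+ m * x * _]mulrA -exprS FM; try exact: CX.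
rewrite (skewX0 _ dF Cw Fw) mul0r add0r F_xX (rmorphXZ _ gw).
by rewrite -!scalerAl -!scalerAr !scalerA !mulrA -exprSr; congr (_ *: _); rewrite exprVn; ring.
Qed.

Lemma T_mono2 i l m : (i + l = m.+1)%N ->
  aspan A (lev m.+1) (F (E (mono2 i m.+1 l)) - lam m.+1 *: mono2 i m.+1 l).
Proof.
have Cb : C (x * w ^+ m * x ^+ l) by apply: CM; [apply: CM|]; rewrite //; exact: CX.
rewrite E_mono2 FZ; case: i => [|i].
  rewrite add0n => lm; rewrite !expr0 !mul1r F_mono2 /mono_uwx expr0 mul1r scalerA -scalerBl.
  rewrite [_ - _](_ : _ = 0) ?scale0r; first exact: aspan0.
  rewrite /lam lm !exprMn !exprS; field; rewrite ?expf_neq0 ?et0 ?al0 //.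
rewrite addSn => -[lm]; have Cui := CX i.+1 Cu.
rewrite FM // F_uX (rmorphXZ _ gu) F_mono2.
have -> : k (x * w ^+ m * x ^+ l) = (be * be ^- m * be ^+ l) *: (x * w ^+ m * x ^+ l).
  rewrite !rmorphM /= kx (rmorphXZ _ kw) (rmorphXZ _ kx) -!scalerAl -!scalerAr -!scalerAl !scalerA exprVn.
  by congr (_ *: _); ring.
(* The v produced by F meets the x produced by E, and v x = p - u w: the term with p has lower
   level, the one with u w restores the monomial. *)
rewrite -!scalerAl -!scalerAr !scalerA [u ^+ i * v * _]mulrA [u ^+ i * v * _]mulrA -[u ^+ i * v * x]mulrA vx.
rewrite mulrBr !mulrBl [u ^+ i * (u * w)]mulrA -exprSr -[u ^+ i.+1 * w * _]mulrA -exprS.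
rewrite [u ^+ i.+1 * (w ^+ _ * _)]mulrA -/(mono2 i.+1 m.+1 l).
rewrite scalerBr scalerDr !scalerA !scalerBr !scalerA -!addrA; apply: aspanD => //.
  apply: levZ; rewrite -[_ * w ^+ m * _]mulrA; apply: (aspan_pull A1 AZD AM AR) pE _ _; first exact: qcommXl.
  by rewrite mulrA -lm; apply: mono2_lev; rewrite lm.
rewrite -!scaleNr addrA -!scalerDl [X in X *: _](_ : _ = 0) ?scale0r; first exact: aspan0.
(* F acting on x and on u contributes [l+1] and [i+1]; weighted, they add up to [m+2] as i + l = m
   here. *)
have qm : qn m.+2 = qn l.+1 + al ^+ (2 * l.+1) * qn i.+1 by rewrite -qnD -lm; congr qn; lia.
rewrite /lam qm -lm mulnC exprM !expr2 !exprMn !exprS !exprD; field.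
by rewrite ?expf_neq0 ?et0 ?al0.
Qed.

(** E turns v into u and w into -al x. That x is absorbed by v x = p - u w, so both contributions
    have the same leading monomial and their q-integers add up to [j + k' + 1]. *)
Lemma E_vw j k' : exists c, E (v ^+ j.+1 * w ^+ k') = (be ^- (j + k') * qn (j + k').+1) *: (u * v ^+ j * w ^+ k') +
    (if k' is k''.+1 then c *: (v ^+ j * p * w ^+ k'') else 0).
Proof.
case: k' => [|k'].
  by exists 0; rewrite !addn0 !mulr1 addr0; exact: E_vX.
exists (- al * et^-1 ^+ j.+1 * be ^- k' * qn k'.+1).
rewrite EM; try exact: CX.
rewrite E_vX E_wX (rmorphXZ _ gv) (rmorphXZ _ kw) exprVn.
rewrite -!scalerAl -!scalerAr !scalerA [v ^+ j.+1 * (x * _)]mulrA [v ^+ j.+1]exprSr -[v ^+ j * v * x]mulrA vx.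
rewrite mulrBr mulrBl scalerBr [v ^+ j * (u * w)]mulrA vXu -!scalerAl !scalerA.
rewrite -[u * v ^+ j * w * _]mulrA -exprS.
rewrite addrCA -scaleNr -scalerDl addrC; congr (_ *: _ + _ *: _); last by ring.
rewrite -[(j + k'.+1).+1]addSn qnD !exprD !exprVn mulnC exprM expr2 !exprMn !exprS; field.
by rewrite ?expf_neq0 ?et0 ?al0.
Qed.

Lemma skew0 D : skew_derivation D -> D 0 = 0.
Proof. by move=> [_ DZ _ _]; rewrite -[X in D X](scale0r 0) DZ scale0r. Qed.

Lemma pull_p m m' : qcomm m R -> exists2 a, A a & m * p * m' = a * (m * m').
Proof.
move=> [e mR]; have [c [d ->]] := pE; exists (c *: 1 + (d * e) *: R).
  by apply: AZD => //; rewrite -[_ *: R]addr0; apply: AZD => //; exact: (A0 A1 AZD).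
rewrite mulrDr -!scalerAr mulr1 mR scalerA !mulrDl -!scalerAl mul1r.
by rewrite mulrA.
Qed.

Lemma F_uvw i j k' : F (u ^+ i.+1 * (v ^+ j * w ^+ k')) =
  (et ^+ i * qn i.+1 * be ^- (j + k')) *: mono1 i j.+1 k'.
Proof.
rewrite FM; [|exact: CX|apply: CM; exact: CX].
have -> : F (v ^+ j * w ^+ k') = 0.
  by rewrite FM ?(skewX0 _ dF Cv Fv) ?(skewX0 _ dF Cw Fw) ?mulr0 ?mul0r ?addr0 //; exact: CX.
rewrite mulr0 addr0 F_uX rmorphM /= (rmorphXZ _ kv) (rmorphXZ _ kw) /mono_uvw !exprVn.
by rewrite -!scalerAl -!scalerAr !scalerA !mulrA exprS exprD invfM; congr (_ *: _); rewrite -?mulrA.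
Qed.

Lemma T_mono1 j k' : aspan A (lev (j + k').+1)
  (F (E (mono1 (j.+1 + k') j.+1 k')) - lam (j + k').+1 *: mono1 (j.+1 + k') j.+1 k').
Proof.
set n := (j + k')%N.
have -> : mono1 (j.+1 + k') j.+1 k' = u ^+ n.+1 * (v ^+ j.+1 * w ^+ k') by rewrite mulrA.
rewrite EM; [|exact: CX|apply: CM; exact: CX].
have [c cE] := E_vw j k'.
rewrite (skewX0 _ dE Cu Eu) mul0r add0r cE (rmorphXZ _ gu) -scalerAl FZ mulrDr FD scalerDr -/n.
rewrite addrAC; apply: aspanD => //; last first.
  apply: levZ; case: k' @n cE => [|k'] n cE; first by rewrite mulr0 (skew0 dF); exact: aspan0.
  rewrite -scalerAr FZ; apply: levZ; rewrite !mulrA.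
  have [|a Aa ->] := @pull_p (u ^+ n.+1 * v ^+ j) (w ^+ k').
    by apply: qcommMl; exact: qcommXl.
  rewrite FA // -mulrA F_uvw; apply: aspanM => //; apply: levZ.
  by rewrite /n addnS -addSn; apply: mono1_lev; rewrite addSn.
rewrite -scalerAr FZ -[u * v ^+ _ * _]mulrA [_ * (u * _)]mulrA -exprSr F_uvw !scalerA [u ^+ _ * _]mulrA.
rewrite -scalerBl [X in X *: _](_ : _ = 0) ?scale0r; first exact: aspan0.
rewrite /lam -/n !exprMn !exprS; field.
by rewrite ?expf_neq0 ?et0 ?al0.
Qed.

Lemma T_lev n m : lev n.+1 m -> aspan A (lev n) (F (E m) - lam n *: m).
Proof.
have FB := skew_sub _ _ dF; have EB := skew_sub _ _ dE.
have sub N N' : (N <= N')%N -> forall y, aspan A (lev N) y -> aspan A (lev N') y.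
  move=> NN'; apply: aspan_sub => // y [i [j [ij yE]]]; apply: aspan_gen => //.
  by exists i, j; split=> //; exact: leq_trans NN'.
have top i j : (m = mono1 (i + j) i j \/ m = mono2 i (i + j) j) ->
    aspan A (lev (i + j)) (F (E m) - lam (i + j) *: m).
  case=> ->.
    case: i => [|i]; last exact: T_mono1.
    (* Without v the two families of monomials agree. *)
    have -> : mono1 (0 + j) 0 j = mono2 j j 0 by rewrite /mono_uvw /mono_uwx !expr0 !mulr1.
    case: j => [|j]; last by apply: T_mono2; rewrite addn0.
    rewrite /mono_uwx !expr0 !mulr1 (skew1 dE) (skew0 dF) /lam qn0 !mul0r scale0r subr0.
    exact: aspan0.
  case ij: (i + j)%N => [|m']; last exact: T_mono2.
  have [i0 j0] : i = 0%N /\ j = 0%N by lia.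
  rewrite i0 j0 /mono_uwx !expr0 !mulr1 (skew1 dE) (skew0 dF) /lam qn0 !mul0r scale0r subr0.
  exact: aspan0.
move=> [i [j [ij mE]]]; have := top _ _ mE; move: ij; rewrite ltnS leq_eqVlt => /orP[/eqP -> //|ij Tm].
(* A monomial below the top level has another eigenvalue; replacing it by lam n costs a multiple of
   m, which is itself of lower level. *)
rewrite -[F _](subrK (lam (i + j) *: m)) -addrA -scalerBl; apply: aspanD => //.
  by apply: sub Tm; exact: ltnW.
by apply: levZ; apply: aspan_gen => //; exists i, j.
Qed.

(** E y = 0 makes lam n y itself of lower level by [T_lev], and dividing by lam n descends. The
    descent stops at level 1, where lam 0 = 0 but the only monomial is 1, so that y is a
    coefficient. *)
Lemma lev_elim n y : aspan A (lev n) y -> E y = 0 -> A y.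
Proof.
elim: n y => [|n IH] y.
  by move=> [[|e l]] [lA ->] _; [rewrite big_nil; exact: (A0 A1 AZD) | case: (lA e (mem_head _ _)) => _ [i [j [//]]]].
move=> ys Ey; have TB : F (E y) - lam n *: y = - lam n *: y by rewrite Ey (skew0 dF) sub0r scaleNr.
have Tlow : aspan A (lev n) (F (E y) - lam n *: y).
  move: ys; clear Ey TB; move: y; apply: aspan_ind => [|y z Py Pz|a m Aa Pm].
  - by rewrite (skew0 dE) (skew0 dF) scaler0 subr0; exact: aspan0.
  - by rewrite ED FD scalerDr opprD addrACA; exact: aspanD.
  - by rewrite EA // FA // scalerAr -mulrBr; apply: aspanM => //; exact: T_lev.
case: n IH ys TB Tlow => [|n] IH ys TB Tlow.
  move: ys; move=> [l [lA ->]]; rewrite big_seq; apply: big_ind => [||e el].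
  - exact: (A0 A1 AZD).
  - by move=> ? ? ? ?; exact: (AD AZD).
  - have [Ae [i [j [ij eE]]]] := lA e el; have [i0 j0] : i = 0%N /\ j = 0%N by lia.
    by move: eE; rewrite i0 j0 /mono_uvw /mono_uwx !expr0 !mulr1 => -[] ->; rewrite mulr1.
have lam1 : - lam n.+1 != 0 by rewrite oppr_eq0 lam_neq0.
apply: IH => //; rewrite -[y]scale1r -(mulVf (lam1 : - lam n.+1 != 0)) -scalerA -TB.
exact: levZ.
Qed.

Lemma chart_elim y : aspan A (chart_mono u v w x) y -> Th y = y -> E y = 0 -> A y.
Proof.
move=> ys Thy; suff [n yn] : exists n, aspan A (lev n) y by exact: lev_elim yn.
have ThX c z n : Th z = c *: z -> Th (z ^+ n) = c ^+ n *: z ^+ n.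
  by move=> zE; elim: n => [|n IH]; rewrite ?expr0 ?Th1 ?scale1r // !exprS ThM zE IH -scalerAl -scalerAr scalerA.
have : aspan A (fun m => exists n, lev n m) y.
  apply: (aspan_fixed A1 AZD ThD ThZ _ _ ys Thy) => [a z Aa|m [i [j [k' mE]]]]; first by rewrite ThM ThA.
  have two0 : (2 : K) != 0 by rewrite pnatr_eq0.
  (* Distinct powers of 2 are different scalars, so eigenvalue 1 means balanced exponents. *)
  have inj2 a b : (2 : K) ^+ a = 2 ^+ b -> a = b.
    by rewrite -!natrX => /eqP; rewrite eqr_nat eqn_exp2l // => /eqP.
  case: mE => ->.
    exists (2 ^+ i * 2^-1 ^+ j * 2^-1 ^+ k').
      by rewrite /mono_uvw !ThM !(ThX _ _ _ Thu, ThX _ _ _ Thv, ThX _ _ _ Thw) -!scalerAl -!scalerAr -!scalerAl !scalerA; congr (_ *: _); ring.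
    move=> e; have -> : i = (j + k')%N.
      apply: inj2; have := congr1 ( *%R^~ (2 ^+ (j + k'))) e; rewrite mul1r => <-.
      by rewrite exprD !exprVn; field; rewrite !expf_neq0.
    by exists (j + k').+1, j, k'; split; [|left].
  exists (2 ^+ i * 2^-1 ^+ j * 2 ^+ k').
    by rewrite /mono_uwx !ThM !(ThX _ _ _ Thu, ThX _ _ _ Thw, ThX _ _ _ Thx) -!scalerAl -!scalerAr -!scalerAl !scalerA; congr (_ *: _); ring.
  move=> e; have -> : j = (i + k')%N.
    apply: inj2; have := congr1 ( *%R^~ (2 ^+ j)) e; rewrite mul1r => <-.
    by rewrite exprD !exprVn; field; rewrite !expf_neq0.
  by exists (i + k').+1, i, k'; split; [|right].
apply: (aspan_ind (Q := fun y => exists n, aspan A (lev n) y)) => [|a b [n an] [n' bn]|a m Aa [n mn]].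
- by exists 0%N; exact: aspan0.
- have sub N N' : (N <= N')%N -> forall y, aspan A (lev N) y -> aspan A (lev N') y.
    move=> NN'; apply: aspan_sub => // z [i [j [ij zE]]]; apply: aspan_gen => //.
    by exists i, j; split=> //; exact: leq_trans NN'.
  exists (maxn n n'); apply: aspanD => //; [apply: sub an; exact: leq_maxl | apply: sub bn; exact: leq_maxr].
- by exists n; apply: aspanM => //; exact: aspan_gen.
Qed.
End ChartElimination.

(** * Representations of U_q(4) and raising operators *)

Section Homs.
Context {K : numClosedFieldType} (q : K) (U : hopfStarAlg K) (t : 'I_4 -> 'I_4 -> U) (Dinv : U).
Hypotheses (hU : is_Uq4 q t Dinv).
Local Notation T := (tgen t).

Lemma qdet_lapdet (A : algType K) (M : nat -> nat -> A) :
  qdet q (fun i j : 'I_4 => M i j) = lapdet q 4 M.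
Proof. by rewrite -lapdetE. Qed.

(** The last clause carries a property of the images of the generators over to all values; it yields
    the triangular shape of the representations. *)
Lemma Uq4_lift (B : algType K) (M : nat -> nat -> B) (N : B) :
  (forall i j k, (i < j < 4)%N -> (k < 4)%N -> M i k * M j k = q *: (M j k * M i k)) ->
  (forall i j k, (i < j < 4)%N -> (k < 4)%N -> M k i * M k j = q *: (M k j * M k i)) ->
  (forall i j k l, (i < j < 4)%N -> (k < l < 4)%N -> M i l * M j k = M j k * M i l) ->
  (forall i j k l, (i < j < 4)%N -> (k < l < 4)%N ->
     M i k * M j l - M j l * M i k = (q - q^-1) *: (M j k * M i l)) ->
  lapdet q 4 M * N = 1 -> N * lapdet q 4 M = 1 ->
  exists f : U -> B, [/\ f 1 = 1, forall c x y, f (c *: x + y) = c *: f x + f y,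
    forall x y, f (x * y) = f x * f y,
    forall i j, (i < 4)%N -> (j < 4)%N -> f (T i j) = M i j &
    forall P : B -> Prop, P 1 -> (forall c x y, P x -> P y -> P (c *: x + y)) ->
      (forall x y, P x -> P y -> P (x * y)) -> (forall i j, (i < 4)%N -> (j < 4)%N -> P (M i j)) -> P N ->
      forall x, P (f x)].
Proof.
move=> Mcol Mrow Mcomm Mcross MN NM.
pose gen' (g : Uq4_gen) : B := if g is Some (i, j) then M i j else N.
have rel' r : Uq4_rel q r -> free_eval gen' r = 0.
  case=> [i j k ij|i j k ij|i j k l ij kl|i j k l ij kl||].
  - by rewrite free_eval_quad /= Mcol ?ij ?ltn_ord // subrr.
  - by rewrite free_eval_quad /= Mrow ?ij ?ltn_ord // subrr.
  - by rewrite -[X in _ - X]scale1r free_eval_quad scale1r /= Mcomm ?ij ?kl ?ltn_ord // subrr.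
  - rewrite free_evalB -[X in free_eval _ (_ - X)]scale1r free_eval_quad scale1r.
    rewrite [free_eval _ (_ *: _)]free_evalZ [free_eval _ (_ * _)]free_evalM !free_eval_gen /=.
    by rewrite Mcross ?ij ?kl ?ltn_ord // subrr.
  - rewrite free_evalB [free_eval _ (_ * _)]free_evalM [free_eval _ 1]free_eval1 free_eval_gen.
    by rewrite free_eval_qdet /= qdet_lapdet MN subrr.
  - rewrite free_evalB [free_eval _ (_ * _)]free_evalM [free_eval _ 1]free_eval1 free_eval_gen.
    by rewrite free_eval_qdet /= qdet_lapdet NM subrr.
have pres := Uq4_presented hU.
exists (presented_lift pres gen'); split.
- exact: presented_lift1.
- by move=> c x y; rewrite presented_liftD // presented_liftZ.
- by move=> x y; rewrite presented_liftM.
- move=> i j i4 j4; rewrite /tgen.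
  have := presented_lift_gen pres rel' (Some (inord i, inord j) : Uq4_gen).
  by rewrite /= !inordK.
- move=> P P1 PZD PM Pg PN x; have [p <-] := presented_repr pres x.
  rewrite presented_liftE //.
  apply: free_eval_ind => [|c w y Py].
    by have := PZD (-1) 1 1 P1 P1; rewrite scaleN1r addNr.
  apply: PZD => //; apply: big_ind => // -[[i j]|] _ //=; exact: Pg.
Qed.
End Homs.

Section Determinants.
Context {K : fieldType} (q : K) {A : algType K}.

Lemma lapdet_row0 n (f : nat -> nat -> A) : (forall b, (b < n.+1)%N -> f 0%N b = 0) ->
  lapdet q n.+1 f = 0.
Proof.
elim: n f => [|n IH] f f0.
  by rewrite /= big_ord_recl big_ord0 f0 // mul0r scaler0 addr0.
rewrite lapdetS big1 // => -[[|i] i2] _.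
  by rewrite f0 // mul0r scaler0.
by rewrite IH ?mulr0 ?scaler0 // => b bn; rewrite f0.
Qed.

Lemma lapdet_hook n (f : nat -> nat -> A) :
  (forall i, (i < n)%N -> f i.+1 0%N = 0) \/ (forall b, (b < n)%N -> f 0%N b.+1 = 0) ->
  lapdet q n.+1 f = f 0%N 0%N * lapdet q n (fun a b => f a.+1 b.+1).
Proof.
move=> f0; rewrite lapdetS big_ord_recl expr0 scale1r big1 ?addr0 // => i _.
case: n f f0 i => [|n] f f0 i; first by case: i.
case: f0 => f0; first by rewrite /= /bump f0 // mul0r scaler0.
rewrite lapdet_row0 ?mulr0 ?scaler0 // => b bn; exact: f0.
Qed.
End Determinants.

(** * The algebra of triangular 3x3 matrices carrying the functionals *)

Section Triangular.
Context {K : fieldType}.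

(** Two upper triangular 2x2 blocks sharing the last diagonal entry: a, b, c multiply as characters,
    d is skew between a and c, e between b and c. *)
Definition tri (a b c d e : K) : 'M[K]_3 := \matrix_(i < 3, j < 3)
  nth 0 (nth [::] [:: [:: a; 0; d]; [:: 0; b; e]; [:: 0; 0; c]] i) j.

Lemma triM a b c d e a' b' c' d' e' :
  tri a b c d e * tri a' b' c' d' e' =
  tri (a * a') (b * b') (c * c') (a * d' + d * c') (b * e' + e * c').
Proof.
apply/matrixP => -[[|[|[|i]]] i3] [[|[|[|j]]] j3] //; rewrite !mxE !big_ord_recr big_ord0 /= !mxE /=; ring.
Qed.

Lemma triD a b c d e a' b' c' d' e' :
  tri a b c d e + tri a' b' c' d' e' = tri (a + a') (b + b') (c + c') (d + d') (e + e').
Proof.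
by apply/matrixP => -[[|[|[|i]]] i3] [[|[|[|j]]] j3] //; rewrite !mxE /= ?addr0.
Qed.

Lemma triZ s a b c d e : s *: tri a b c d e = tri (s * a) (s * b) (s * c) (s * d) (s * e).
Proof.
by apply/matrixP => -[[|[|[|i]]] i3] [[|[|[|j]]] j3] //; rewrite !mxE /= ?mulr0.
Qed.

Lemma triN a b c d e : - tri a b c d e = tri (- a) (- b) (- c) (- d) (- e).
Proof.
by apply/matrixP => -[[|[|[|i]]] i3] [[|[|[|j]]] j3] //; rewrite !mxE /= ?oppr0.
Qed.

Lemma tri1 : 1 = tri 1 1 1 0 0.
Proof. by apply/matrixP => -[[|[|[|i]]] i3] [[|[|[|j]]] j3] //; rewrite !mxE. Qed.

Lemma tri0 : 0 = tri 0 0 0 0 0.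
Proof. by apply/matrixP => -[[|[|[|i]]] i3] [[|[|[|j]]] j3] //; rewrite !mxE. Qed.

Definition triE := (triM, triN, triD, triZ).
End Triangular.

Definition i3 (i : nat) : 'I_3 := inord i.

Lemma tri_entry (K : fieldType) (a b c d e : K) i j : (i < 3)%N -> (j < 3)%N ->
  tri a b c d e (i3 i) (i3 j) = nth 0 (nth [::] [:: [:: a; 0; d]; [:: 0; b; e]; [:: 0; 0; c]] i) j.
Proof. by move=> i3 j3; rewrite mxE !inordK. Qed.

Opaque tri.

Section Representations.
Context {K : numClosedFieldType} (q : K) (U : hopfStarAlg K) (t : 'I_4 -> 'I_4 -> U) (Dinv : U).
Hypotheses (q0 : q != 0) (qR : q^* = q) (hU : is_Uq4 q t Dinv).

(* The matrices of t_ij; b distinguishes the raising from the lowering operator. *)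
Definition rmx (b : bool) (i j : nat) : 'M[K]_3 :=
  if i == j then
    tri 1 (nth 0 [:: q^-1; q; q; q^-1] i) (nth 0 [:: q^-1; q; 1; 1] i) 0 0
  else if (i, j) == (if b then (0, 1) else (1, 0))%N then tri 0 0 0 1 0
  else if (i, j) == (if b then (3, 2) else (2, 3))%N then tri 0 0 0 0 (-1) else 0.

(** The inverse of [rmx] as a 4x4 matrix over 3x3 matrices, hence the values of the representation
    on the S(t_ij). *)
Definition rmxV (b : bool) (i j : nat) : 'M[K]_3 :=
  if i == j then
    tri 1 (nth 0 [:: q; q^-1; q^-1; q] i) (nth 0 [:: q; q^-1; 1; 1] i) 0 0
  else if (i, j) == (if b then (0, 1) else (1, 0))%N then tri 0 0 0 (if b then - q^-1 else - q) 0
  else if (i, j) == (if b then (3, 2) else (2, 3))%N then tri 0 0 0 0 (if b then q else q^-1)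
  else 0.

Lemma rmx_det b : lapdet q 4 (rmx b) = 1.
Proof.
rewrite !lapdet_hook; first last.
- by case: b; [left|right]; case=> [|[|[|[|i]]]].
- by case: b; [left|right]; case=> [|[|[|[|i]]]].
- by case: b; [right|left]; case=> [|[|[|[|i]]]].
- by left; case.
by rewrite /rmx /= mulr1 !triM tri1; congr tri; field.
Qed.

Lemma rmx_col b i j k : (i < j < 4)%N -> (k < 4)%N ->
  rmx b i k * rmx b j k = q *: (rmx b j k * rmx b i k).
Proof.
move=> /andP[ij j4] k4; have i4 := ltn_trans ij j4; move: i j k i4 j4 k4 ij.
move=> [|[|[|[|i]]]] // [|[|[|[|j]]]] // [|[|[|[|k]]]] // _ _ _ _; case: b;
  rewrite /rmx /= ?(mul0r, mulr0, scaler0, oppr0, addr0, add0r) // ?triE;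
  first [congr tri | rewrite [RHS]tri0; congr tri]; by [|field].
Qed.

Lemma rmx_row b i j k : (i < j < 4)%N -> (k < 4)%N ->
  rmx b k i * rmx b k j = q *: (rmx b k j * rmx b k i).
Proof.
move=> /andP[ij j4] k4; have i4 := ltn_trans ij j4; move: i j k i4 j4 k4 ij.
move=> [|[|[|[|i]]]] // [|[|[|[|j]]]] // [|[|[|[|k]]]] // _ _ _ _; case: b;
  rewrite /rmx /= ?(mul0r, mulr0, scaler0, oppr0, addr0, add0r) // ?triE;
  first [congr tri | rewrite [RHS]tri0; congr tri]; by [|field].
Qed.

Lemma rmx_comm b i j k l : (i < j < 4)%N -> (k < l < 4)%N ->
  rmx b i l * rmx b j k = rmx b j k * rmx b i l.
Proof.
move=> /andP[ij j4] /andP[kl l4]; have i4 := ltn_trans ij j4; have k4 := ltn_trans kl l4.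
move: i j k l i4 j4 k4 l4 ij kl.
move=> [|[|[|[|i]]]] // [|[|[|[|j]]]] // [|[|[|[|k]]]] // [|[|[|[|l]]]] // _ _ _ _ _ _; case: b;
  rewrite /rmx /= ?(mul0r, mulr0, scaler0, oppr0, addr0, add0r) // ?triE;
  first [congr tri | rewrite [RHS]tri0; congr tri]; by [|field].
Qed.

Lemma rmx_cross b i j k l : (i < j < 4)%N -> (k < l < 4)%N ->
  rmx b i k * rmx b j l - rmx b j l * rmx b i k = (q - q^-1) *: (rmx b j k * rmx b i l).
Proof.
move=> /andP[ij j4] /andP[kl l4]; have i4 := ltn_trans ij j4; have k4 := ltn_trans kl l4.
move: i j k l i4 j4 k4 l4 ij kl.
move=> [|[|[|[|i]]]] // [|[|[|[|j]]]] // [|[|[|[|k]]]] // [|[|[|[|l]]]] // _ _ _ _ _ _; case: b;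
  rewrite /rmx /= ?(mul0r, mulr0, scaler0, oppr0, addr0, add0r) // ?triE;
  first [congr tri | rewrite [RHS]tri0; congr tri]; by [|field].
Qed.

Lemma rmxV_mul b i j : (i < 4)%N -> (j < 4)%N ->
  \sum_(k < 4) rmx b i k * rmxV b k j = (i == j)%:R.
Proof.
move: i j => [|[|[|[|i]]]] // [|[|[|[|j]]]] // _ _; case: b;
  rewrite !big_ord_recr big_ord0 /= /rmx /rmxV /= ?(mul0r, mulr0, addr0, add0r) // !triE;
  first [rewrite [RHS]tri1; congr tri | rewrite [RHS]tri0; congr tri]; by [|field].
Qed.
End Representations.

Arguments rmx : simpl never.
Arguments rmxV : simpl never.

Section CharacterOperators.
Context {K : numClosedFieldType} (U : hopfStarAlg K) (f : U -> K).
Hypothesis fl : forall c u v, f (c *: u + v) = c * f u + f v.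
Hypotheses (fM : forall u v, f (u * v) = f u * f v) (f1 : f 1 = 1).

Lemma oper_charM x y : oper f (x * y) = oper f x * oper f y.
Proof.
rewrite (operM (s := [:: tt]) (g := fun=> f) (h := fun=> f)) ?big_seq1 // => u v.
by rewrite big_seq1.
Qed.

Lemma oper_char1 : oper f 1 = 1.
Proof.
rewrite (operE fl (r := [:: tt]) (g := fun=> 1) (h := fun=> 1)) ?big_seq1 ?f1 ?scale1r //.
exact: hopf_Delta1.
Qed.

Lemma oper_rmorphism : exists g : {rmorphism U -> U}, forall x, g x = oper f x.
Proof.
have zm : zmod_morphism (oper f : U -> U).
  by move=> x y; rewrite -scaleN1r (operD fl) (operZ fl) scaleN1r.
have mm : monoid_morphism (oper f : U -> U) by split; [exact: oper_char1 | exact: oper_charM].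
pose H1 := GRing.isZmodMorphism.Build _ _ _ zm.
pose H2 := GRing.isMonoidMorphism.Build _ _ _ mm.
pose h : {rmorphism U -> U} := HB.pack (oper f : U -> U) H1 H2.
by exists h.
Qed.
End CharacterOperators.

Section Operators.
Context {K : numClosedFieldType} (q : K) (U : hopfStarAlg K) (t : 'I_4 -> 'I_4 -> U) (Dinv : U).
Hypotheses (q0 : q != 0) (qR : q^* = q) (hU : is_Uq4 q t Dinv).
Local Notation T := (tgen t).
Local Notation S := (ST t).
Local Notation RI := (ideal_R q t).

Lemma rep_exists b : exists f : U -> 'M[K]_3, [/\ f 1 = 1, forall c x y, f (c *: x + y) = c *: f x + f y,
    forall x y, f (x * y) = f x * f y,
    forall i j, (i < 4)%N -> (j < 4)%N -> f (T i j) = rmx q b i j &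
    forall x, exists v : K * K * K * K * K, f x = tri v.1.1.1.1 v.1.1.1.2 v.1.1.2 v.1.2 v.2].
Proof.
have [||||||f [f1 fl fM fT fP]] := @Uq4_lift _ q _ _ _ hU _ (rmx q b) 1.
- exact: rmx_col.
- exact: rmx_row.
- exact: rmx_comm.
- exact: rmx_cross.
- by rewrite rmx_det ?mulr1.
- by rewrite rmx_det ?mulr1.
exists f; split=> // x; apply: (fP (fun y => exists v : K * K * K * K * K, y = tri v.1.1.1.1 v.1.1.1.2 v.1.1.2 v.1.2 v.2)).
- by exists (1, 1, 1, 0, 0); rewrite /= tri1.
- by move=> c _ _ [v ->] [w ->]; rewrite triZ triD; eexists (_, _, _, _, _); reflexivity.
- by move=> _ _ [v ->] [w ->]; rewrite triM; eexists (_, _, _, _, _); reflexivity.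
- move=> i j i4 j4; rewrite /rmx; case: ifP => _; first by eexists (_, _, _, _, _); reflexivity.
  case: ifP => _; first by eexists (_, _, _, _, _); reflexivity.
  case: ifP => _; first by eexists (_, _, _, _, _); reflexivity.
  by exists (0, 0, 0, 0, 0); rewrite /= tri0.
- by exists (1, 1, 1, 0, 0); rewrite /= tri1.
Qed.

Definition rep b : U -> 'M[K]_3 := projT1 (cid (rep_exists b)).

Lemma rep1 b : rep b 1 = 1.
Proof. by have [h _ _ _ _] := projT2 (cid (rep_exists b)); exact: h. Qed.
Lemma rep_linear b c x y : rep b (c *: x + y) = c *: rep b x + rep b y.
Proof. by have [_ h _ _ _] := projT2 (cid (rep_exists b)); exact: h. Qed.
Lemma repM b x y : rep b (x * y) = rep b x * rep b y.
Proof. by have [_ _ h _ _] := projT2 (cid (rep_exists b)); exact: h. Qed.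
Lemma repT b i j : (i < 4)%N -> (j < 4)%N -> rep b (T i j) = rmx q b i j.
Proof. by have [_ _ _ fT _] := projT2 (cid (rep_exists b)); exact: fT. Qed.
Lemma rep_tri b x : exists v : K * K * K * K * K, rep b x = tri v.1.1.1.1 v.1.1.1.2 v.1.1.2 v.1.2 v.2.
Proof. by have [_ _ _ _ h] := projT2 (cid (rep_exists b)); exact: h. Qed.

Lemma repD b x y : rep b (x + y) = rep b x + rep b y.
Proof. by have := rep_linear b 1 x y; rewrite !scale1r. Qed.
Lemma rep0 b : rep b 0 = 0.
Proof. by have := rep_linear b (-1) 0 0; rewrite scaler0 addr0 scaleN1r addNr. Qed.
Lemma rep_sum b n (F : 'I_n -> U) : rep b (\sum_(i < n) F i) = \sum_(i < n) rep b (F i).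
Proof. by elim/big_ind2: _ => [|x1 x2 y1 y2 <- <-|//]; rewrite ?rep0 ?repD. Qed.
Lemma repZ b c x : rep b (c *: x) = c *: rep b x.
Proof. by have := rep_linear b c x 0; rewrite rep0 !addr0. Qed.

Lemma repB b x y : rep b (x - y) = rep b x - rep b y.
Proof. by rewrite -scaleN1r repD repZ scaleN1r. Qed.

(** The images of the S(t_ij) form a left inverse of [rmx], and [rmxV] is a right inverse. *)
Lemma repS b i j : (i < 4)%N -> (j < 4)%N -> rep b (S i j) = rmxV q b i j.
Proof.
move=> i4 j4.
have TS k : (k < 4)%N -> \sum_(l < 4) rep b (S i l) * rmx q b l k = (i == k)%:R.
  move=> k4; have := congr1 (rep b) (ST_T hU i4 k4); rewrite rep_sum => e.
  transitivity (rep b (i == k)%:R).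
    by rewrite -e; apply: eq_bigr => l _; rewrite repM repT.
  by case: (_ == _); rewrite ?rep1 ?rep0.
transitivity (\sum_(k < 4) (\sum_(l < 4) rep b (S i l) * rmx q b l k) * rmxV q b k j); last first.
  rewrite (bigD1 (Ordinal i4)) //= TS // eqxx mul1r big1 ?addr0 // => k.
  by rewrite -val_eqE /= TS // eq_sym => /negbTE ->; rewrite mul0r.
rewrite (eq_bigr (fun k : 'I_4 => \sum_(l < 4) rep b (S i l) * (rmx q b l k * rmxV q b k j))); last first.
  by move=> k _; rewrite mulr_suml; apply: eq_bigr => l _; rewrite mulrA.
rewrite exchange_big /= (bigD1 (Ordinal j4)) //= -mulr_sumr rmxV_mul // eqxx mulr1 big1 ?addr0 // => l.
by rewrite -val_eqE /= -mulr_sumr rmxV_mul ?ltn_ord // => /negbTE ->; rewrite mulr0.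
Qed.

(* The entries (0, 2) and (1, 2) are skew primitive functionals, the diagonal ones characters. *)
Definition rep_coef b i j (x : U) : K := rep b x (i3 i) (i3 j).

Lemma rep_coef_linear b i j c x y : rep_coef b i j (c *: x + y) = c * rep_coef b i j x + rep_coef b i j y.
Proof. by rewrite /rep_coef rep_linear mxE [X in X + _]mxE. Qed.

Lemma rep_coef_diagM b i x y : (i < 3)%N -> rep_coef b i i (x * y) = rep_coef b i i x * rep_coef b i i y.
Proof.
move=> i3; rewrite /rep_coef repM; have [[v ->] [w ->]] := (rep_tri b x, rep_tri b y).
by rewrite triM !tri_entry //; case: i i3 => [|[|[|i]]].
Qed.

Lemma rep_coef_diag1 b i : (i < 3)%N -> rep_coef b i i 1 = 1.
Proof. by move=> i3; rewrite /rep_coef rep1 tri1 tri_entry //; case: i i3 => [|[|[|i]]]. Qed.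

Lemma rep_coefM b i x y : (i < 2)%N ->
  rep_coef b i 2 (x * y) = rep_coef b i 2 x * rep_coef b 2 2 y + rep_coef b i i x * rep_coef b i 2 y.
Proof.
move=> i2; rewrite /rep_coef repM; have [[v ->] [w ->]] := (rep_tri b x, rep_tri b y).
by rewrite triM !tri_entry ?(ltn_trans i2) //; case: i i2 => [|[|i]] //= _; rewrite addrC.
Qed.

(** Neither entry alone vanishes on the right ideal. Its generators t_12 + t_43 and t_21 + t_34
    couple the two blocks, and the entry -1 in [rmx] makes the sum cancel on them. *)
Definition skewf b (x : U) : K := rep_coef b 0 2 x + rep_coef b 1 2 x.

Lemma skewf_linear b c x y : skewf b (c *: x + y) = c * skewf b x + skewf b y.
Proof. by rewrite /skewf !rep_coef_linear mulrDr addrACA. Qed.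

Lemma skewf1 b : skewf b 1 = 0.
Proof. by rewrite /skewf /rep_coef rep1 tri1 !tri_entry // addr0. Qed.

Lemma skewf_gen b s x : s \in rgens q t -> skewf b (s * x) = 0.
Proof.
move=> sR.
(* The value at s x pairs the first two diagonal entries of s with d and e of x, and d + e of s with
   c of x. The entry c of s does not enter; it may be q^-1 - 1, as for t_11 - t_44. *)
have key : forall v : K * K * K * K * K, rep b s = tri v.1.1.1.1 v.1.1.1.2 v.1.1.2 v.1.2 v.2 ->
    v.1.1.1.1 = 0 -> v.1.1.1.2 = 0 -> v.1.2 + v.2 = 0 -> skewf b (s * x) = 0.
  move=> v se v1 v2 v3; rewrite /skewf /rep_coef repM se; have [w ->] := rep_tri b x.
  by rewrite triM !tri_entry //= v1 v2 !mul0r !add0r -mulrDl v3 mul0r.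
have zero : rep b s = 0 -> skewf b (s * x) = 0.
  by move=> se; apply: (key (0, 0, 0, 0, 0)); rewrite //= ?addr0 // -tri0.
move: sR; rewrite /rgens !inE.
do 8 (case/orP => [/eqP se|]; first by rewrite zero // se repT //; case: (b)).
case/orP => [/eqP se|].
  apply: (key (0, 0, q^-1 - 1, 0, 0)); rewrite //= ?addr0 //.
  rewrite se repB !repT // /rmx /= triN triD; congr tri; ring.
case/orP => [/eqP se|].
  apply: (key (0, 0, 0, b%:R, - b%:R)); rewrite //= ?subrr //.
  rewrite se repD !repT // /rmx; case: (b) => /=; rewrite ?addr0 ?triD; last by rewrite tri0 oppr0.
  by congr tri; rewrite ?addr0 ?add0r.
case/orP => [/eqP se|].
  apply: (key (0, 0, 0, (~~ b)%:R, - (~~ b)%:R)); rewrite //= ?subrr //.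
  rewrite se repD !repT // /rmx; case: (b) => /=; rewrite ?addr0 ?triD; first by rewrite tri0 oppr0.
  by congr tri; rewrite ?addr0 ?add0r.
case/orP => [/eqP se|].
  apply: (key (0, 0, q - 1, 0, 0)); rewrite //= ?addr0 //.
  rewrite se repB !repT // /rmx /= triN triD; congr tri; ring.
move=> /eqP se; apply: (key (0, 0, 0, 0, 0)); rewrite //= ?addr0 // -tri0.
rewrite se !repB repZ !repM !repT // rep1 /rmx; case: (b) => /=;
  rewrite ?mulr0 ?mul0r !scaler0 subr0 triM tri1 triN triD tri0; congr tri; by field.
Qed.

Lemma ideal_R_kill (f : U -> K) : (forall c x y, f (c *: x + y) = c * f x + f y) ->
  (forall s x, s \in rgens q t -> f (s * x) = 0) -> forall u, u \in lspan RI -> f u = 0.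
Proof.
move=> fl fs.
have sub u (A : set U) : (forall a, A a -> f a = 0) -> u \in lspan A -> f u = 0.
  move=> fA /lspanP /(_ [pred x | f x == 0]) P; apply/eqP/P => [|a /fA fa]; last exact/eqP.
  split=> [|c x y]; rewrite !inE.
    by have := fl (-1) 0 0; rewrite scaler0 addr0 mulN1r addNr => ->.
  by move=> /eqP fx /eqP fy; rewrite fl fx fy mulr0 addr0.
(* [RI] is a span already, so the argument runs twice. *)
by move=> u; apply: (sub) => a; apply: (sub) => _ [s [x [sR ->]]]; exact: fs.
Qed.

Lemma skewf_R b u : u \in lspan RI -> skewf b u = 0.
Proof. exact/ideal_R_kill/skewf_gen/skewf_linear. Qed.
End Operators.

(** * Relations in the 7-sphere *)

(* Position of a letter in the order z_1 < z_2 < z_3 < z_1^* < z_2^* < z_3^* < z_4 < z_4^*;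
   the letters 0, 1, 2, 3 stand for the z_i, and 4, 5, 6, 7 for the z_i^*. *)
Definition zpos (a : nat) : nat := nth 0 [:: 0; 1; 2; 6; 3; 4; 5; 7]%N a.

(** The value of z_4 z_4^* for e = 0 and of z_4^* z_4 for e = 2. *)
Definition zsum (e : int) : qpoly := [:: ((Posz 1, Posz 0), [::]); ((Negz 0, e), [:: 0; 4]%N);
  ((Negz 0, e), [:: 1; 5]%N); ((Negz 0, e), [:: 2; 6]%N)].

(** In the order [zpos] the letters z_4 and z_4^* come last and are therefore adjacent in a sorted
    word, where the unit relation eliminates their product. *)
Definition zrule (a b : nat) : option qpoly :=
  if ~~ ((a < 8)%N && (b < 8)%N) then None
  else if (a == 3)%N && (b == 7)%N then Some (zsum (Posz 0))
  else if (a == 7)%N && (b == 3)%N then Some (zsum (Posz 2))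
  else if (zpos a <= zpos b)%N then None
  else if (a < 4)%N then Some [:: ((Posz 1, Negz 0), [:: b; a])]
  else if (4 <= b)%N || (a != b + 4)%N then Some [:: ((Posz 1, Posz 1), [:: b; a])]
  else Some (((Posz 1, Posz 0), [:: b; a]) ::
    flatten [seq [:: ((Posz 1, Posz 0), [:: m; m + 4]%N); ((Negz 0, Posz 2), [:: m; m + 4]%N)] | m <- iota 0 b]).

Definition znull := qnull zrule 60.

Definition zl := qletter.
Definition zz a b := qmul (zl a) (zl b).
Definition zR := zz 0 4 ++ zz 1 5.
Definition za := qsub (zz 0 7) (zz 1 6).
Definition zas := qsub (zz 3 4) (zz 2 5).
Definition zb := zz 0 2 ++ qscale 1 (Negz 0) (zz 1 3).
Definition zbs := zz 6 4 ++ qscale 1 (Negz 0) (zz 7 5).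

Lemma zrel_Ra : znull (qsub (qmul zR za) (qscale 1 (Negz 1) (qmul za zR))).
Proof. by vm_compute. Qed.
Lemma zrel_Ras : znull (qsub (qmul zR zas) (qscale 1 2 (qmul zas zR))).
Proof. by vm_compute. Qed.
Lemma zrel_Rb : znull (qsub (qmul zR zb) (qscale 1 2 (qmul zb zR))).
Proof. by vm_compute. Qed.
Lemma zrel_Rbs : znull (qsub (qmul zR zbs) (qscale 1 (Negz 1) (qmul zbs zR))).
Proof. by vm_compute. Qed.
Lemma zrel_ab : znull (qsub (qmul za zb) (qscale 1 3 (qmul zb za))).
Proof. by vm_compute. Qed.
Lemma zrel_abs : znull (qsub (qmul za zbs) (qscale 1 (Negz 0) (qmul zbs za))).
Proof. by vm_compute. Qed.
Lemma zrel_aasbbs : znull (qsub (qmul za zas ++ qscale 1 2 (qmul zb zbs))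
  (qmul zR (qsub (qconst 1 0) (qscale 1 2 zR)))).
Proof. by vm_compute. Qed.
Lemma zrel_aas : znull (qsub (qmul za zas)
  (qscale 1 2 (qmul zas za) ++ qsub (qmul zR zR) (qscale 1 2 (qmul zR zR)))).
Proof. by vm_compute. Qed.
Lemma zrel_bsb : znull (qsub (qmul zbs zb) (qscale 1 4 (qmul zb zbs) ++ qsub zR (qscale 1 2 zR))).
Proof. by vm_compute. Qed.

Lemma zrel_Rz : all (fun m : nat * int => znull (qsub (qmul zR (zl m.1)) (qscale 1 m.2 (qmul (zl m.1) zR))))
  [:: (0%N, Posz 0); (1%N, Posz 0); (2%N, Posz 2); (3%N, Posz 2); (4%N, Posz 0); (5%N, Posz 0);
      (6%N, Negz 1); (7%N, Negz 1)].
Proof. by vm_compute. Qed.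

(** At q = 1: where R != 0, the pair (z_3, z_4) is determined by (z_1, z_2) and the point of the
    4-sphere. Each table entry pairs a letter with the value of R times it. *)
Lemma zrel_out1 : all (fun m : nat * qpoly => znull (qsub (qmul zR (zl m.1)) m.2))
  [:: (2%N, qscale (Negz 0) 2 (qmul zas (zl 1)) ++ qscale 1 3 (qmul zb (zl 4)));
      (3%N, qscale 1 2 (qmul zas (zl 0)) ++ qscale 1 2 (qmul zb (zl 5)));
      (6%N, qscale (Negz 0) (Negz 0) (qmul za (zl 5)) ++ qscale 1 (Negz 1) (qmul zbs (zl 0)));
      (7%N, qscale 1 1 (qmul za (zl 4)) ++ qscale 1 (Negz 0) (qmul zbs (zl 1)))].
Proof. by vm_compute. Qed.

(** The counterpart for the chart R != 1, where 1 - q^2 R takes the place of R. *)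
Lemma zrel_out2 : all (fun m : nat * qpoly => znull (qsub (qsub (zl m.1) (qscale 1 2 (qmul zR (zl m.1)))) m.2))
  [:: (0%N, qscale 1 0 (qmul za (zl 3)) ++ qscale 1 2 (qmul zb (zl 6)));
      (1%N, qscale (Negz 0) 0 (qmul za (zl 2)) ++ qscale 1 1 (qmul zb (zl 7)));
      (4%N, qscale 1 1 (qmul zas (zl 7)) ++ qscale 1 (Negz 0) (qmul zbs (zl 2)));
      (5%N, qscale (Negz 0) 3 (qmul zas (zl 6)) ++ qscale 1 0 (qmul zbs (zl 3)))].
Proof. by vm_compute. Qed.

Section Relations.
Context {K : numClosedFieldType} (q : K) (U : hopfStarAlg K) (t : 'I_4 -> 'I_4 -> U) (Dinv : U).
Hypotheses (q0 : q != 0) (qR : q^* = q) (hU : is_Uq4 q t Dinv).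
Local Notation Z := (zcoord t).
Local Notation Zs := (zstar t).

Definition zletter (a : nat) : U := if (a < 4)%N then Z a else Zs (a - 4).
Local Notation ev := (qeval q zletter).

Lemma Z_Zr i j : (i < j < 4)%N -> Z j * Z i = q^-1 *: (Z i * Z j).
Proof. by move=> ij; rewrite (Z_Z hU ij) scalerA mulVf ?scale1r. Qed.

Lemma Z_Zs i j : (i < 4)%N -> (j < 4)%N -> i != j -> Z i * Zs j = q^-1 *: (Zs j * Z i).
Proof. by move=> i4 j4 ij; rewrite (Zs_Z q0 hU) // scalerA mulVf ?scale1r. Qed.

Lemma zsumE e : ev (zsum e) = 1 - q ^ e *: (Z 0 * Zs 0 + Z 1 * Zs 1 + Z 2 * Zs 2).
Proof.
rewrite /zsum !qeval_cons /qeval big_nil /qword !big_cons !big_nil /qcoef /zletter /= !mulr1 addr0.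
by rewrite !mulN1r !scaleNr scale1r !scalerDr !opprD !addrA.
Qed.

Lemma zruleP a b r : zrule a b = Some r -> zletter a * zletter b = ev r.
Proof.
have one e a' b' : ev [:: ((Posz 1, e), [:: a'; b'])] = q ^ e *: (zletter a' * zletter b').
  by rewrite qeval_cons /qeval big_nil /qword !big_cons big_nil /qcoef /= !mulr1 mul1r addr0.
rewrite /zrule; case: ifP => // /negbFE /andP[a8 b8].
have sZZ : Z 3 * Zs 3 = 1 - (Z 0 * Zs 0 + Z 1 * Zs 1 + Z 2 * Zs 2).
  by rewrite -(sum_ZZs hU) !big_ord_recr big_ord0 /= add0r addrC addrK.
case: ifP => [/andP[/eqP-> /eqP->] [<-]|n37]; first by rewrite zsumE expr0z scale1r.
case: ifP => [/andP[/eqP-> /eqP->] [<-]|n73].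
  rewrite zsumE /zletter /= (ZsZ q0 hU) // !big_ord_recr big_ord0 /= add0r sZZ -exprnP.
  by rewrite scalerBl scale1r addrA subrK.
case: ifP => // /negbT; rewrite -ltnNge => ab; case: ifP => [a4|a4].
  case=> <-; rewrite one; have [b4|b4] := ltnP b 4.
    rewrite /zletter a4 b4; apply: Z_Zr; rewrite a4 andbT.
    by move: a b a4 b4 ab {a8 b8 n37 n73} => [|[|[|[|]]]] // [|[|[|[|]]]].
  have [a3 b7] : a = 3%N /\ (b < 7)%N.
    by move: a b a4 b4 ab b8 n37 {a8 n73} => [|[|[|[|]]]] // [|[|[|[|[|[|[|[|]]]]]]]].
  rewrite /zletter a4 ltnNge b4 /= (Zs_Z q0 hU) ?scalerA ?mulVf ?scale1r //; first by lia.
  by rewrite a3; lia.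
have a4' : (4 <= a)%N by rewrite leqNgt a4.
case: ifP => [ne [<-]|].
  rewrite one; have [b4|b4] := ltnP b 4.
    move: ne; rewrite leqNgt b4 /= => ne; rewrite /zletter a4 b4; apply: (Zs_Z q0 hU); lia.
  rewrite /zletter a4 ltnNge b4 /=; apply: (Zs_Zs qR hU).
  have : (b < a)%N.
    by move: a b a4' b4 ab b8 a8 {a4 ne n37 n73} => [|[|[|[|[|[|[|[|]]]]]]]] // [|[|[|[|[|[|[|[|]]]]]]]].
  lia.
move=> /negbT; rewrite negb_or -ltnNge negbK => /andP[b4 /eqP aE] [<-].
have b3 : (b < 3)%N by move: b b4 aE n73 {ab b8 n37} => [|[|[|[|]]]] // _ ->.
have word2 c m : qcoef q c *: qword zletter [:: m; m + 4]%N = qcoef q c *: (zletter m * zletter (m + 4)).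
  by rewrite /qword !big_cons big_nil mulr1.
have zm m : (m < 4)%N -> zletter m * zletter (m + 4) = Z m * Zs m by move=> m4; rewrite /zletter m4 ltnNge leq_addl addnK.
have -> : zletter a * zletter b = Zs b * Z b by rewrite aE /zletter b4 ltnNge leq_addl addnK.
rewrite (ZsZ q0 hU) // -cat1s qeval_cat aE one expr0z scale1r (zm b) //; congr (_ + _).
have fl n : (n <= 4)%N -> (1 - q ^+ 2) *: (\sum_(j < n) Z j * Zs j) = ev (flatten [seq
    [:: ((Posz 1, Posz 0), [:: m; m + 4]%N); ((Negz 0, Posz 2), [:: m; m + 4]%N)] | m <- iota 0 n]).
  elim: n => [|n IH] n4; first by rewrite big_ord0 scaler0 /qeval big_nil.
  have -> : iota 0 n.+1 = iota 0 n ++ [:: n] by rewrite -addn1 iotaD.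
  rewrite map_cat flatten_cat qeval_cat -IH ?(ltnW n4) // big_ord_recr scalerDr.
  congr (_ + _); rewrite /= !qeval_cons /qeval big_nil !word2 zm // addr0 -scalerDl.
  by rewrite /qcoef /= mulr1 mulN1r.
by apply: fl; rewrite ltnW.
Qed.

Lemma znull_eq p r : znull (qsub p r) -> ev p = ev r.
Proof. exact: (qnull_eq q0 zruleP). Qed.

Lemma ev_zl a : ev (zl a) = zletter a.
Proof. exact: qeval_letter. Qed.

Lemma ev_qscale1 e p : ev (qscale 1 e p) = q ^ e *: ev p.
Proof. by rewrite qevalZ // mul1r. Qed.
Lemma ev_qscaleN e p : ev (qscale (Negz 0) e p) = - q ^ e *: ev p.
Proof. by rewrite qevalZ // mulN1r. Qed.

Definition sphere_r := Z 0 * Zs 0 + Z 1 * Zs 1.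
Definition sphere_a := Z 0 * Zs 3 - Z 1 * Zs 2.
Definition sphere_as := Z 3 * Zs 0 - Z 2 * Zs 1.
Definition sphere_b := Z 0 * Z 2 + q^-1 *: (Z 1 * Z 3).
Definition sphere_bs := Zs 2 * Zs 0 + q^-1 *: (Zs 3 * Zs 1).

Lemma ev_zR : ev zR = sphere_r.
Proof. by rewrite qeval_cat !qevalM // !ev_zl. Qed.
Lemma ev_za : ev za = sphere_a.
Proof. by rewrite qevalB // !qevalM // !ev_zl. Qed.
Lemma ev_zas : ev zas = sphere_as.
Proof. by rewrite qevalB // !qevalM // !ev_zl. Qed.
Lemma ev_zb : ev zb = sphere_b.
Proof. by rewrite qeval_cat ev_qscale1 !qevalM // !ev_zl. Qed.
Lemma ev_zbs : ev zbs = sphere_bs.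
Proof. by rewrite qeval_cat ev_qscale1 !qevalM // !ev_zl. Qed.

Lemma Ra : sphere_r * sphere_a = q ^- 2 *: (sphere_a * sphere_r).
Proof. by have := znull_eq zrel_Ra; rewrite ev_qscale1 !qevalM // ev_zR ev_za. Qed.
Lemma Ras : sphere_r * sphere_as = q ^+ 2 *: (sphere_as * sphere_r).
Proof. by have := znull_eq zrel_Ras; rewrite ev_qscale1 !qevalM // ev_zR ev_zas. Qed.
Lemma Rb : sphere_r * sphere_b = q ^+ 2 *: (sphere_b * sphere_r).
Proof. by have := znull_eq zrel_Rb; rewrite ev_qscale1 !qevalM // ev_zR ev_zb. Qed.
Lemma Rbs : sphere_r * sphere_bs = q ^- 2 *: (sphere_bs * sphere_r).
Proof. by have := znull_eq zrel_Rbs; rewrite ev_qscale1 !qevalM // ev_zR ev_zbs. Qed.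
Lemma aabb : sphere_a * sphere_b = q ^+ 3 *: (sphere_b * sphere_a).
Proof. by have := znull_eq zrel_ab; rewrite ev_qscale1 !qevalM // ev_zb ev_za. Qed.
Lemma aabbs : sphere_a * sphere_bs = q^-1 *: (sphere_bs * sphere_a).
Proof. by have := znull_eq zrel_abs; rewrite ev_qscale1 !qevalM // ev_zbs ev_za. Qed.
Lemma aaas_bbbs : sphere_a * sphere_as + q ^+ 2 *: (sphere_b * sphere_bs) = sphere_r * (1 - q ^+ 2 *: sphere_r).
Proof.
have := znull_eq zrel_aasbbs; rewrite qeval_cat ev_qscale1 !qevalM // qevalB // ev_qscale1 qeval_const.
by rewrite expr0z mulr1 scale1r ev_zR ev_za ev_zas ev_zb ev_zbs.
Qed.
Lemma aaas : sphere_a * sphere_as = q ^+ 2 *: (sphere_as * sphere_a) + (1 - q ^+ 2) *: sphere_r ^+ 2.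
Proof.
have := znull_eq zrel_aas; rewrite qeval_cat qevalB // !ev_qscale1 !qevalM // ev_zR ev_za ev_zas => ->.
by rewrite scalerBl scale1r.
Qed.
Lemma bbsbb : sphere_bs * sphere_b = q ^+ 4 *: (sphere_b * sphere_bs) + (1 - q ^+ 2) *: sphere_r.
Proof.
have := znull_eq zrel_bsb; rewrite qeval_cat qevalB // !ev_qscale1 !qevalM // ev_zR ev_zb ev_zbs => ->.
by rewrite scalerBl scale1r.
Qed.

Lemma Rr_letter a : (a < 8)%N -> exists2 c, c != 0 & sphere_r * zletter a = c *: (zletter a * sphere_r).
Proof.
move=> a8; have [m ma mR] : exists2 m : nat * int, m.1 = a &
    znull (qsub (qmul zR (zl m.1)) (qscale 1 m.2 (qmul (zl m.1) zR))).
  exists (nth (0%N, Posz 0) [:: (0%N, Posz 0); (1%N, Posz 0); (2%N, Posz 2); (3%N, Posz 2);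
    (4%N, Posz 0); (5%N, Posz 0); (6%N, Negz 1); (7%N, Negz 1)] a).
    by move: a a8 => [|[|[|[|[|[|[|[|]]]]]]]].
  exact: (all_nthP (0%N, Posz 0) zrel_Rz).
exists (q ^ m.2); [exact: expfz_neq0 | have := znull_eq mR].
by rewrite ev_qscale1 !qevalM // ev_zR ev_zl ma.
Qed.

(* Localized at sphere_r, respectively at polynomials in sphere_r with constant term 1, the algebra is
   generated by coinvariants and by the letters of one chart. *)
Lemma Rr_outer1 a : a \in [:: 2; 3; 6; 7]%N -> exists c1 c2 i j,
  [/\ i \in [:: 0; 1; 4; 5]%N, j \in [:: 0; 1; 4; 5]%N &
   exists g1 g2, [/\ g1 \in [:: sphere_a; sphere_as; sphere_b; sphere_bs], g2 \in [:: sphere_a; sphere_as; sphere_b; sphere_bs] &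
   sphere_r * zletter a = c1 *: (g1 * zletter i) + c2 *: (g2 * zletter j)]].
Proof.
rewrite !inE; have := zrel_out1; rewrite /all => /and5P[h2 h3 h6 h7 _].
case/or4P => /eqP ->.
- exists (- q ^+ 2), (q ^+ 3), 1%N, 4%N; split=> //; exists sphere_as, sphere_b; rewrite !inE !eqxx ?orbT; split=> //.
  by have := znull_eq h2; cbn [fst snd]; rewrite [X in _ = X -> _]qeval_cat ev_qscaleN ev_qscale1 !qevalM // !ev_zl ev_zR ev_zas ev_zb.
- exists (q ^+ 2), (q ^+ 2), 0%N, 5%N; split=> //; exists sphere_as, sphere_b; rewrite !inE !eqxx ?orbT; split=> //.
  by have := znull_eq h3; cbn [fst snd]; rewrite [X in _ = X -> _]qeval_cat !ev_qscale1 !qevalM // !ev_zl ev_zR ev_zas ev_zb.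
- exists (- q^-1), (q ^- 2), 5%N, 0%N; split=> //; exists sphere_a, sphere_bs; rewrite !inE !eqxx ?orbT; split=> //.
  by have := znull_eq h6; cbn [fst snd]; rewrite [X in _ = X -> _]qeval_cat ev_qscaleN ev_qscale1 !qevalM // !ev_zl ev_zR ev_za ev_zbs.
- exists q, (q^-1), 4%N, 1%N; split=> //; exists sphere_a, sphere_bs; rewrite !inE !eqxx ?orbT; split=> //.
  by have := znull_eq h7; cbn [fst snd]; rewrite [X in _ = X -> _]qeval_cat !ev_qscale1 !qevalM // !ev_zl ev_zR ev_za ev_zbs.
Qed.

Lemma Rr_outer2 a : a \in [:: 0; 1; 4; 5]%N -> exists c1 c2 i j,
  [/\ i \in [:: 2; 3; 6; 7]%N, j \in [:: 2; 3; 6; 7]%N &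
   exists g1 g2, [/\ g1 \in [:: sphere_a; sphere_as; sphere_b; sphere_bs], g2 \in [:: sphere_a; sphere_as; sphere_b; sphere_bs] &
   (1 - q ^+ 2 *: sphere_r) * zletter a = c1 *: (g1 * zletter i) + c2 *: (g2 * zletter j)]].
Proof.
rewrite !inE; have := zrel_out2; rewrite /all => /and5P[h0 h1 h4 h5 _].
case/or4P => /eqP ->; rewrite mulrBl mul1r -scalerAl.
- exists 1, (q ^+ 2), 3%N, 6%N; split=> //; exists sphere_a, sphere_b; rewrite !inE !eqxx ?orbT; split=> //.
  by have := znull_eq h0; cbn [fst snd]; rewrite [X in _ = X -> _]qeval_cat qevalB // !ev_qscale1 !qevalM // !ev_zl ev_zR ev_za ev_zb.
- exists (-1), q, 2%N, 7%N; split=> //; exists sphere_a, sphere_b; rewrite !inE !eqxx ?orbT; split=> //.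
  by have := znull_eq h1; cbn [fst snd]; rewrite [X in _ = X -> _]qeval_cat qevalB // ev_qscaleN !ev_qscale1 !qevalM // !ev_zl ev_zR ev_za ev_zb.
- exists q, (q^-1), 7%N, 2%N; split=> //; exists sphere_as, sphere_bs; rewrite !inE !eqxx ?orbT; split=> //.
  by have := znull_eq h4; cbn [fst snd]; rewrite [X in _ = X -> _]qeval_cat qevalB // !ev_qscale1 !qevalM // !ev_zl ev_zR ev_zas ev_zbs.
- exists (- q ^+ 3), 1, 6%N, 3%N; split=> //; exists sphere_as, sphere_bs; rewrite !inE !eqxx ?orbT; split=> //.
  by have := znull_eq h5; cbn [fst snd]; rewrite [X in _ = X -> _]qeval_cat qevalB // ev_qscaleN !ev_qscale1 !qevalM // !ev_zl ev_zR ev_zas ev_zbs.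
Qed.
End Relations.

(** * The two charts *)

Section Torus.
Context {K : numClosedFieldType} (q : K) (U : hopfStarAlg K) (t : 'I_4 -> 'I_4 -> U) (Dinv : U).
Hypotheses (q0 : q != 0) (hU : is_Uq4 q t Dinv).
Local Notation T := (tgen t).
Local Notation S := (ST t).

(** The diagonal characters killing the right ideal have values s, s^-1, s^-1, s, by t_11 = t_44,
    t_22 = t_33 and t_11 t_22 = 1; s = 2 serves as a scalar of infinite order. *)
Definition tval (i : nat) : K := nth 0 [:: 2; 2^-1; 2^-1; 2] i.

Lemma tval_neq0 i : (i < 4)%N -> tval i != 0.
Proof. by move: i => [|[|[|[|]]]] // _; rewrite ?invr_neq0 // pnatr_eq0. Qed.

Lemma torus_exists : exists f : U -> K^o, [/\ f 1 = 1, forall c x y, f (c *: x + y) = c * f x + f y,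
  forall x y, f (x * y) = f x * f y,
  forall i j, (i < 4)%N -> (j < 4)%N -> f (T i j) = (i == j)%:R * tval i &
  (forall i j, (i < 4)%N -> (j < 4)%N -> f (S i j) = (i == j)%:R * (tval i)^-1) /\
  (forall s x, s \in rgens q t -> f (s * x) = 0)].
Proof.
pose M (i j : nat) : K^o := (i == j)%:R * tval i.
have M0 i j : (i != j) -> M i j = 0 by rewrite /M => /negbTE ->; rewrite mul0r.
have [||||||f [f1 fl fM fT _]] := @Uq4_lift _ q _ _ _ hU _ M 1.
- move=> i j k /andP[ij j4] k4; have [ik|ik] := eqVneq i k; last by rewrite M0 // mul0r mulr0 scaler0.
  by rewrite (M0 j) ?mul0r ?mulr0 ?scaler0 // -ik neq_ltn ij orbT.
- move=> i j k /andP[ij j4] k4; have [ik|ik] := eqVneq k i; last by rewrite M0 // mul0r mulr0 scaler0.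
  by rewrite (M0 k j) ?mul0r ?mulr0 ?scaler0 // ik neq_ltn ij.
- by move=> i j k l _ _; exact: mulrC.
- move=> i j k l /andP[ij j4] /andP[kl l4]; rewrite mulrC subrr.
  have [jk|jk] := eqVneq j k; last by rewrite M0 // mul0r scaler0.
  rewrite (M0 i l) ?mulr0 ?scaler0 //; lia.
- rewrite mulr1 !lapdet_hook; first last.
  - by left=> i _; exact: M0.
  - by left=> i _; exact: M0.
  - by left=> i _; exact: M0.
  - by left=> i _; exact: M0.
  rewrite /M /= /tval /= !mul1r mulr1 mulrA mulfV ?mul1r ?mulVf // pnatr_eq0 //.
- rewrite mul1r !lapdet_hook; first last.
  - by left=> i _; exact: M0.
  - by left=> i _; exact: M0.
  - by left=> i _; exact: M0.
  - by left=> i _; exact: M0.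
  rewrite /M /= /tval /= !mul1r mulr1 mulrA mulfV ?mul1r ?mulVf // pnatr_eq0 //.
have f0 : f 0 = 0 by have := fl (-1) 0 0; rewrite scaler0 addr0 scaleN1r addNr.
have fD x y : f (x + y) = f x + f y by have := fl 1 x y; rewrite !scale1r.
have fZ c x : f (c *: x) = c *: f x by have := fl c x 0; rewrite f0 !addr0.
have fB x y : f (x - y) = f x - f y by rewrite -scaleN1r fD fZ scaleN1r.
exists f; split=> //; split=> [i j i4 j4|s x sR].
  have fsum (F : 'I_4 -> U) : f (\sum_(k < 4) F k) = \sum_(k < 4) f (F k).
    by elim/big_ind2: _ => [|x1 x2 y1 y2 <- <-|//]; rewrite ?f0 ?fD.
  have := congr1 f (T_ST hU i4 j4); rewrite fsum (bigD1 (Ordinal i4)) //= big1 => [|k].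
    rewrite addr0 fM fT // /M eqxx mul1r => e; apply: (mulfI (tval_neq0 i4)).
    by rewrite e; case: (i == j); rewrite ?f1 ?f0 ?mul1r ?mul0r ?mulr0 ?mulfV ?tval_neq0.
  by rewrite -val_eqE /= => ki; rewrite fM fT // M0 ?mul0r // eq_sym.
rewrite fM; suff -> : f s = 0 by rewrite mul0r.
move: sR; rewrite !inE.
have two : (2 : K) != 0 by rewrite pnatr_eq0.
do 8 (case/orP => [/eqP ->|]; first by rewrite fT // M0).
do 4 (case/orP => [/eqP ->|]; first by rewrite ?fB ?fD !fT // /M /tval /= ?mul0r ?addr0 ?mul1r ?subrr).
move=> /eqP ->; rewrite !fB fZ !fM !fT // /M /tval /= !mul1r !mul0r scaler0 subr0 mulfV // f1 subrr //.
Qed.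
End Torus.

Section Letters.
Context {K : numClosedFieldType} (q : K) (U : hopfStarAlg K) (t : 'I_4 -> 'I_4 -> U) (Dinv : U).
Hypotheses (q0 : q != 0) (qR : q^* = q) (hU : is_Uq4 q t Dinv).
Local Notation T := (tgen t).
Local Notation S := (ST t).
Local Notation Z := (zcoord t).
Local Notation Zs := (zstar t).

Lemma oper_Z (f : U -> K) i : (forall c u v, f (c *: u + v) = c * f u + f v) ->
  oper f (Z i) = f (T 0 i) *: Z 0 + f (T 1 i) *: Z 1 + f (T 2 i) *: Z 2 + f (T 3 i) *: Z 3.
Proof.
move=> fl; rewrite (operE fl (r := index_enum 'I_4) (Delta_Z hU i)) !big_ord_recr big_ord0 /=.
by rewrite add0r.
Qed.

Lemma oper_Zs (f : U -> K) i : (forall c u v, f (c *: u + v) = c * f u + f v) ->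
  oper f (Zs i) = f (S i 0) *: Zs 0 + f (S i 1) *: Zs 1 + f (S i 2) *: Zs 2 + f (S i 3) *: Zs 3.
Proof.
move=> fl; rewrite (operE fl (r := index_enum 'I_4) (Delta_Zs hU i)) !big_ord_recr big_ord0 /=.
by rewrite add0r.
Qed.
End Letters.

(** Even powers of a real number are nonnegative and the first one is 1, so the sum is positive
    whatever the sign of al. *)
Lemma qn_real_neq0 (K : numClosedFieldType) (al : K) n : al \is Num.real -> qn al n.+1 != 0.
Proof.
move=> alR; rewrite /qn big_ord_recl expr0 lt0r_neq0 // ltr_pwDl //.
by apply: sumr_ge0 => s _; rewrite exprM exprn_ge0 // real_exprn_even_ge0.
Qed.

Section Charts.
Context {K : numClosedFieldType} (q : K) (U : hopfStarAlg K) (t : 'I_4 -> 'I_4 -> U) (Dinv : U).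
Hypotheses (q0 : q != 0) (qR : q^* = q) (hU : is_Uq4 q t Dinv).
Local Notation Z := (zcoord t).
Local Notation Zs := (zstar t).
Local Notation RI := (ideal_R q t).
Local Notation repe := (rep_coef q0 hU).
Local Notation Xf := (skewf q0 hU).
Local Notation op b i j := (oper (repe b i j)).
Local Notation X b := (oper (Xf b)).

Lemma X_op b x : X b x = op b 0 2 x + op b 1 2 x.
Proof.
rewrite (oper_expansion (skewf_linear q0 hU b)) !(oper_expansion (rep_coef_linear q0 hU _ _ _)) -big_split.
by apply: eq_bigr => p _; rewrite /skewf scalerDl.
Qed.

Lemma op_diagM b i x y : (i < 3)%N -> op b i i (x * y) = op b i i x * op b i i y.
Proof.
move=> i3; apply: oper_charM; [exact: rep_coef_linear | move=> u v; exact: rep_coef_diagM].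
Qed.

Lemma op_diag1 b i : (i < 3)%N -> op b i i 1 = 1.
Proof. by move=> i3; apply: oper_char1; [exact: rep_coef_linear | exact: rep_coef_diag1]. Qed.

Lemma op_skewM b i x y : (i < 2)%N ->
  op b i 2 (x * y) = op b i 2 x * op b 2 2 y + op b i i x * op b i 2 y.
Proof.
move=> i2; rewrite (operM (s := [:: true; false]) (g := fun c => if c then repe b i 2 else repe b i i)
  (h := fun c => if c then repe b 2 2 else repe b i 2)).
- by rewrite !big_cons big_nil addr0.
- exact: rep_coef_linear.
- by case; exact: rep_coef_linear.
- by case; exact: rep_coef_linear.
- by move=> u v; rewrite !big_cons big_nil addr0; exact: rep_coefM.
Qed.

Lemma op_skew1 b i : (i < 2)%N -> op b i 2 1 = 0.
Proof.
move=> i2; have := op_skewM b 1 1 i2; rewrite op_diag1 // op_diag1 ?(ltn_trans i2) // !mulr1 mul1r.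
by move=> e; apply: (addrI (op b i 2 1)); rewrite addr0 -e.
Qed.

(* On chart number i only the i-th of the two skew primitive functionals acts. *)
Definition chart i (x : U) :=
  [/\ forall b, op b (1 - i) 2 x = 0, op false 2 2 x = op true 2 2 x & op false i i x = op true i i x].

Lemma chart1 i : (i < 2)%N -> chart i 1.
Proof.
move=> i2; split=> [b||]; rewrite ?op_diag1 ?(ltn_trans i2) // op_skew1 //; lia.
Qed.

Lemma chartM i x y : (i < 2)%N -> chart i x -> chart i y -> chart i (x * y).
Proof.
move=> i2 [x1 x2 x3] [y1 y2 y3]; split=> [b||].
- rewrite op_skewM ?x1 ?y1 ?mul0r ?mulr0 ?addr0 //; lia.
- by rewrite !op_diagM // x2 y2.
- by rewrite !op_diagM ?x3 ?y3 // (ltn_trans i2).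
Qed.

Lemma X_chart b i x : (i < 2)%N -> chart i x -> X b x = op b i 2 x.
Proof.
by move: i => [|[|]] // _ [x1 _ _]; rewrite X_op; have := x1 b; rewrite /= => ->; rewrite ?addr0 ?add0r.
Qed.

Lemma X_chartM b i x y : (i < 2)%N -> chart i x -> chart i y ->
  X b (x * y) = X b x * op true 2 2 y + op true i i x * X b y.
Proof.
move=> i2 cx cy; rewrite !(X_chart b i2) //; last exact: chartM.
rewrite op_skewM //; have [_ y2 _] := cy; have [_ _ x3] := cx.
by case: b => //; rewrite y2 x3.
Qed.

(** Evaluates an operator on a single letter by reading off the entries of [rmx] and [rmxV]. *)
Ltac letter := rewrite ?(oper_Z hU) ?(oper_Zs hU); try (by move=> *; exact: rep_coef_linear);
  rewrite /rep_coef !(repT, repS) // /rmx /rmxV /= !(tri_entry, mxE) //= ?(scale0r, addr0, add0r, scale1r).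

Definition chart_idx (c : bool) : nat := if c then 1 else 0.
(** The second chart lists its coordinates in reverse, since the right ideal pairs t_43 with t_12; u
    is always the image of v under the raising operator. *)
Definition chart_u c := if c then Z 3 else Z 0.
Definition chart_v c := if c then Z 2 else Z 1.
Definition chart_w c := if c then Zs 3 else Zs 0.
Definition chart_x c := if c then Zs 2 else Zs 1.
Definition chart_al c := if c then q else q^-1.
Definition chart_et c := if c then q^-1 else 1.
(** Compensates the entry -1 of [rmx], so that both charts obey the same formulas. *)
Definition chart_sg c : K := if c then -1 else 1.

Lemma cidx2 c : (chart_idx c < 2)%N. Proof. by case: c. Qed.

Ltac cletter c := case: c; rewrite /chart_u /chart_v /chart_w /chart_x /chart_al /chart_et /chart_idx; letter.

Lemma chart_letter c x : x \in [:: chart_u c; chart_v c; chart_w c; chart_x c] -> chart (chart_idx c) x.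
Proof.
by rewrite !inE => /or4P[] /eqP ->; split=> [b||]; try case: b; cletter c.
Qed.

Lemma cletter_K c : [/\ op true 2 2 (chart_u c) = (chart_et c * chart_al c) *: chart_u c,
  op true 2 2 (chart_v c) = (chart_et c * chart_al c)^-1 *: chart_v c, op true 2 2 (chart_w c) = (chart_et c * chart_al c)^-1 *: chart_w c &
  op true 2 2 (chart_x c) = (chart_et c * chart_al c) *: chart_x c].
Proof.
by split; cletter c; rewrite ?mulVf ?mul1r ?invr1 ?invrK ?scale1r.
Qed.

Lemma cletter_G c : let g := op true (chart_idx c) (chart_idx c) in
  [/\ g (chart_u c) = chart_et c *: chart_u c, g (chart_v c) = (chart_et c)^-1 *: chart_v c,
    g (chart_w c) = (chart_et c)^-1 *: chart_w c & g (chart_x c) = chart_et c *: chart_x c].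
Proof.
by split; cletter c; rewrite ?invr1 ?invrK ?scale1r.
Qed.

Definition Eop c x := chart_sg c *: X true x.
Definition Fop c x := chart_sg c *: X false x.

Lemma cletter_E c : [/\ Eop c (chart_u c) = 0, Eop c (chart_v c) = chart_u c, Eop c (chart_w c) = - chart_al c *: chart_x c & Eop c (chart_x c) = 0].
Proof.
split; rewrite /Eop (X_chart _ (cidx2 c)); try (by apply: chart_letter; rewrite !inE eqxx ?orbT);
  cletter c; rewrite /chart_sg ?scaler0 ?scalerA ?mulr1 ?mulN1r ?mul1r ?opprK ?scale1r //.
Qed.

Lemma cletter_F c : [/\ Fop c (chart_u c) = chart_v c, Fop c (chart_v c) = 0, Fop c (chart_w c) = 0 & Fop c (chart_x c) = - (chart_al c)^-1 *: chart_w c].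
Proof.
split; rewrite /Fop (X_chart _ (cidx2 c)); try (by apply: chart_letter; rewrite !inE eqxx ?orbT);
  cletter c; rewrite /chart_sg ?scaler0 ?scalerA ?mulr1 ?mulN1r ?mul1r ?opprK ?invrK ?scale1r //.
Qed.

Variable A : U -> Prop.
Hypotheses (A1 : A 1) (AZD : forall c x y, A x -> A y -> A (c *: x + y)).
Hypotheses (AM : forall x y, A x -> A y -> A (x * y)).
Hypotheses (Aco : forall x, A x -> rcoinv RI x).

Lemma X_A b a x : A a -> X b (a * x) = a * X b x.
Proof.
move=> Aa; apply: oper_coinvM (Aco Aa); [exact: skewf_linear | exact: R_closed | exact: skewf_R].
Qed.

Lemma X_coinv b x : rcoinv RI x -> X b x = 0.
Proof.
move=> cx; rewrite (oper_coinv _ _ _ cx) ?skewf1 ?scale0r //; [exact: skewf_linear | exact: R_closed | exact: skewf_R].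
Qed.

Lemma skew_X c b (k g : {rmorphism U -> U}) : (forall x, k x = op true 2 2 x) -> (forall x, g x = op true (chart_idx c) (chart_idx c) x) ->
  skew_derivation A (chart (chart_idx c)) k g (fun x => chart_sg c *: X b x).
Proof.
move=> kE gE; split=> [x y|d x|a x Aa|x y cx cy].
- by rewrite operD ?scalerDr //; exact: skewf_linear.
- by rewrite operZ ?scalerA 1?mulrC -?scalerA //; exact: skewf_linear.
- by rewrite X_A // scalerAr.
- by rewrite (X_chartM _ (cidx2 c)) // kE gE scalerDr scalerAl scalerAr.
Qed.

Lemma cal_real c : chart_al c \is Num.real.
Proof. have qr : q \is Num.real by rewrite CrealE qR. by case: c; rewrite /chart_al ?realV. Qed.

(** A coinvariant is fixed by the torus and killed by the raising operator, the two conditions that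
    [chart_elim] asks for. *)
Lemma chart_coinv c R p y : A R -> (forall x, x \in [:: chart_u c; chart_v c; chart_w c; chart_x c] -> qcomm x R) ->
  (exists d e, p = d *: 1 + e *: R) -> chart_v c * chart_u c = chart_al c *: (chart_u c * chart_v c) ->
  chart_x c * chart_w c = (chart_al c)^-1 *: (chart_w c * chart_x c) -> chart_v c * chart_x c = p - chart_u c * chart_w c ->
  aspan A (chart_mono (chart_u c) (chart_v c) (chart_w c) (chart_x c)) y -> rcoinv RI y -> A y.
Proof.
move=> AR Rc pE vu xw vx ys cy.
have c3 : (chart_idx c < 3)%N by exact: ltn_trans (cidx2 c) _.
have [k kE] := oper_rmorphism (rep_coef_linear q0 hU true 2 2) (fun x y => rep_coef_diagM q0 hU true x y (isT : (2 < 3)%N))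
  (rep_coef_diag1 q0 hU true (isT : (2 < 3)%N)).
have [g gE] := oper_rmorphism (rep_coef_linear q0 hU true (chart_idx c) (chart_idx c)) (fun x y => rep_coef_diagM q0 hU true x y c3)
  (rep_coef_diag1 q0 hU true c3).
have [th [th1 thl thM thT [thS thR]]] := torus_exists q0 hU.
have thA : forall u, u \in lspan RI -> th u = 0 by exact/ideal_R_kill/thR.
have thco x : rcoinv RI x -> oper (th : U -> K) x = x.
  by move=> cox; rewrite (oper_coinv thl _ thA cox) ?th1 ?scale1r //; exact: R_closed.
have q1 : q^-1 != 0 by rewrite invr_neq0.
have lett x : x \in [:: chart_u c; chart_v c; chart_w c; chart_x c] -> chart (chart_idx c) x /\ qcomm x R.
  by move=> xl; split; [exact: chart_letter | exact: Rc].
have [[Cu uR] [Cv vR]] : (chart (chart_idx c) (chart_u c) /\ qcomm (chart_u c) R) /\ (chart (chart_idx c) (chart_v c) /\ qcomm (chart_v c) R).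
  by split; apply: lett; rewrite !inE eqxx ?orbT.
have [[Cw wR] [Cx xR]] : (chart (chart_idx c) (chart_w c) /\ qcomm (chart_w c) R) /\ (chart (chart_idx c) (chart_x c) /\ qcomm (chart_x c) R).
  by split; apply: lett; rewrite !inE eqxx ?orbT.
have [Eu Ev Ew Ex] := cletter_E c; have [Fu Fv Fw Fx] := cletter_F c.
have [ku kv kw kx] := cletter_K c; have [gu gv gw gx] := cletter_G c.
have H := (@chart_elim _ _ A (chart (chart_idx c)) (chart_al c) (chart_et c) (chart_u c) (chart_v c) (chart_w c) (chart_x c) R p A1 AZD AM AR
  (chart1 (cidx2 c)) (fun x y => @chartM _ x y (cidx2 c)) Cu Cv Cw Cx _ _ vu xw vx uR vR pE
  (Eop c) (Fop c) (oper (th : U -> K)) k g (skew_X _ kE gE) (skew_X _ kE gE) Eu Ev Ew Ex Fu Fv Fw Fx).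
have thl' : forall c u v, (th : U -> K) (c *: u + v) = c * (th : U -> K) u + (th : U -> K) v by exact: thl.
have thM' : forall u v, (th : U -> K) (u * v) = (th : U -> K) u * (th : U -> K) v by exact: thM.
have thletter : [/\ oper (th : U -> K) (chart_u c) = 2 *: chart_u c, oper (th : U -> K) (chart_v c) = 2^-1 *: chart_v c,
    oper (th : U -> K) (chart_w c) = 2^-1 *: chart_w c & oper (th : U -> K) (chart_x c) = 2 *: chart_x c].
  split; case: (c); rewrite /chart_u /chart_v /chart_w /chart_x ?(oper_Z hU) ?(oper_Zs hU) // ?thT ?thS //=;
    by rewrite /tval /= ?mul0r ?scale0r ?addr0 ?add0r ?mul1r ?invrK.
have [thu thv thw thx] := thletter.
apply: H => //.
- by case: (c).
- by case: (c); rewrite /chart_et ?oner_neq0.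
- by rewrite kE.
- by rewrite kE.
- by rewrite kE.
- by rewrite kE.
- by rewrite gE.
- by rewrite gE.
- by rewrite gE.
- by rewrite gE.
- exact: operD thl'.
- exact: operZ thl'.
- exact: oper_charM thl' thM'.
- exact: oper_char1 thl' th1.
- by move=> a /Aco; exact: thco.
- by move=> n; apply/qn_real_neq0/cal_real.
- exact: thco.
- by rewrite /Eop X_coinv ?scaler0.
Qed.
End Charts.

(** * Generation of the 4-sphere *)

Section Localization.
Context {K : fieldType} {U : algType K} (A P Phi : U -> Prop).
Hypotheses (A1 : A 1) (AZD : forall c x y, A x -> A y -> A (c *: x + y)).
Hypotheses (AM : forall x y, A x -> A y -> A (x * y)).
Hypotheses (PhiA : forall f, Phi f -> A f) (PhiC : forall f g, Phi f -> Phi g -> f * g = g * f).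

(* x lies in the localization at Phi of the A-module spanned by P. *)
Definition loc (x : U) := exists2 s : seq U, forall f, f \in s -> Phi f & aspan A P (\prod_(f <- s) f * x).

Lemma prod_A (s : seq U) : (forall f, f \in s -> Phi f) -> A (\prod_(f <- s) f).
Proof.
move=> sP; rewrite big_seq; apply: big_ind => // f fs; exact/PhiA/sP.
Qed.

Lemma prod_comm (s s' : seq U) : (forall f, f \in s -> Phi f) -> (forall f, f \in s' -> Phi f) ->
  \prod_(f <- s) f * \prod_(f <- s') f = \prod_(f <- s') f * \prod_(f <- s) f.
Proof.
move=> sP sP'; have comm1 f : Phi f -> f * \prod_(g <- s') g = \prod_(g <- s') g * f.
  move=> Pf; elim: s' sP' => [|g s' IH] sP'; first by rewrite big_nil mulr1 mul1r.
  have Pg : Phi g by apply: sP'; exact: mem_head.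
  rewrite big_cons mulrA (PhiC Pf Pg) -!mulrA IH // => h hs.
  by apply: sP'; rewrite inE hs orbT.
elim: s sP => [|f s IH] sP; first by rewrite big_nil mulr1 mul1r.
have Pf : Phi f by apply: sP; exact: mem_head.
rewrite big_cons mulrA -(comm1 f Pf) -!mulrA IH // => h hs.
by apply: sP; rewrite inE hs orbT.
Qed.

Lemma loc_span x : aspan A P x -> loc x.
Proof. by move=> xP; exists [::] => //; rewrite big_nil mul1r. Qed.

Lemma locZ c x : loc x -> loc (c *: x).
Proof. by move=> [s sP sx]; exists s => //; rewrite -scalerAr; exact: aspanZ. Qed.

Lemma locD x y : loc x -> loc y -> loc (x + y).
Proof.
move=> [s sP sx] [s' sP' sy]; exists (s ++ s').
  by move=> f; rewrite mem_cat => /orP[/sP|/sP'].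
rewrite big_cat /= mulrDr; apply: aspanD => //.
  rewrite prod_comm // -mulrA; apply: aspanM => //; exact: prod_A.
by rewrite -mulrA; apply: aspanM => //; exact: prod_A.
Qed.

Lemma loc_factor f x : Phi f -> loc (f * x) -> loc x.
Proof.
move=> Pf [s sP sx]; exists (s ++ [:: f]).
  by move=> g; rewrite mem_cat inE => /orP[/sP|/eqP ->].
by rewrite big_cat /= big_seq1 -mulrA.
Qed.

Lemma loc_factors s x : (forall f, f \in s -> Phi f) -> loc (\prod_(f <- s) f * x) -> loc x.
Proof.
move=> sP [s' sP' sx]; exists (s' ++ s); last by rewrite big_cat /= -mulrA.
by move=> f; rewrite mem_cat => /orP[/sP'|/sP].
Qed.

(** The condition on g is an Ore condition up to a scalar: a denominator moved past g becomes
    another denominator. *)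
Lemma loc_lmul g : A g -> (forall f, Phi f -> exists2 f', Phi f' & exists c, f' * g = c *: (g * f)) ->
  forall x, loc x -> loc (g * x).
Proof.
move=> Ag gP x [s sP sx].
have [s' sP' [c sE]] : exists2 s', forall f, f \in s' -> Phi f &
    exists c, \prod_(f <- s') f * g = c *: (g * \prod_(f <- s) f).
  elim: s sP {sx} => [|f s IH] sP.
    by exists [::] => //; exists 1; rewrite !big_nil mul1r mulr1 scale1r.
  have [|s' sP' [c sE]] := IH; first by move=> h hs; apply: sP; rewrite inE hs orbT.
  have [f' Pf' [d fE]] := gP f (sP f (mem_head _ _)).
  exists (f' :: s') => [h|]; first by rewrite inE => /orP[/eqP ->|/sP'].
  exists (c * d); rewrite !big_cons -mulrA sE -scalerAr [f' * (g * _)]mulrA fE -scalerAl scalerA.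
  by rewrite mulrA.
exists s' => //; rewrite mulrA sE -scalerAl -mulrA; apply: aspanZ => //; exact: aspanM.
Qed.

Lemma loc_inner g : (forall y, aspan A P y -> aspan A P (y * g)) -> forall x, loc x -> loc (x * g).
Proof. by move=> gP x [s sP sx]; exists s => //; rewrite mulrA; exact: gP. Qed.

(** A letter g outside the chart moves to the left of a monomial up to a scalar, and there a
    denominator turns it into an element of the span. *)
Lemma loc_outer g : (forall a x, A a -> loc x -> loc (a * x)) -> (forall m, P m -> qcomm m g) ->
  (forall m, P m -> exists2 f, Phi f & aspan A P (f * g * m)) ->
  forall x, loc x -> loc (x * g).
Proof.
move=> locA Pg gP x [s sP sx]; apply: loc_factors sP _; rewrite mulrA.
move: sx; move: (_ * x); apply: aspan_ind => [|y z ly lz|a m Aa Pm].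
- by rewrite mul0r; apply: loc_span; exact: aspan0.
- by rewrite mulrDl; exact: locD.
- have [c mg] := Pg m Pm; rewrite -mulrA mg -scalerAr; apply: locZ; apply: locA => //.
  have [f Pf fgm] := gP m Pm; apply: (loc_factor Pf); apply: loc_span; rewrite mulrA; exact: fgm.
Qed.
End Localization.

Section CommutingIdentities.
Context {K : fieldType} {U : algType K} (r g : U).
Hypothesis gr : g * r = r * g.

Lemma comm_step (d : K) : (d *: 1 + g - d *: (r * g)) * r = r * (d *: 1 + g - d *: (r * g)).
Proof.
rewrite mulrBl mulrBr mulrDl mulrDr -!scalerAl -!scalerAr mul1r mulr1 gr.
by rewrite -[r * g * r]mulrA gr.
Qed.

Lemma denominator_step (d : K) : (1 - d *: r) * (1 - r * g) = 1 - r * (d *: 1 + g - d *: (r * g)).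
Proof.
rewrite mulrBl mul1r mulrBr mulr1 -scalerAl mulrBr mulrDr -!scalerAr mulr1.
by rewrite !opprB addrACA [RHS]addrA opprD [- (d *: r) - _]addrC.
Qed.

Lemma localization_step (x : U) n : r ^+ n * x = r ^+ n * ((1 - r * g) * x) + g * (r ^+ n.+1 * x).
Proof.
have gX : g * r ^+ n.+1 = r ^+ n.+1 * g by exact: commrX.
rewrite (mulrA g) gX exprSr mulrBl mul1r mulrBr !mulrA subrK; reflexivity.
Qed.
End CommutingIdentities.

Section Generation.
Context {K : numClosedFieldType} (q : K) (U : hopfStarAlg K) (t : 'I_4 -> 'I_4 -> U) (Dinv : U).
Hypotheses (q0 : q != 0) (qR : q^* = q) (hU : is_Uq4 q t Dinv).
Local Notation Z := (zcoord t).
Local Notation Zs := (zstar t).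
Local Notation RI := (ideal_R q t).
Local Notation Rr := (sphere_r t).
Local Notation aa := (sphere_a t).
Local Notation aas := (sphere_as t).
Local Notation bb := (sphere_b q t).
Local Notation bbs := (sphere_bs q t).
Local Notation cu := (chart_u t).
Local Notation cv := (chart_v t).
Local Notation cw := (chart_w t).
Local Notation cx := (chart_x t).
Local Notation cal := (chart_al q).
Local Notation zenv := (zletter t).

(** The structure constants of the chart follow: [cp] for v x in [chart_vx], [cp2] and [cth] for x v
    in [chart_xv], [cph] and [cph0] for w u in [chart_wu]. *)
Definition cp c := if c then 1 - Rr else Rr.
Definition cp2 c := if c then 1 - q ^+ 2 *: Rr else Rr.
Definition cph c : K := if c then q ^+ 2 else 1.
Definition cph0 c : K := if c then 1 - q ^+ 2 else 0.
Definition cth c : K := if c then 1 else q ^+ 2.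

Lemma sum_split : Rr + Z 2 * Zs 2 + Z 3 * Zs 3 = 1.
Proof. by rewrite -(sum_ZZs hU) !big_ord_recr big_ord0 /= add0r. Qed.

Lemma chart_vu c : cv c * cu c = cal c *: (cu c * cv c).
Proof.
by case: c; [rewrite /chart_v /chart_u /= (Z_Z hU (i := 2) (j := 3)) | exact: (Z_Zr q0 hU)].
Qed.

Lemma chart_xw c : cx c * cw c = (cal c)^-1 *: (cw c * cx c).
Proof.
case: c; rewrite /chart_x /chart_w /chart_al /=.
  by rewrite (Zs_Zs qR hU (i := 2) (j := 3)) // scalerA mulVf ?scale1r.
by rewrite invrK (Zs_Zs qR hU (i := 0) (j := 1)).
Qed.

Lemma chart_vx c : cv c * cx c = cp c - cu c * cw c.
Proof.
case: c; rewrite /chart_v /chart_x /chart_u /chart_w /cp /=.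
  by rewrite -[in RHS]sum_split -(addrA Rr) (addrC Rr) !addrK.
by rewrite /sphere_r addrC addrA addNr add0r.
Qed.

Lemma chart_wu c : cw c * cu c = cph c *: (cu c * cw c) + cph0 c *: 1.
Proof.
case: c; rewrite /chart_w /chart_u /cph /cph0 /= (ZsZ q0 hU) //.
  have -> : \sum_(j < 3) Z j * Zs j = 1 - Z 3 * Zs 3.
    by rewrite -sum_split addrK !big_ord_recr big_ord0 /= add0r.
  rewrite scalerBr addrCA -[X in _ + (X - _)]scale1r addrC -scalerBl; congr (_ *: _ + _).
  by rewrite opprB addrC subrK.
by rewrite big_ord0 scaler0 scale0r scale1r.
Qed.

Lemma chart_xv c : cx c * cv c = cp2 c - cth c *: (cu c * cw c).
Proof.
case: c; rewrite /chart_x /chart_v /chart_u /chart_w /cp2 /cth /= (ZsZ q0 hU) //.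
  rewrite scale1r !big_ord_recr big_ord0 /= add0r -/Rr scalerBl scale1r.
  rewrite -[in RHS]sum_split -[in RHS](addrAC _ (- _)) addrK.
  by rewrite addrA [Z 2 * _ + _]addrC.
rewrite big_ord1 scalerBl scale1r addrA /sphere_r [Z 1 * _ + _]addrC; reflexivity.
Qed.

Lemma chart_wv c : qcomm (cw c) (cv c).
Proof. by case: c; exists q; exact: (Zs_Z q0 hU). Qed.

Lemma chart_xu c : qcomm (cx c) (cu c).
Proof. by case: c; exists q; exact: (Zs_Z q0 hU). Qed.

Lemma qcomm_sym (x y : U) c : c != 0 -> x * y = c *: (y * x) -> qcomm y x.
Proof. by move=> c0 e; exists c^-1; rewrite e scalerA mulVf ?scale1r. Qed.

Lemma cal0 c : cal c != 0.
Proof. by case: c; rewrite /chart_al ?invr_neq0. Qed.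

Lemma chart_wx c : qcomm (cw c) (cx c).
Proof. by apply: qcomm_sym (chart_xw c); rewrite invr_eq0 cal0. Qed.

(** The codes of u, v, w, x in this order; [inner (~~ c)] holds the letters outside the chart. *)
Definition inner (c : bool) := if c then [:: 3; 2; 7; 6]%N else [:: 0; 1; 4; 5]%N.

Lemma qcomm_zenv i j : (i < 8)%N -> (j < 8)%N -> (i %% 4 != j %% 4)%N -> qcomm (zenv i) (zenv j).
Proof.
move=> i8 j8 ij; rewrite /zletter; case: ltnP => i4; case: ltnP => j4.
- exact: (qcomm_Z q0 hU).
- exists q^-1; apply: (Z_Zs q0 hU) => //; lia.
- exists q; apply: (Zs_Z q0 hU) => //; lia.
- have [lt|le] := ltnP (j - 4) (i - 4).
    exists q; apply: (Zs_Zs qR hU); lia.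
  apply: (@qcomm_sym _ _ q) => //; apply: (Zs_Zs qR hU); lia.
Qed.

Lemma inner_outer c i j : i \in inner c -> j \in inner (~~ c) -> qcomm (zenv i) (zenv j).
Proof.
by move=> ic jc; apply: qcomm_zenv; move: ic jc; case: c; rewrite !inE => /or4P[]/eqP ic /or4P[]/eqP jc; rewrite ?ic ?jc.
Qed.

Lemma letters_inner c : [:: cu c; cv c; cw c; cx c] = map zenv (inner c).
Proof. by case: c. Qed.

Lemma letter_R c x : x \in [:: cu c; cv c; cw c; cx c] -> qcomm x Rr.
Proof.
rewrite letters_inner => /mapP[i ic ->]; have i8 : (i < 8)%N by move: ic; case: c; rewrite !inE => /or4P[]/eqP ->.
have [d d0 dE] := Rr_letter q0 qR hU i8; exact: qcomm_sym d0 dE.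
Qed.

Lemma cpE c : exists d e, cp c = d *: 1 + e *: Rr.
Proof.
by case: c; [exists 1, (-1) | exists 0, 1]; rewrite ?scaleN1r ?scale1r ?scale0r ?add0r.
Qed.

Lemma cp2E c : exists d e, cp2 c = d *: 1 + e *: Rr.
Proof.
by case: c; [exists 1, (- q ^+ 2) | exists 0, 1]; rewrite ?scaleNr ?scale1r ?scale0r ?add0r.
Qed.

Definition coinv_gens : seq U := [:: aa; aas; bb; bbs; Rr].
Local Notation A := (gen_subalg (fun y => y \in coinv_gens)).
Local Notation AZD := (@galgZD _ _ (fun y => y \in coinv_gens)).
Local Notation AM := (@galgM _ _ (fun y => y \in coinv_gens)).
Local Notation A1 := (@galg1 _ _ (fun y => y \in coinv_gens)).
Local Notation mono c := (chart_mono (cu c) (cv c) (cw c) (cx c)).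

Lemma A_gen y : y \in coinv_gens -> A y.
Proof. exact: galg_gen. Qed.

Lemma A_R : A Rr.
Proof. by apply: A_gen; rewrite !inE eqxx !orbT. Qed.

Lemma A_rcoinv x : A x -> rcoinv RI x.
Proof.
move: x; apply: galg_ind => [|c x y|x y|x].
- exact: rcoinv1.
- exact: rcoinvZD.
- by apply: rcoinvM; exact: R_closed.
rewrite !inE => /or4P[/eqP->|/eqP->|/eqP->|/orP[/eqP->|/eqP->]].
- by have := rcoinv_a hU; rewrite scaleN1r.
- by have := rcoinv_as hU; rewrite scaleN1r.
- exact: (rcoinv_b q0 hU).
- exact: (rcoinv_bs q0 hU).
- by have := rcoinv_r hU; rewrite scale1r.
Qed.

Lemma letter_mem c i : i \in inner c -> zenv i \in [:: cu c; cv c; cw c; cx c].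
Proof. by move=> ic; rewrite letters_inner; exact: map_f. Qed.

Lemma span_letter c i y : i \in inner c -> aspan A (mono c) y -> aspan A (mono c) (y * zenv i).
Proof.
have [[uR vR] [wR xR]] : (qcomm (cu c) Rr /\ qcomm (cv c) Rr) /\ (qcomm (cw c) Rr /\ qcomm (cx c) Rr).
  by split; split; apply: (@letter_R c); rewrite !inE eqxx ?orbT.
have xwc : qcomm (cx c) (cw c) by exists (cal c)^-1; exact: chart_xw.
move=> /letter_mem; rewrite !inE => /or4P[]/eqP -> ys.
- exact: (span_u A1 AZD AM (chart_vu c) (chart_xu c) (chart_wu c)).
- exact: (span_v A1 AZD AM A_R (chart_vu c) (chart_wv c) (chart_xu c) xwc (chart_wu c) (chart_xv c) uR wR xR (cp2E c)).
- exact: (span_w A1 AZD AM xwc).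
- exact: (span_x A1 AZD AM A_R (chart_vu c) xwc (chart_wx c) (chart_vx c) uR vR (cpE c)).
Qed.

(** The letter lies in the span, and the monomial is multiplied back onto it from the right one
    power at a time, so [span_letter] suffices. *)
Lemma span_lmul c i m : i \in inner c -> mono c m -> aspan A (mono c) (zenv i * m).
Proof.
have one : aspan A (mono c) 1.
  by apply: (aspan_gen A1); exists 0%N, 0%N, 0%N; left; rewrite /mono_uvw !expr0 !mulr1.
have spanX j n y : j \in inner c -> aspan A (mono c) y -> aspan A (mono c) (y * zenv j ^+ n).
  move=> jc ys; elim: n => [|n IH]; first by rewrite expr0 mulr1.
  by rewrite exprSr mulrA; exact: span_letter.
move=> ic; have zi : aspan A (mono c) (zenv i) by rewrite -[zenv i]mul1r; exact: span_letter.
move=> [n1 [n2 [n3 [->|->]]]]; rewrite /mono_uvw /mono_uwx !mulrA; case: (c) ic one spanX zi => ic one spanX zi.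
- by apply: (spanX 7%N) => //; apply: (spanX 2%N) => //; apply: (spanX 3%N).
- by apply: (spanX 4%N) => //; apply: (spanX 1%N) => //; apply: (spanX 0%N).
- by apply: (spanX 6%N) => //; apply: (spanX 7%N) => //; apply: (spanX 3%N).
- by apply: (spanX 5%N) => //; apply: (spanX 4%N) => //; apply: (spanX 0%N).
Qed.

Lemma mono_qcomm c m j : mono c m -> j \in inner (~~ c) -> qcomm m (zenv j).
Proof.
move=> cm jc.
have qX i n : i \in inner c -> qcomm (zenv i ^+ n) (zenv j).
  by move=> ic; apply/qcommXl/(inner_outer ic).
move: cm => [n1 [n2 [n3 [->|->]]]]; rewrite /mono_uvw /mono_uwx; case: (c) qX => qX.
- by apply: qcommMl; [apply: qcommMl; [exact: (qX 3%N) | exact: (qX 2%N)] | exact: (qX 7%N)].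
- by apply: qcommMl; [apply: qcommMl; [exact: (qX 0%N) | exact: (qX 1%N)] | exact: (qX 4%N)].
- by apply: qcommMl; [apply: qcommMl; [exact: (qX 3%N) | exact: (qX 7%N)] | exact: (qX 6%N)].
- by apply: qcommMl; [apply: qcommMl; [exact: (qX 0%N) | exact: (qX 4%N)] | exact: (qX 5%N)].
Qed.

(** Moving 1 - s R past a generator rescales s, hence a whole family of denominators instead of 1 -
    q^2 R alone. *)
Definition denominator (c : bool) (f : U) := if c then exists s, f = 1 - s *: Rr else f = Rr.

Lemma denominator_A c f : denominator c f -> A f.
Proof.
case: c => [[s ->]|->]; last exact: A_R.
by rewrite addrC -scaleNr; apply: galgZD; [exact: A_R | exact: galg1].
Qed.

Lemma denominator_comm c f g : denominator c f -> denominator c g -> f * g = g * f.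
Proof.
case: c => [[s ->] [s' ->]|-> -> //].
rewrite !(mulrBl, mulrBr, mul1r, mulr1) -!scalerAl -!scalerAr !scalerA mulrC.
by rewrite !opprB addrACA [RHS]addrACA; congr (_ + _); exact: addrC.
Qed.

Local Notation locc c := (loc A (mono c) (denominator c)).

Lemma loc_A c a x : A a -> locc c x -> locc c (a * x).
Proof.
move=> Aa; move: x; move: a Aa; apply: galg_ind => [|d a b IHa IHb|a b IHa IHb|g gin] x lx.
- by rewrite mul1r.
- rewrite mulrDl -scalerAl; apply: (locD A1 AM (@denominator_A c) (@denominator_comm c)).
    by apply: (locZ A1 AZD AM); exact: IHa.
  exact: IHb.
- by rewrite -mulrA; apply/IHa/IHb.
apply: (loc_lmul A1 AZD AM) lx; first exact: A_gen.
have [d d0 gR] : exists2 d, d != 0 & Rr * g = d *: (g * Rr).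
  move: gin; rewrite !inE => /or4P[/eqP->|/eqP->|/eqP->|/orP[/eqP->|/eqP->]].
  - by exists (q ^- 2); [rewrite invr_eq0 expf_neq0 | exact: (Ra q0 qR hU)].
  - by exists (q ^+ 2); [rewrite expf_neq0 | exact: (Ras q0 qR hU)].
  - by exists (q ^+ 2); [rewrite expf_neq0 | exact: (Rb q0 qR hU)].
  - by exists (q ^- 2); [rewrite invr_eq0 expf_neq0 | exact: (Rbs q0 qR hU)].
  - by exists 1; rewrite ?oner_neq0 // scale1r.
move=> f; case: c => [[s ->]|->]; last by exists Rr => //; exists d.
exists (1 - (s / d) *: Rr); first by exists (s / d).
exists 1; rewrite scale1r mulrBl mulrBr mul1r mulr1 -scalerAl gR scalerA -mulrA mulVf // mulr1.
by rewrite scalerAr.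
Qed.

Lemma outer_reduce c j m : j \in inner (~~ c) -> mono c m ->
  exists2 f, denominator c f & aspan A (mono c) (f * zenv j * m).
Proof.
move=> jc cm.
have pair c1 c2 i1 i2 g1 g2 f : i1 \in inner c -> i2 \in inner c ->
    g1 \in [:: aa; aas; bb; bbs] -> g2 \in [:: aa; aas; bb; bbs] ->
    f * zenv j = c1 *: (g1 * zenv i1) + c2 *: (g2 * zenv i2) -> aspan A (mono c) (f * zenv j * m).
  have gA g : g \in [:: aa; aas; bb; bbs] -> A g.
    by move=> gg; apply: A_gen; move: gg; rewrite !inE => /or4P[]->; rewrite ?orbT.
  move=> ic1 ic2 gg1 gg2 ->; rewrite mulrDl -!scalerAl -!mulrA.
  by apply: aspanD; apply: (aspanZ A1 AZD AM); apply: (aspanM AM); [exact: gA | exact: span_lmul | exact: gA | exact: span_lmul].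
case: c jc cm pair => jc cm pair.
  have [|c1 [c2 [i1 [i2 [ic1 ic2 [g1 [g2 [gg1 gg2 e]]]]]]]] := @Rr_outer2 _ q _ t _ q0 qR hU j.
    exact: jc.
  exists (1 - q ^+ 2 *: Rr); first by exists (q ^+ 2).
  apply: pair gg1 gg2 e; [move: ic1 | move: ic2]; by rewrite !inE => /or4P[]/eqP ->.
have [|c1 [c2 [i1 [i2 [ic1 ic2 [g1 [g2 [gg1 gg2 e]]]]]]]] := @Rr_outer1 _ q _ t _ q0 qR hU j.
  by move: jc; rewrite !inE => /or4P[]/eqP ->.
exists Rr => //; exact: pair gg1 gg2 e.
Qed.

Lemma loc_letter c i x : (i < 8)%N -> locc c x -> locc c (x * zenv i).
Proof.
move=> i8; have [ic|ic] := boolP (i \in inner c).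
  apply: loc_inner => y; exact: span_letter.
have ic' : i \in inner (~~ c) by move: i8 ic; case: c; move: i => [|[|[|[|[|[|[|[|]]]]]]]].
apply: (loc_outer A1 AZD AM (@denominator_A c) (@denominator_comm c)).
- by move=> a y; exact: loc_A.
- by move=> m cm; exact: mono_qcomm cm ic'.
- by move=> m; exact: outer_reduce.
Qed.

Lemma B_loc c y : gen_subalg (zgen t) y -> locc c y.
Proof.
move=> By; suff H : forall x, locc c x -> locc c (x * y).
  rewrite -[y]mul1r; apply: H; apply: loc_span; apply: (aspan_gen A1).
  by exists 0%N, 0%N, 0%N; left; rewrite /mono_uvw !expr0 !mulr1.
move: y By; apply: galg_ind => [|d y z IHy IHz|y z IHy IHz|y [i i4 yE]] x lx.
- by rewrite mulr1.
- rewrite mulrDr -scalerAr; apply: (locD A1 AM (@denominator_A c) (@denominator_comm c)).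
    by apply: (locZ A1 AZD AM); exact: IHy.
  exact: IHz.
- by rewrite mulrA; apply/IHz/IHy.
(* The code of the letter y is i for z and i + 4 for z^*. *)
have := @loc_letter c (if `[< y = Z i >] then i else (i + 4)%N) x; rewrite /zletter.
case: asboolP => yZ; first by rewrite i4 yZ; apply => //; rewrite (ltn_trans i4).
rewrite [(_ < 4)%N]ltnNge leq_addl addnK; case: yE => [//|->]; apply=> //.
by rewrite -[8%N]/(4 + 4)%N ltn_add2r.
Qed.

Lemma chart_A c x : gen_subalg (zgen t) x -> rcoinv RI x ->
  exists2 s : seq U, forall f, f \in s -> denominator c f & A (\prod_(f <- s) f * x).
Proof.
move=> /(B_loc c) [s sP sx] cx; exists s => //.
apply: (chart_coinv q0 qR hU A1 AZD AM A_rcoinv A_R (@letter_R c) (cpE c)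
  (chart_vu c) (chart_xw c) (chart_vx c) sx).
apply: rcoinvM => //; first exact: R_closed.
apply: A_rcoinv; apply: (prod_A A1 AM) sP; exact: denominator_A.
Qed.

(** R and 1 - R g are comaximal: R^n x = R^n (1 - R g) x + g R^(n+1) x lowers the exponent of R step
    by step to 0. *)
Lemma Rr_localization (x : U) n g : A g -> g * Rr = Rr * g -> A (Rr ^+ n * x) ->
  A ((1 - Rr * g) * x) -> A x.
Proof.
move=> Ag gR; elim: n => [|n IH]; first by rewrite expr0 mul1r.
move=> An Af; apply: IH => //.
rewrite (localization_step gR x n); apply: galgD; apply: galgM => //; apply: galgX; exact: A_R.
Qed.

Lemma denominators_true (s : seq U) : (forall f, f \in s -> denominator true f) ->
  exists g, [/\ A g, g * Rr = Rr * g & \prod_(f <- s) f = 1 - Rr * g].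
Proof.
elim: s => [|f s IH] sP.
  by exists 0; rewrite big_nil !(mulr0, mul0r) subr0; split=> //; exact: galg0.
have [|g [Ag gR sE]] := IH; first by move=> h hs; apply: sP; rewrite inE hs orbT.
have [d fE] := sP f (mem_head _ _); exists (d *: 1 + g - d *: (Rr * g)); split.
- apply: galgB; first by apply: galgZD; [exact: galg1 | exact: Ag].
  by apply: galgZ; apply: galgM; [exact: A_R | exact: Ag].
- exact: comm_step.
- by rewrite big_cons sE fE; exact: denominator_step.
Qed.

Lemma coinv_A x : gen_subalg (zgen t) x -> rcoinv RI x -> A x.
Proof.
(* The denominators of the first chart multiply to a power of R, those of the second to some 1 - R
   g. *)
move=> Bx cx; have [s sP sA] := chart_A false Bx cx.
have [s' sP' sA'] := chart_A true Bx cx; have [g [Ag gR gE]] := denominators_true sP'.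
apply: (Rr_localization (n := size s) Ag gR); last by rewrite -gE.
have -> : Rr ^+ size s = \prod_(f <- s) f => //.
elim: s sP {sA} => [|f s IH] sP; first by rewrite big_nil expr0.
rewrite big_cons exprS IH => [|h hs]; last by apply: sP; rewrite inE hs orbT.
by rewrite (sP f (mem_head _ _)).
Qed.
End Generation.

Local Open Scope complex_scope.

Theorem proposition6 (R : realType) (q : R) (hq : q != 0)
    (U : hopfStarAlg R[i]) (t : 'I_4 -> 'I_4 -> U) (Dinv : U)
    (hU : is_Uq4 q%:C t Dinv) :
  let z (i : nat) : U := t (idx 4) (idx i) in
  let qC : R[i] := q%:C in
  let a := z 1%N * star (z 4%N) - z 2%N * star (z 3%N) in
  let b := z 1%N * z 3%N + qC^-1 *: (z 2%N * z 4%N) in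
  let r := z 1%N * star (z 1%N) + z 2%N * star (z 2%N) in
  (forall x : U, sphere4 qC t x <->
     gen_subalg (fun y => y \in [:: a; star a; b; star b; r]) x)
  /\ [/\ r * a = qC ^- 2 *: (a * r),
         r * b = qC ^+ 2 *: (b * r),
         a * b = qC ^+ 3 *: (b * a)
       & a * star b = qC^-1 *: (star b * a)]
  /\ a * star a + qC ^+ 2 *: (b * star b) = r * (1 - qC ^+ 2 *: r)
  /\ a * star a = qC ^+ 2 *: (star a * a) + (1 - qC ^+ 2) *: r ^+ 2
  /\ star b * b = qC ^+ 4 *: (b * star b) + (1 - qC ^+ 2) *: r.
Proof.
move=> z qC a b r.
have q0 : qC != 0 by rewrite /qC eq_complex /= eqxx andbT.
have qR : Num.conj qC = qC by apply/eqP; rewrite eq_complex /= oppr0 !eqxx.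
have zE i : z i.+1 = zcoord t i by [].
have starN x : star (- x) = - star x :> U by rewrite -scaleN1r hopf_starZ rmorphN1 scaleN1r.
have aE : a = sphere_a t by rewrite /a !zE !(star_Z hU).
have saE : star a = sphere_as t.
  by rewrite aE /sphere_a hopf_starD starN !hopf_starM !(star_Z hU) !(star_Zs hU).
have bE : b = sphere_b qC t by [].
have sbE : star b = sphere_bs qC t.
  by rewrite bE /sphere_b hopf_starD hopf_starZ !hopf_starM !(star_Z hU) fmorphV /= qR.
have rE : r = sphere_r t by rewrite /r !zE !(star_Z hU).
split; last first.
  rewrite sbE saE aE bE rE; split; first split.
  - exact: (Ra q0 qR hU).
  - exact: (Rb q0 qR hU).
  - exact: (aabb q0 qR hU).
  - exact: (aabbs q0 qR hU).
  split; first exact: (aaas_bbbs q0 qR hU).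
  split; first exact: (aaas q0 qR hU).
  exact: (bbsbb q0 qR hU).
rewrite saE sbE aE bE rE => x; split.
  by move=> [x7 xr]; apply: (coinv_A q0 qR hU) => //; exact: (sphere7_B q0 qR hU x7).
move=> Ax; split; last exact: (A_rcoinv q0 hU Ax).
apply: (B_sphere7 hU); move: x Ax; apply: galg_ind => [|c x y|x y|x].
- exact: galg1.
- exact: galgZD.
- exact: galgM.
have BZ i : (i < 4)%N -> gen_subalg (zgen t) (zcoord t i) by exact: B_Z.
have BZs i : (i < 4)%N -> gen_subalg (zgen t) (zstar t i) by exact: B_Zs.
rewrite !inE => /or4P[/eqP->|/eqP->|/eqP->|/orP[/eqP->|/eqP->]].
- by apply: galgB; apply: galgM; [exact: BZ | exact: BZs | exact: BZ | exact: BZs].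
- by apply: galgB; apply: galgM; [exact: BZ | exact: BZs | exact: BZ | exact: BZs].
- by apply: galgD; [|apply: galgZ]; apply: galgM; exact: BZ.
- by apply: galgD; [|apply: galgZ]; apply: galgM; exact: BZs.
- by apply: galgD; apply: galgM; [exact: BZ | exact: BZs | exact: BZ | exact: BZs].
Qed.
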